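(* The AEMFP with one homologous edge set and a piecewise polynomial concave deviation function $\Delta$ whose pieces have degree at most $q$ can be solved in polynomial time, namely in time $O\big(mq\cdot(nm\cdot(n+2m+n^2)\,T_{MF}(n,n+m))\big)$, under the assumption that the roots of a polynomial of degree at most $q$ can be computed in constant time $O(1)$. Here $n=|V|$, $m=|E|$ and $T_{MF}(n',m')$ denotes the time to compute a maximum flow in a graph with $n'$ nodes and $m'$ edges.
   Context: An instance of the AEMFP consists of a directed graph $G=(V,E)$, non-negative edge capacities $u$, a source $s$, a sink $t\neq s$, homologous edge sets $R_1,\dots,R_k\subseteq E$ and monotonically increasing deviation functions $\Delta_1,\dots,\Delta_k$. A flow $f\colon E\to\mathbb{R}$ is an almost equal $s$-$t$-flow if $0\le f\le u$, flow conservation holds at all $v\in V\setminus\{s,t\}$, $f(\delta^+(s))-f(\delta^-(s))\ge 0$, $f(\delta^+(t))-f(\delta^-(t))\le 0$, and for every $i$, with $f_i:=\min_{e\in R_i}f(e)$, one has $f_i\le f(e)\le\Delta_i(f_i)$ for all $e\in R_i$. Its value is $f(\delta^+(s))-f(\delta^-(s))$, to be maximized (fractional version, real-valued flows).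
   Formalization: The formal time bound adds p(q+1), the length of the description of Δ with p pieces, to the stated formula inside the O(·), since no bound independent of p can hold when Δ is given by its pieces; it also takes q ≥ 1, as the formula vanishes for q = 0. *)

(* Defs.v *)
From HB Require Import structures.
From mathcomp Require Import all_boot all_order all_algebra.
From mathcomp Require Import reals.

Set Implicit Arguments.
Unset Strict Implicit.
Unset Printing Implicit Defensive.

Import Order.TTheory GRing.Theory Num.Theory.
Local Open Scope ring_scope.

(* Nodes are 'I_n and edges are 'I_m, so that parallel edges and loops are
   allowed. *)
Record network (R : realType) (n m : nat) := Network {
  tail : {ffun 'I_m -> 'I_n};
  head : {ffun 'I_m -> 'I_n};
  cap : {ffun 'I_m -> R};
  src : 'I_n;
  snk : 'I_n;
  cap_ge0 : [forall e, 0 <= cap e];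
  src_neq_snk : src != snk
}.

(* f(delta^+(v)) - f(delta^-(v)) *)
Definition net_out (R : realType) (n m : nat) (N : network R n m)
    (f : {ffun 'I_m -> R}) (v : 'I_n) : R :=
  \sum_(e | tail N e == v) f e - \sum_(e | head N e == v) f e.

Definition flow_value (R : realType) (n m : nat) (N : network R n m)
    (f : {ffun 'I_m -> R}) : R := net_out N f (src N).

Definition st_flow (R : realType) (n m : nat) (N : network R n m)
    (f : {ffun 'I_m -> R}) : Prop :=
  [/\ forall e, 0 <= f e <= cap N e,
      forall v, v != src N -> v != snk N -> net_out N f v = 0,
      0 <= net_out N f (src N)
    & net_out N f (snk N) <= 0].

Definition max_flow (R : realType) (n m : nat) (N : network R n m)
    (f : {ffun 'I_m -> R}) : Prop :=
  st_flow N f /\ forall g, st_flow N g -> flow_value N g <= flow_value N f.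

Definition is_min_on (R : realType) (m : nat) (f : {ffun 'I_m -> R})
    (A : {set 'I_m}) (x : R) : Prop :=
  (exists2 e, e \in A & f e = x) /\ forall e, e \in A -> x <= f e.

(* An instance with k homologous edge sets.  These are nonempty, since the
   minimum of f over each of them is taken.  Only the values of a deviation
   function on [0, +oo[ are meaningful. *)
Record aemfp (R : realType) (n m k : nat) := Aemfp {
  net :> network R n m;
  homologous : 'I_k -> {set 'I_m};
  deviation : 'I_k -> R -> R;
  homologous_neq0 : forall i, homologous i != set0;
  deviation_mono : forall i x y,
    0 <= x -> x <= y -> deviation i x <= deviation i y
}.

Definition almost_equal_flow (R : realType) (n m k : nat) (I : aemfp R n m k)
    (f : {ffun 'I_m -> R}) : Prop :=
  st_flow I f /\
  forall i, exists2 fi, is_min_on f (homologous I i) fi &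
    forall e, e \in homologous I i -> fi <= f e <= deviation I i fi.

Definition max_almost_equal_flow (R : realType) (n m k : nat)
    (I : aemfp R n m k) (f : {ffun 'I_m -> R}) : Prop :=
  almost_equal_flow I f /\
  forall g, almost_equal_flow I g -> flow_value I g <= flow_value I f.

Definition concave_on_nneg (R : realType) (D : R -> R) : Prop :=
  forall t x y : R, 0 <= t <= 1 -> 0 <= x -> 0 <= y ->
    t * D x + (1 - t) * D y <= D (t * x + (1 - t) * y).

(* D is the polynomial P`_i on [b`_i, b`_i.+1[, the last piece extending to
   +oo; the degrees are at most q. *)
Definition piecewise_poly (R : realType) (q : nat) (b : seq R)
    (P : seq {poly R}) (D : R -> R) : Prop :=
  [/\ size b = size P, (0 < size P)%N, b`_0 = 0 & sorted <%R b] /\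
  all (fun p : {poly R} => size p <= q.+1)%N P /\
  forall i x, (i < size P)%N -> b`_i <= x ->
    ((i.+1 < size P)%N -> x < b`_i.+1) -> D x = (P`_i).[x].

(* A random access machine over the reals.

   Algorithms are while programs working on arrays of natural numbers and
   arrays of reals; arrays are named by numbers, and scalar variables are cells
   of arrays.  Every node of an expression and every executed command (for
   loops, every test of the guard) costs one time unit.  There is no conversion
   between the two sorts, no rounding, and no real constant other than 0
   and 1.  Integer arithmetic is restricted to addition, truncated subtraction
   and halving, so that unit-cost multiplication of large integers is not
   available. *)

Inductive iexp :=
  | INum of nat
  | IGet of nat & iexp           (* array name, index *)
  | IAdd of iexp & iexp
  | ISub of iexp & iexp
  | IHalf of iexp.

Inductive rexp :=
  | RZero
  | ROne
  | RGet of nat & iexp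
  | RAdd of rexp & rexp
  | RSub of rexp & rexp
  | RMul of rexp & rexp
  | RDiv of rexp & rexp.

Inductive bexp :=
  | BILe of iexp & iexp
  | BRLe of rexp & rexp
  | BNot of bexp
  | BAnd of bexp & bexp.

Inductive cmd :=
  | Skip
  | ISet of nat & iexp & iexp    (* array name, index, value *)
  | RSet of nat & iexp & rexp
  | Seq of cmd & cmd
  | If of bexp & cmd & cmd
  | While of bexp & cmd
  (* Roots a len out cnt: the roots of the polynomial whose len lowest
     coefficients are in the real array a go to the real array out, and their
     number to cell 0 of the integer array cnt. *)
  | Roots of nat & iexp & nat & nat
  (* MaxFlow n m s t tl hd u out: a maximum s-t-flow in the network with n nodes
     and m edges whose tails, heads and capacities are in the arrays tl, hd
     and u goes to the real array out. *)
  | MaxFlow of iexp & iexp & iexp & iexp & nat & nat & nat & nat.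

Record state (R : realType) := State {
  imem : nat -> nat -> nat;
  rmem : nat -> nat -> R
}.

Definition iput (R : realType) (st : state R) (a j v : nat) : state R :=
  State (fun a' j' => if (a' == a) && (j' == j) then v else imem st a' j')
        (rmem st).

Definition rput (R : realType) (st : state R) (a j : nat) (v : R) : state R :=
  State (imem st)
        (fun a' j' => if (a' == a) && (j' == j) then v else rmem st a' j').

Definition rput_seq (R : realType) (st : state R) (a : nat) (l : seq R) :
    state R :=
  State (imem st)
    (fun a' j' => if (a' == a) && (j' < size l)%N then l`_j' else rmem st a' j').

Fixpoint ieval (R : realType) (st : state R) (e : iexp) : nat :=
  match e with
  | INum k => k
  | IGet a i => imem st a (ieval st i)
  | IAdd e1 e2 => ieval st e1 + ieval st e2
  | ISub e1 e2 => ieval st e1 - ieval st e2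
  | IHalf e1 => (ieval st e1)./2
  end%N.

Fixpoint reval (R : realType) (st : state R) (e : rexp) : R :=
  match e with
  | RZero => 0
  | ROne => 1
  | RGet a i => rmem st a (ieval st i)
  | RAdd e1 e2 => reval st e1 + reval st e2
  | RSub e1 e2 => reval st e1 - reval st e2
  | RMul e1 e2 => reval st e1 * reval st e2
  | RDiv e1 e2 => reval st e1 / reval st e2
  end.

Fixpoint beval (R : realType) (st : state R) (e : bexp) : bool :=
  match e with
  | BILe e1 e2 => (ieval st e1 <= ieval st e2)%N
  | BRLe e1 e2 => reval st e1 <= reval st e2
  | BNot e1 => ~~ beval st e1
  | BAnd e1 e2 => beval st e1 && beval st e2
  end.

Fixpoint icost (e : iexp) : nat :=
  match e with
  | INum _ => 1
  | IGet _ i => 1 + icost i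
  | IAdd e1 e2 | ISub e1 e2 => 1 + icost e1 + icost e2
  | IHalf e1 => 1 + icost e1
  end%N.

Fixpoint rcost (e : rexp) : nat :=
  match e with
  | RZero | ROne => 1
  | RGet _ i => 1 + icost i
  | RAdd e1 e2 | RSub e1 e2 | RMul e1 e2 | RDiv e1 e2 =>
      1 + rcost e1 + rcost e2
  end%N.

Fixpoint bcost (e : bexp) : nat :=
  match e with
  | BILe e1 e2 => 1 + icost e1 + icost e2
  | BRLe e1 e2 => 1 + rcost e1 + rcost e2
  | BNot e1 => 1 + bcost e1
  | BAnd e1 e2 => 1 + bcost e1 + bcost e2
  end%N.

(* A choice, for every network, of a maximum flow, and for every nonzero
   polynomial, of an enumeration of its roots in R. *)
Definition flow_oracle (R : realType) :=
  forall n m : nat, network R n m -> {ffun 'I_m -> R}.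

Definition flow_oracle_correct (R : realType) (mf : flow_oracle R) : Prop :=
  forall (n m : nat) (N : network R n m), max_flow N (mf n m N).

Definition root_oracle_correct (R : realType) (rt : {poly R} -> seq R) : Prop :=
  forall p : {poly R}, p != 0 -> uniq (rt p) /\ rt p =i root p.

Definition stores_network (R : realType) (n m : nat) (st : state R)
    (tl hd u : nat) (N : network R n m) : Prop :=
  forall e : 'I_m, [/\ imem st tl e = tail N e, imem st hd e = head N e
                     & rmem st u e = cap N e].

(* exec q T mf rt c st st' k: command c, started in st, stops in st' after k
   time units.  Maximum flows in networks with n nodes and m edges take time
   T n m, and the roots of a nonzero polynomial of degree at most q take
   constant time.  An oracle command with any other input is stuck. *)
Inductive exec (R : realType) (q : nat) (T : nat -> nat -> nat)
    (mf : flow_oracle R) (rt : {poly R} -> seq R) :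
    cmd -> state R -> state R -> nat -> Prop :=
  | ExecSkip st : exec q T mf rt Skip st st 1
  | ExecISet a i e st :
      exec q T mf rt (ISet a i e) st
        (iput st a (ieval st i) (ieval st e)) (1 + icost i + icost e)
  | ExecRSet a i e st :
      exec q T mf rt (RSet a i e) st
        (rput st a (ieval st i) (reval st e)) (1 + icost i + rcost e)
  | ExecSeq c1 c2 st st1 st2 k1 k2 :
      exec q T mf rt c1 st st1 k1 -> exec q T mf rt c2 st1 st2 k2 ->
      exec q T mf rt (Seq c1 c2) st st2 (1 + k1 + k2)
  | ExecIf b c1 c2 st st1 k :
      exec q T mf rt (if beval st b then c1 else c2) st st1 k ->
      exec q T mf rt (If b c1 c2) st st1 (1 + bcost b + k)
  | ExecWhileF b c st :
      ~~ beval st b -> exec q T mf rt (While b c) st st (1 + bcost b)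
  | ExecWhileT b c st st1 st2 k1 k2 :
      beval st b -> exec q T mf rt c st st1 k1 ->
      exec q T mf rt (While b c) st1 st2 k2 ->
      exec q T mf rt (While b c) st st2 (1 + bcost b + k1 + k2)
  | ExecRoots a len out cnt st (p : {poly R}) :
      p = \poly_(j < ieval st len) rmem st a j -> p != 0 -> (size p <= q.+1)%N ->
      exec q T mf rt (Roots a len out cnt) st
        (iput (rput_seq st out (rt p)) cnt 0 (size (rt p))) (1 + icost len)
  | ExecMaxFlow en em es et tl hd u out st (n m : nat) (N : network R n m) :
      ieval st en = n -> ieval st em = m ->
      ieval st es = src N -> ieval st et = snk N ->
      stores_network st tl hd u N ->
      exec q T mf rt (MaxFlow en em es et tl hd u out) st
        (rput_seq st out (codom (mf n m N)))
        (1 + icost en + icost em + icost es + icost et + T n m).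

(* The homologous set is given by its indicator function, the deviation function
   by its breakpoints b and the q.+1 lowest coefficients of each piece of P.
   All other memory cells have arbitrary initial contents. *)
Definition stores_input (R : realType) (n m : nat) (q : nat) (b : seq R)
    (P : seq {poly R}) (I : aemfp R n m 1) (st : state R) : Prop :=
  [/\ [/\ imem st 0 0 = n, imem st 0 1 = m, imem st 0 2 = src I,
          imem st 0 3 = snk I & imem st 0 4 = size P] /\ imem st 0 5 = q,
      stores_network st 1 2 0 I,
      forall e : 'I_m, imem st 3 e = (e \in homologous I ord0),
      forall i, (i < size P)%N -> rmem st 1 i = b`_i
    & forall i j, (i < size P)%N -> (j <= q)%N ->
        rmem st 2 (i * q.+1 + j)%N = (P`_i)`_j].

(* Cell 0 of the integer array 4 tells whether an almost equal flow exists; if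
   so, an optimal one is in the real array 3. *)
Definition stores_solution (R : realType) (n m k : nat) (I : aemfp R n m k)
    (st : state R) : Prop :=
  (imem st 4 0 = 1%N /\
   max_almost_equal_flow I [ffun e : 'I_m => rmem st 3 e]) \/
  (imem st 4 0 = 0%N /\ forall f, ~ almost_equal_flow I f).

(* Main.v *)
(* Fix the minimum x of the flow over R_1.  Closing the network by an arc from t
   to s, a flow with this minimum is a circulation with lower bound x and upper
   bound min(u, D x) on R_1, so x is feasible iff x <= D x and no cut is
   violated, and the best value is the capacity of a smallest s-t cut.  Every cut
   taken at x gives a form w(y) = A + c D(y) - k y with integers c, k <= m, which
   bounds the true cut for all y and is tight at x; since D is concave, so is w,
   and the sign of c D'(x) - k tells on which side of x the optimum lies.

   First the bracket is shrunk at the O(m^2) points where D' crosses some k/c, so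
   that afterwards all forms, and all differences of two forms, are monotone on
   the bracket.  Then the forms at its two ends are intersected repeatedly, as in
   Newton's method for the root of a convex function.  Each step either settles
   the optimum or strictly decreases an integer rank of (c, k) among the O(m^2)
   possible slopes, so O(m^2) evaluations suffice, each of O(n) maximum flows.
   Points are located by bisection over the pieces and one call of the root
   oracle.

   At the optimal x a flow is obtained by fixing the edges one by one, each at
   the largest value that violates no cut; submodularity of the cut function
   keeps the remaining problem feasible.  The logarithm from the bisection is
   absorbed because up_log 2 p ^ 3 <= 8 p. *)
Require Import Defs.
From HB Require Import structures.
From mathcomp Require Import all_boot all_order all_algebra.
From mathcomp Require Import boolp reals.
From mathcomp Require Import zify ring lra.

Set Implicit Arguments.
Unset Strict Implicit.
Unset Printing Implicit Defensive.
Import Defs.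
Import Order.TTheory GRing.Theory Num.Theory.
Local Open Scope ring_scope.

(** * Flows, cuts and circulations *)

(** In exact real arithmetic a bisection on the parameter need not end, so the number of evaluations
    has to come from the combinatorics of the cuts. There are only (m+1)^2 pairs (c, k), but the
    slope c D' - k varies with the point, and a priori two slopes may change their order along the
    bracket. This is why the critical points go first: the difference of two forms has coefficients
    c - c' and k - k', so it is a form of the same size, the negative of one, or monotone outright
    because D is. From then on the increase over one fixed bracket orders all forms, and counting
    the pairs below it gives the integer rank. Infeasible points fit the same scheme: there the most
    violated cut takes the place of the tightest bound, and the kind of outcome is the leading digit
    of the potential. An evaluation has to find a most violated cut among all node sets. Fixing the
    source and separating it from every other node in both directions takes about 2n flows, each on
    an auxiliary network that turns signed cut capacities into ordinary ones. Limits are avoided: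
    derivatives enter through polynomial difference quotients. *)

Section Flows.
Context {R : realType}.

(** Finitely many positive thresholds have a positive minimum; this supplies the step length of an
    augmentation. *)
Lemma uniform_small (T : finType) (P : T -> R -> Prop) :
  (forall t, exists2 e, 0 < e & forall d, 0 < d <= e -> P t d) ->
  exists2 e, 0 < e & forall t, P t e.
Proof.
move=> H.
suff [e e0 He] : exists2 e, 0 < e &
    forall t, t \in enum T -> forall d, 0 < d <= e -> P t d.
  exists e => // t; apply: He; rewrite ?mem_enum //.
  by rewrite e0 lexx.
elim: (enum T) => [|t s [e e0 He]]; first by exists 1.
have [e' e'0 He'] := H t.
exists (Num.min e e'); first by rewrite lt_min e0.
move=> u; rewrite inE => /orP[/eqP->|us] d; rewrite le_min => /and3P[d0 de de'].
  by apply: He'; rewrite d0.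
by apply: He => //; rewrite d0.
Qed.

Lemma sum_incidence (n k : nat) (tl hd : 'I_k -> 'I_n) (f : 'I_k -> R)
    (S : {set 'I_n}) :
  \sum_(v in S) \sum_e f e * ((tl e == v)%:R - (hd e == v)%:R) =
  \sum_e f e * ((tl e \in S)%:R - (hd e \in S)%:R).
Proof.
have ind (u : 'I_n) : \sum_(v in S) (u == v)%:R = (u \in S)%:R :> R.
  case: (boolP (u \in S)) => uS.
    rewrite (bigD1 u) //= eqxx big1 ?addr0 // => v /andP[_ vu].
    by rewrite eq_sym (negbTE vu).
  rewrite big1 // => v vS; case: eqP => // uv; move: uS.
  by rewrite uv vS.
rewrite exchange_big /=; apply: eq_bigr => e _.
by rewrite -mulr_sumr sumrB !ind.
Qed.

Section Network.
Variables (n m : nat) (N : network R n m).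

Lemma net_outE (f : {ffun 'I_m -> R}) v :
  net_out N f v = \sum_e f e * ((tail N e == v)%:R - (head N e == v)%:R).
Proof.
rewrite /net_out !(big_mkcond (fun e => _ == v)) /= -sumrB.
apply: eq_bigr => e _; rewrite mulrBr.
by congr (_ - _); case: eqP; rewrite ?mulr1 ?mulr0.
Qed.

Definition cutcap (S : {set 'I_n}) : R :=
  \sum_e if (tail N e \in S) && (head N e \notin S) then cap N e else 0.

Lemma flow_valueE f (S : {set 'I_n}) : st_flow N f ->
  src N \in S -> snk N \notin S ->
  flow_value N f = \sum_e f e * ((tail N e \in S)%:R - (head N e \in S)%:R).
Proof.
move=> [_ cons _ _] sS tS; rewrite -sum_incidence.
under eq_bigr do rewrite -net_outE.
rewrite (bigD1 (src N)) //= big1 ?addr0 // => v /andP[vS vs].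
by apply: cons => //; apply: contraNneq tS => <-.
Qed.

Lemma flow_le_cut f (S : {set 'I_n}) : st_flow N f ->
  src N \in S -> snk N \notin S -> flow_value N f <= cutcap S.
Proof.
move=> ff sS tS; rewrite (flow_valueE ff sS tS); apply: ler_sum => e _.
case: ff => /(_ e)/andP[f0 fc] _ _ _.
by case: (_ \in S); case: (_ \in S) => /=; lra.
Qed.

(** Closure under residual edges. Every such set that separates source and sink is a minimum cut, so
    the program may use whichever one its marking yields. *)
Definition saturated (f : {ffun 'I_m -> R}) (S : {set 'I_n}) :=
  forall e, (tail N e \in S -> f e < cap N e -> head N e \in S) /\
            (head N e \in S -> 0 < f e -> tail N e \in S).

Lemma flow_eq_cut f (S : {set 'I_n}) : st_flow N f ->
  src N \in S -> snk N \notin S -> saturated f S -> flow_value N f = cutcap S.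
Proof.
move=> ff sS tS sat; rewrite (flow_valueE ff sS tS); apply: eq_bigr => e _.
case: ff => /(_ e)/andP[f0 fc] _ _ _; have [s1 s2] := sat e.
case: (boolP (tail N e \in S)) s1 s2 => tlS;
  case: (boolP (head N e \in S)) => hdS /= s1 s2; try lra.
Qed.

(* A circulation-like direction d from the source to v that keeps f + eps d
   within the capacities for small eps.  Such directions form a cone, so that
   residual walks need not be simple paths. *)
Definition pushable (f : {ffun 'I_m -> R}) (v : 'I_n) := exists d : 'I_m -> R,
  (forall e, (0 < d e -> f e < cap N e) /\ (d e < 0 -> 0 < f e)) /\
  forall w, \sum_e d e * ((tail N e == w)%:R - (head N e == w)%:R) =
            (w == src N)%:R - (w == v)%:R.

Lemma pushable_src f : pushable f (src N).
Proof.
exists (fun=> 0); split=> [e|w]; first by rewrite ltxx.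
by rewrite big1 ?subrr // => e _; rewrite mul0r.
Qed.

Lemma pushable_add f u v e (x : R) : pushable f u ->
  (0 < x -> f e < cap N e) -> (x < 0 -> 0 < f e) ->
  (forall w, x * ((tail N e == w)%:R - (head N e == w)%:R) =
             (w == u)%:R - (w == v)%:R) -> pushable f v.
Proof.
move=> [d [dc dn]] xp xn xuv.
exists (fun e' => d e' + if e' == e then x else 0); split=> [e'|w].
  have [h1 h2] := dc e'; case: eqP => [->|_]; last by rewrite addr0.
  have [h3 h4] := dc e; split=> h.
    have [|d0] := ltrP 0 (d e); first exact: h3.
    by apply: xp; lra.
  have [|d0] := ltrP (d e) 0; first exact: h4.
  by apply: xn; lra.
rewrite (eq_bigr (fun e' => d e' * ((tail N e' == w)%:R - (head N e' == w)%:R) +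
  if e' == e then x * ((tail N e == w)%:R - (head N e == w)%:R) else 0)); last first.
  by move=> e' _; rewrite mulrDl; case: (e' =P e) => [->|_] //; rewrite mul0r.
rewrite big_split /= dn -big_mkcond /= big_pred1_eq xuv.
by rewrite addrA subrK.
Qed.

Lemma pushable_fwd f e : pushable f (tail N e) -> f e < cap N e ->
  pushable f (head N e).
Proof.
move=> pu fc; apply: (@pushable_add f _ _ e 1 pu) => //; first by rewrite ltr10.
by move=> w; rewrite mul1r !(eq_sym w).
Qed.

Lemma pushable_bwd f e : pushable f (head N e) -> 0 < f e ->
  pushable f (tail N e).
Proof.
move=> pu fc; apply: (@pushable_add f _ _ e (-1) pu) => //.
  by rewrite ltr0N1.
by move=> w; rewrite mulN1r opprB !(eq_sym w).
Qed.

(** A small multiple of such a direction can be added to the flow and raises its value by that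
    multiple. *)
Lemma max_flow_not_pushable f : max_flow N f -> ~ pushable f (snk N).
Proof.
move=> [ff fmax] [d [dc dn]]; case: (ff) => fb cons vs vt.
have [e|eps eps0 He] := @uniform_small 'I_m
    (fun e x => 0 <= f e + x * d e <= cap N e).
  have /andP[f0 fc] := fb e; have [h1 h2] := dc e.
  case: (ltrgtP 0 (d e)) => [d0|d0|<-].
  - exists ((cap N e - f e) / d e); first by rewrite divr_gt0 ?subr_gt0 ?h1.
    by move=> x /andP[x0]; rewrite ler_pdivlMr // => xd; nra.
  - exists (f e / - d e); first by rewrite divr_gt0 ?oppr_gt0 ?h2.
    by move=> x /andP[x0]; rewrite ler_pdivlMr ?oppr_gt0 // => xd; nra.
  - by exists 1 => // x _; rewrite mulr0 addr0 f0.
pose g := [ffun e => f e + eps * d e].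
have ng w : net_out N g w = net_out N f w + eps * ((w == src N)%:R - (w == snk N)%:R).
  rewrite !net_outE -dn mulr_sumr -big_split /=; apply: eq_bigr => e _.
  by rewrite ffunE mulrDl mulrA.
have st : (src N == snk N) = false by exact: negbTE (src_neq_snk N).
have gf : st_flow N g.
  split=> [e|v vS vT||]; first by rewrite ffunE.
  - by rewrite ng (negbTE vS) (negbTE vT) subrr mulr0 addr0 cons.
  - rewrite ng eqxx st subr0 mulr1; lra.
  - rewrite ng eqxx eq_sym st sub0r mulrN1; lra.
by have := fmax g gf; rewrite /flow_value ng eqxx st /=; lra.
Qed.

(** The cut consists of all pushable nodes: that set is closed under residual edges and misses the
    sink. *)
Lemma max_flow_min_cut f : max_flow N f ->
  exists S : {set 'I_n},
    [/\ src N \in S, snk N \notin S & flow_value N f = cutcap S].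
Proof.
move=> fm; exists [set v | `[< pushable f v >]].
have h1 : src N \in [set v | `[< pushable f v >]].
  by rewrite inE; apply/asboolP; exact: pushable_src.
have h2 : snk N \notin [set v | `[< pushable f v >]].
  by rewrite inE; apply/negP => /asboolP; exact: max_flow_not_pushable.
split=> //; apply: (flow_eq_cut _ h1 h2); first by case: fm.
move=> e; rewrite !inE; split=> /asboolP pu fe; apply/asboolP.
  exact: pushable_fwd pu fe.
exact: pushable_bwd pu fe.
Qed.

End Network.

(** * Circulations with lower bounds and their signed cuts *)

Section Circulations.
Variables (n k : nat) (tl hd : 'I_k -> 'I_n).
Implicit Types (lo up f : 'I_k -> R) (S T : {set 'I_n}).

(** The summand of Hoffman's cut condition: leaving edges count with the upper bound, entering edges
    with minus the lower bound. *)
Definition edgecap (l u : R) (e : 'I_k) S : R :=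
  if tl e \in S then (if hd e \in S then 0 else u)
  else (if hd e \in S then - l else 0).

Definition lowcap lo up S : R := \sum_e edgecap (lo e) (up e) e S.

Definition upd (g : 'I_k -> R) (e : 'I_k) (x : R) : 'I_k -> R :=
  fun e' => if e' == e then x else g e'.

Lemma upd_same g e x : upd g e x e = x. Proof. by rewrite /upd eqxx. Qed.

(** With both bounds 0 an edge adds nothing to any cut, so [upd _ e 0] amounts to deleting [e], and
    its contribution can be split off. *)
Lemma lowcap_upd lo up e l u S :
  lowcap (upd lo e l) (upd up e u) S =
  lowcap (upd lo e 0) (upd up e 0) S + edgecap l u e S.
Proof.
rewrite /lowcap (bigD1 e) //= [in RHS](bigD1 e) //= !upd_same.
have -> : edgecap 0 0 e S = 0.
  by rewrite /edgecap oppr0; case: ifP => _; case: ifP.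
rewrite add0r addrC; congr (_ + _).
by apply: eq_bigr => e' /negbTE e'e; rewrite /upd e'e.
Qed.

Lemma lowcap_split lo up e S :
  lowcap lo up S = lowcap (upd lo e 0) (upd up e 0) S + edgecap (lo e) (up e) e S.
Proof.
rewrite -lowcap_upd; apply: eq_bigr => e' _.
by rewrite /upd; case: eqP => // ->.
Qed.

Definition conserved f :=
  forall v, \sum_e f e * ((tl e == v)%:R - (hd e == v)%:R) = 0.

Lemma sum_conserved f S : conserved f ->
  \sum_e f e * ((tl e \in S)%:R - (hd e \in S)%:R) = 0.
Proof. by move=> cf; rewrite -sum_incidence big1. Qed.

(** The easy half of Hoffman's theorem: the net outflow of [S] vanishes and is bounded edge by
    edge. *)
Lemma circulation_cut0 lo up f S :
  conserved f -> (forall e, lo e <= f e <= up e) -> 0 <= lowcap lo up S.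
Proof.
move=> cf fb.
rewrite -[X in X <= _](sum_conserved S cf); apply: ler_sum => e _.
by rewrite /edgecap; have := fb e; case: (_ \in S); case: (_ \in S) => /=; lra.
Qed.

(** Pinning both bounds of [e0] to [f e0] and applying the cut condition isolates [f e0]. For the
    arc from sink to source this bounds the flow value. *)
Lemma circulation_cut lo up f S e0 :
  conserved f -> (forall e, lo e <= f e <= up e) ->
  tl e0 \notin S -> hd e0 \in S -> f e0 <= lowcap (upd lo e0 0) (upd up e0 0) S.
Proof.
move=> cf fb tS hS.
have fb' e : upd lo e0 (f e0) e <= f e <= upd up e0 (f e0) e.
  by rewrite /upd; case: eqP => [->|_]; rewrite ?lexx.
have := circulation_cut0 S cf fb'.
by rewrite lowcap_upd /edgecap (negbTE tS) hS subr_ge0.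
Qed.

(** Checked edge by edge. The two sides differ only on edges between the two set differences; there
    the right side has an extra [up e - lo e]. *)
Lemma lowcap_submod lo up S T : (forall e, lo e <= up e) ->
  lowcap lo up (S :&: T) + lowcap lo up (S :|: T) <=
  lowcap lo up S + lowcap lo up T.
Proof.
move=> lu; rewrite -!big_split /=; apply: ler_sum => e _; have := lu e.
rewrite /edgecap !inE.
by case: (tl e \in S); case: (tl e \in T); case: (hd e \in S);
  case: (hd e \in T) => /=; lra.
Qed.

(* Raising the flow on e as far as possible and then fixing it keeps all cuts
   nonnegative: if a cut S leaving along e became negative, uncrossing it with
   the cut S0 that blocks e would give a negative cut not containing e. *)
Lemma fix_edge lo up e (M : R) S0 (x := if M <= up e then M else up e) :
  (forall e, lo e <= up e) -> (forall S, 0 <= lowcap lo up S) ->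
  hd e \in S0 -> tl e \notin S0 -> M = lowcap (upd lo e 0) (upd up e 0) S0 ->
  (forall S, hd e \in S -> tl e \notin S ->
     M <= lowcap (upd lo e 0) (upd up e 0) S) ->
  lo e <= x <= up e /\ forall S, 0 <= lowcap (upd lo e x) (upd up e x) S.
Proof.
move=> lu cuts hS0 tS0 M0 Mmin.
have lx : lo e <= x.
  rewrite /x; case: ifP => // _; have := cuts S0.
  by rewrite (lowcap_split _ _ e) -M0 /edgecap (negbTE tS0) hS0; lra.
have xu : x <= up e by rewrite /x; case: ifP.
have xM : x <= M by rewrite /x; case: ifP => // /negbT; rewrite -ltNge => /ltW.
have xE : x = up e \/ x = M by rewrite /x; case: ifP; [right|left].
clearbody x; split=> [|S]; first by rewrite lx.
have cS := cuts S; rewrite (lowcap_split _ _ e) in cS.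
rewrite lowcap_upd; move: cS; rewrite /edgecap.
case: (boolP (tl e \in S)) => tS; case: (boolP (hd e \in S)) => hS //; last first.
  by move=> _; rewrite subr_ge0 (le_trans xM) ?Mmin.
case: xE => -> // _; rewrite {1}M0.
have lu' e' : upd lo e 0 e' <= upd up e 0 e' by rewrite /upd; case: eqP.
have := @lowcap_submod (upd lo e 0) (upd up e 0) S S0 lu'.
have := cuts (S :&: S0); have := cuts (S :|: S0).
rewrite !(lowcap_split lo up e) /edgecap !inE tS hS0 (negbTE hS) (negbTE tS0) /= -M0.
lra.
Qed.

(** A loop crosses no cut, so its flow is free. *)
Lemma fix_loop lo up e x : tl e = hd e -> (forall S, 0 <= lowcap lo up S) ->
  forall S, 0 <= lowcap (upd lo e x) (upd up e x) S.
Proof.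
move=> te cuts S; have := cuts S; rewrite (lowcap_split lo up e) (lowcap_upd _ _ _ x x).
by rewrite /edgecap te; case: (hd e \in S).
Qed.

(** With coinciding bounds a cut capacity is a net outflow. The outflows of a node and of its
    complement are opposite, so two inequalities force both to be 0. *)
Lemma cuts_conserved f : (forall S, 0 <= lowcap f f S) -> conserved f.
Proof.
have E S : lowcap f f S = \sum_e f e * ((tl e \in S)%:R - (hd e \in S)%:R).
  apply: eq_bigr => e _; rewrite /edgecap.
  by case: (_ \in S); case: (_ \in S) => /=; lra.
move=> cuts v; apply/eqP; rewrite eq_le; apply/andP; split.
  have := cuts (~: [set v]); rewrite E => h; rewrite -oppr_ge0; apply: (le_trans h).
  rewrite -sumrN le_eqVlt; apply/orP; left; apply/eqP; apply: eq_bigr => e _.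
  by rewrite !inE; do 2 case: eqP => _ /=; lra.
have := cuts [set v]; rewrite E => h; apply: (le_trans h).
by rewrite le_eqVlt; apply/orP; left; apply/eqP; apply: eq_bigr => e _; rewrite !inE.
Qed.

Definition excess lo (v : 'I_n) : R :=
  \sum_e lo e * ((hd e == v)%:R - (tl e == v)%:R).

End Circulations.

(* The auxiliary network: every edge e has capacity up e - lo e, and the excess
   of the lower bounds at v is fed from a, or its deficit drained to b.  No such
   edge is needed at a, and its slot is taken by the last edge. *)
Section Auxiliary.
Variables (n m : nat) (tl hd : 'I_m.+1 -> 'I_n) (lo up : 'I_m.+1 -> R).
Variables (a b : 'I_n).
Local Notation ex := (excess tl hd lo).

Definition aux_tail (e : 'I_(m + n)) : 'I_n :=
  match split e with
  | inl i => tl (widen_ord (leqnSn m) i)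
  | inr v => if v == a then tl ord_max else if 0 <= ex v then a else v
  end.

Definition aux_head (e : 'I_(m + n)) : 'I_n :=
  match split e with
  | inl i => hd (widen_ord (leqnSn m) i)
  | inr v => if v == a then hd ord_max else if 0 <= ex v then v else b
  end.

Definition aux_cap (e : 'I_(m + n)) : R :=
  match split e with
  | inl i => let e := widen_ord (leqnSn m) i in up e - lo e
  | inr v => if v == a then up ord_max - lo ord_max
             else if 0 <= ex v then ex v else - ex v
  end.

(** The constant by which cuts of the auxiliary network exceed the signed cut capacities. *)
Definition deficit : R := \sum_(v | v != a) if 0 <= ex v then 0 else - ex v.

Hypothesis lu : forall e, lo e <= up e.
Hypothesis ab : a != b.

Lemma aux_cap_ge0 : [forall e, 0 <= [ffun e => aux_cap e] e].
Proof.
apply/forallP => e; rewrite ffunE /aux_cap; case: (split e) => [i|v].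
  by rewrite subr_ge0.
case: eqP => _; first by rewrite subr_ge0.
by case: ifP => [//|/negbT]; rewrite -ltNge oppr_ge0 => /ltW.
Qed.

Definition aux_net : network R n (m + n) :=
  Network [ffun e => aux_tail e] [ffun e => aux_head e] aux_cap_ge0 ab.

(** A node of nonnegative excess is charged when it lies outside [S], any other node when it lies
    inside. Both add up to the excess of the complement plus [deficit], and the excess of the
    complement replaces [up - lo] by [up] on leaving edges and yields [- lo] on entering ones. *)
Lemma cutcap_aux (S : {set 'I_n}) : a \in S -> b \notin S ->
  cutcap aux_net S = lowcap tl hd lo up S + deficit.
Proof.
move=> aS bS; rewrite /cutcap big_split_ord /= (bigD1 a) //= addrA.
pose out e := if (tl e \in S) && (hd e \notin S) then up e - lo e else 0.
set X := (X in X + _); have -> : X = \sum_e out e.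
  rewrite big_ord_recr /= /X; congr (_ + _).
    apply: eq_bigr => i _; rewrite !ffunE /aux_tail /aux_head /aux_cap.
    by rewrite (unsplitK (inl i)).
  rewrite !ffunE /aux_tail /aux_head /aux_cap (unsplitK (inr a)) /=.
  by rewrite eqxx.
set Y := (Y in _ + Y).
have -> : Y = (\sum_(v in ~: S) ex v) + deficit.
  rewrite /deficit (big_mkcond (fun v => v \in ~: S)) (bigD1 a) //= inE aS add0r.
  rewrite -big_split /=; apply: eq_bigr => v va.
  rewrite !ffunE /aux_tail /aux_head /aux_cap (unsplitK (inr v)) /=.
  rewrite (negbTE va) inE.
  by case: lerP => ev; rewrite ?aS ?bS ?andbT /=; case: (v \in S) => /=;
    rewrite ?addr0 ?add0r ?subrr.
rewrite addrA; congr (_ + _).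
have -> : \sum_(v in ~: S) ex v =
    \sum_e lo e * ((hd e \in ~: S)%:R - (tl e \in ~: S)%:R).
  exact: sum_incidence.
rewrite -big_split /=; apply: eq_bigr => e _; rewrite /out /edgecap !inE.
by case: (_ \in S); case: (_ \in S) => /=; lra.
Qed.

(** Signed cut capacities can be negative; one maximum flow still gives their minimum after the
    constant shift. *)
Lemma aux_min_cut f : max_flow aux_net f ->
  let M := flow_value aux_net f - deficit in
  (exists S : {set 'I_n}, [/\ a \in S, b \notin S & M = lowcap tl hd lo up S]) /\
  forall S : {set 'I_n}, a \in S -> b \notin S -> M <= lowcap tl hd lo up S.
Proof.
move=> fm M; split.
  have [S [aS bS v]] := max_flow_min_cut fm; exists S; split=> //.
  by rewrite /M v (cutcap_aux aS bS) addrK.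
move=> S aS bS; rewrite /M lerBlDr -(cutcap_aux aS bS).
by apply: flow_le_cut => //; case: fm.
Qed.

Lemma aux_saturated f (S : {set 'I_n}) : max_flow aux_net f ->
  a \in S -> b \notin S -> saturated aux_net f S ->
  lowcap tl hd lo up S = flow_value aux_net f - deficit.
Proof.
move=> [ff _] aS bS sat; rewrite (flow_eq_cut ff aS bS sat).
by rewrite (cutcap_aux aS bS) addrK.
Qed.

End Auxiliary.
End Flows.

(** * Piecewise polynomial concave functions *)

Section Polynomials.
Variable R : realType.
Implicit Types (p : {poly R}) (a x y : R).

Lemma poly_bounded p a : exists2 M, 0 <= M & forall x, `|x - a| <= 1 -> `|p.[x]| <= M.
Proof.
elim/poly_ind: p => [|p c [M M0 HM]].
  by exists 0 => // x _; rewrite horner0 normr0.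
exists (M * (`|a| + 1) + `|c|) => [|x xa].
  by rewrite addr_ge0 ?mulr_ge0 ?addr_ge0.
rewrite !hornerE (le_trans (ler_normD _ _)) // lerD2r normrM.
apply: ler_pM => //; first exact: HM.
by rewrite -[x](subrK a) addrC (le_trans (ler_normD _ _)) // lerD2l.
Qed.

(** [s] is the difference quotient at [a], continued to [a] itself as a polynomial; it replaces
    limits of quotients. *)
Lemma poly_slope p a :
  exists s : {poly R}, s.[a] = p^`().[a] /\ forall x, p.[x] = p.[a] + s.[x] * (x - a).
Proof.
have /factor_theorem[s Es] : root (p - (p.[a])%:P) a.
  by rewrite rootE !hornerE subrr.
have Ep : p = s * ('X - a%:P) + (p.[a])%:P by rewrite -Es subrK.
exists s; split=> [|x].
  by rewrite [in RHS]Ep derivD derivC addr0 derivM derivXsubC !hornerE subrr mulr0 add0r.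
by rewrite [in LHS]Ep !hornerE addrC.
Qed.

(** Continuity, in the form needed to pass a weak inequality to a limit point. *)
Lemma poly_limit_ge0 p a :
  (forall e, 0 < e -> exists2 x, `|x - a| < e & 0 <= p.[x]) -> 0 <= p.[a].
Proof.
move=> H; rewrite leNgt; apply/negP => pa0.
have [s [_ Es]] := poly_slope p a.
have [M M0 HM] := poly_bounded s a.
(* Within this distance the change of [p] stays below [- p.[a]]; the [+ 1] keeps the divisor
   positive. *)
have e0 : 0 < Num.min 1 (- p.[a] / (M + 1)).
  by rewrite lt_min ltr01 divr_gt0 ?oppr_gt0 // ltr_pwDr.
have [x] := H _ e0; rewrite lt_min => /andP[x1 x2].
have := HM x (ltW x1); rewrite Es => sx px.
have : `|s.[x] * (x - a)| < - p.[a].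
  rewrite normrM; apply: (@le_lt_trans _ _ (M * `|x - a|)).
    by rewrite ler_wpM2r.
  move: x2; rewrite ltr_pdivlMr ?ltr_pwDr //.
  by have := normr_ge0 (x - a); nra.
by rewrite ltr_norml => /andP[_]; lra.
Qed.

Lemma poly_eq0_itv p a x : a < x -> (forall y, a <= y <= x -> root p y) -> p = 0.
Proof.
move=> ax H; apply/eqP; apply/negPn/negP => p0.
(* [size p] distinct points of the interval, one more than the roots a nonzero polynomial of this
   size can have. *)
pose rs := [seq a + (x - a) / (j.+1)%:R | j <- iota 0 (size p)].
suff : (size rs < size p)%N by rewrite size_map size_iota ltnn.
apply: max_poly_roots => //.
  apply/allP => y /mapP[j _ ->]; apply: H.
  have xa : 0 <= x - a by lra.
  rewrite lerDl divr_ge0 ?ler0n //= -lerBrDl ler_pdivrMr ?ltr0Sn //.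
  by rewrite ler_peMr // ler1n.
rewrite map_inj_uniq ?iota_uniq // => i j /addrI /mulfI.
rewrite subr_eq0 gt_eqF // => /(_ isT)/invr_inj/eqP.
by rewrite eqr_nat eqSS => /eqP.
Qed.

End Polynomials.

Section PiecewiseConcave.
Variables (R : realType) (q : nat) (b : seq R) (P : seq {poly R}) (D : R -> R).
Hypothesis pwD : piecewise_poly q b P D.
Hypothesis concD : concave_on_nneg D.
Hypothesis monoD : forall x y, 0 <= x -> x <= y -> D x <= D y.

Definition at_piece i x :=
  [/\ (i < size P)%N, b`_i <= x & (i.+1 < size P)%N -> x < b`_i.+1].

(* g is the right derivative of D at x. *)
Definition is_rd x g := exists2 i, at_piece i x & g = (P`_i)^`().[x].

Lemma b_lt i j : (i < j)%N -> (j < size P)%N -> b`_i < b`_j.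
Proof.
case: pwD => -[sb _ _ bs] _ ij jp.
by apply: sorted_ltn_nth => //; rewrite ?inE ?sb //; [exact: lt_trans|exact: ltn_trans jp].
Qed.

Lemma b0 : b`_0 = 0. Proof. by case: pwD => -[]. Qed.

Lemma b_ge0 i : (i < size P)%N -> 0 <= b`_i.
Proof. by case: i => [|i] ip; [rewrite b0|rewrite -[X in X <= _]b0 ltW // b_lt]. Qed.

Lemma at_piece_ge0 i x : at_piece i x -> 0 <= x.
Proof. by case=> ip bx _; apply: le_trans (b_ge0 ip) bx. Qed.

Lemma D_at_piece i x : at_piece i x -> D x = (P`_i).[x].
Proof. by case: pwD => _ [_ H] [ip bx xb]; apply: H. Qed.

Lemma ex_piece x : 0 <= x -> exists i, at_piece i x.
Proof.
move=> x0; have [[_ P0 _ _] _] := pwD.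
have ex : exists i, (i < size P)%N && (b`_i <= x) by exists 0%N; rewrite P0 b0.
have ub i : (i < size P)%N && (b`_i <= x) -> (i <= size P)%N by case/andP=> /ltnW.
case: (ex_maxnP ex ub) => i /andP[ip bx] imax; exists i; split=> // i1p.
rewrite ltNge; apply/negP => bx1; have := imax i.+1.
by rewrite i1p bx1 ltnn => /(_ isT).
Qed.

Lemma at_piece_uniq i j x : at_piece i x -> at_piece j x -> i = j.
Proof.
have key k l : (k < l)%N -> at_piece k x -> at_piece l x -> False.
  move=> kl [kp _ xk] [lp xl _].
  have k1p : (k.+1 < size P)%N by apply: leq_ltn_trans lp.
  have := xk k1p; rewrite ltNge (le_trans _ xl) //.
  by case: (ltngtP k.+1 l) kl => // [kl _|-> _]; [exact: ltW (b_lt kl lp)|exact: lexx].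
by move=> hi hj; case: (ltngtP i j) => // h; [case: (key _ _ h hi hj)|case: (key _ _ h hj hi)].
Qed.

Lemma at_piece_b i : (i < size P)%N -> at_piece i b`_i.
Proof. by move=> ip; split=> // i1p; apply: b_lt. Qed.

(** The chord inequality without division, so that on a piece it is a polynomial inequality and
    survives limits. *)
Lemma concave3 x y z : 0 <= x -> x <= y -> y <= z ->
  (z - y) * D x + (y - x) * D z <= (z - x) * D y.
Proof.
move=> x0 xy yz; have [xz|zx] := ltrP x z; last first.
  have -> : y = x by lra.
  have -> : z = x by lra.
  lra.
have z0 : 0 <= z by lra.
pose t := (z - y) / (z - x).
have zx0 : 0 < z - x by lra.
have t01 : 0 <= t <= 1.
  by rewrite divr_ge0 ?ler_pdivrMr ?mul1r //; lra.
have := concD t01 x0 z0.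
have -> : t * x + (1 - t) * z = y by rewrite /t; field; lra.
move=> /(ler_wpM2l (ltW zx0)); apply: le_trans.
rewrite le_eqVlt; apply/orP; left; apply/eqP; rewrite /t; field; lra.
Qed.

(** Pieces are half-open, so their definition does not tie piece [i] to its right end. In the limit
    from the left, the chord inequality gives one direction and monotonicity the other. Closed
    pieces are what the intermediate value theorem needs. *)
Lemma D_left i : (i.+1 < size P)%N -> D b`_i.+1 = (P`_i).[b`_i.+1].
Proof.
move=> i1p; have ip : (i < size P)%N by exact: ltnW.
have bb := b_lt (ltnSn i) i1p; have bi0 := b_ge0 ip.
set x0 := b`_i in bb bi0; set x1 := b`_i.+1 in bb *.
have near e : 0 < e -> exists2 z, `|z - x1| < e & x0 <= z < x1 /\ D z = (P`_i).[z].
  move=> e0; exists (Num.max x0 (x1 - e / 2)).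
    by rewrite ltr_norml; case: (lerP x0 (x1 - e / 2)) => h; apply/andP; split; lra.
  have h : x0 <= Num.max x0 (x1 - e / 2) < x1.
    by rewrite le_max lexx /= gt_max bb; lra.
  split=> //; apply: D_at_piece; case/andP: h => h1 h2; split=> //.
apply/eqP; rewrite eq_le; apply/andP; split.
  have : 0 <= ((x1 - x0) *: P`_i - (x1%:P - 'X) * (D x0)%:P - ('X - x0%:P) * (D x1)%:P).[x1].
    apply: poly_limit_ge0 => e /near[z ze [/andP[z0 z1] Dz]]; exists z => //.
    rewrite !hornerE -Dz; have := @concave3 x0 z x1; lra.
  rewrite !hornerE subrr mul0r subr0 -mulrBr pmulr_rge0 ?subr_ge0 //; lra.
have : 0 <= ((D x1)%:P - P`_i).[x1].
  apply: poly_limit_ge0 => e /near[z ze [/andP[z0 z1] Dz]]; exists z => //.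
  by rewrite !hornerE -Dz subr_ge0 monoD //; lra.
by rewrite !hornerE subr_ge0.
Qed.

Lemma D_closed_piece i x : (i < size P)%N -> b`_i <= x ->
  ((i.+1 < size P)%N -> x <= b`_i.+1) -> D x = (P`_i).[x].
Proof.
move=> ip bx xb; case: (ltnP i.+1 (size P)) => i1p; last first.
  by apply: D_at_piece; split=> //; rewrite ltnNge i1p.
have := xb i1p; rewrite le_eqVlt => /orP[/eqP->|h]; first exact: D_left.
by apply: D_at_piece; split.
Qed.

(** Chord slopes of a concave function decrease: the chord between [x] and [y] is compared with the
    quotients [s.[z]] for [z] above [x] in the same piece, and [z] tends to [x]. *)
Lemma supergradient x y g : is_rd x g -> 0 <= y -> D y <= D x + g * (y - x).
Proof.
move=> [i ipx ->] y0; have x0 := at_piece_ge0 ipx.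
have [s [<- Es]] := poly_slope P`_i x.
have near e : 0 < e -> exists2 z, x < z < x + e & at_piece i z.
  move=> e0; case: ipx => ip bx xb.
  case: (ltnP i.+1 (size P)) => i1p; last first.
    exists (x + e / 2); first by lra.
    by split=> //; [lra|rewrite ltnNge i1p].
  have := xb i1p => xb1; exists (x + Num.min e (b`_i.+1 - x) / 2).
    by case: (lerP e (b`_i.+1 - x)) => h; lra.
  by split=> [//||_]; case: (lerP e (b`_i.+1 - x)) => h; lra.
have Dz z : at_piece i z -> D z = D x + s.[z] * (z - x).
  by move=> iz; rewrite (D_at_piece iz) (D_at_piece ipx) Es.
case: (ltrgtP x y) => [xy|yx|<-]; last by rewrite subrr mulr0 addr0.
- have : 0 <= ((y - x) *: s - (D y - D x)%:P).[x].
    apply: poly_limit_ge0 => e e0.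
    have e'0 : 0 < Num.min e (y - x) by rewrite lt_min e0 subr_gt0.
    have [z /andP[xz ze] iz] := near _ e'0; exists z.
      rewrite ger0_norm; last lra.
      by move: ze; case: (lerP e (y - x)) => h; lra.
    rewrite !hornerE; have zy : z <= y.
      by move: ze; case: (lerP e (y - x)) => h; lra.
    have := @concave3 x z y x0 (ltW xz) zy; rewrite (Dz z iz).
    have zx : 0 < z - x by lra.
    rewrite -(pmulr_rge0 _ zx); nra.
  by rewrite !hornerE; nra.
- have : 0 <= ((D x - D y)%:P - (x - y) *: s).[x].
    apply: poly_limit_ge0 => e e0.
    have [z /andP[xz ze] iz] := near _ e0; exists z; first by rewrite ger0_norm; lra.
    rewrite !hornerE; have := @concave3 y x z y0 (ltW yx) (ltW xz); rewrite (Dz z iz).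
    have zx : 0 < z - x by lra.
    rewrite -(pmulr_rge0 _ zx); nra.
  by rewrite !hornerE; nra.
Qed.

Lemma rd_uniq x g h : is_rd x g -> is_rd x h -> g = h.
Proof. by move=> [i hi ->] [j hj ->]; rewrite (at_piece_uniq hi hj). Qed.

Lemma rd_nonincreasing x y g h : is_rd x g -> is_rd y h -> x <= y -> h <= g.
Proof.
move=> hx hy; rewrite le_eqVlt => /orP[/eqP E|xy].
  by rewrite E in hx; rewrite (rd_uniq hx hy).
have [x0 y0] : 0 <= x /\ 0 <= y.
  by case: hx hy => [i /at_piece_ge0 -> _] [j /at_piece_ge0 -> _].
by have := supergradient hx y0; have := supergradient hy x0; nra.
Qed.

Lemma ex_rd x : 0 <= x -> exists g, is_rd x g.
Proof. by move=> /ex_piece[i hi]; exists (P`_i)^`().[x]; exists i. Qed.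

(** * Locating a sign change of a form or of a slope *)

Section Search.
Variables (lo hi : R) (alpha beta gamma delta : R).
Hypothesis lo0 : 0 <= lo.
Hypothesis lohi : lo < hi.

(** One shape for both searches: [delta = 0] when a combination of forms must vanish,
    [beta = gamma = 0] when a slope must change its sign. *)
Definition search_poly i : {poly R} :=
  alpha%:P + beta *: P`_i + gamma *: 'X + delta *: (P`_i)^`().

Definition piece_lo i := if b`_i <= lo then lo else b`_i.
Definition piece_hi i :=
  if (i.+1 < size P)%N && (b`_i.+1 <= hi) then b`_i.+1 else hi.

(** Breakpoints up to [lo] count as true and those from [hi] on as false, so a bisection ends at a
    piece that meets the bracket. *)
Definition search_pred (strict : bool) i := (b`_i <= lo) || (b`_i < hi) &&
  (if strict then (search_poly i).[b`_i] < 0 else (search_poly i).[b`_i] <= 0).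

Definition first_root i acc :=
  [/\ piece_lo i <= acc <= piece_hi i,
      acc = piece_hi i \/ root (search_poly i) acc &
      forall r, root (search_poly i) r -> piece_lo i <= r -> r < acc -> False].

Variables (strict : bool) (i : nat).
Hypothesis ip : (i < size P)%N.
Hypothesis pi : search_pred strict i.
Hypothesis pi1 : (i.+1 < size P)%N -> ~~ search_pred strict i.+1.

Lemma piece_loP : [/\ lo <= piece_lo i, b`_i <= piece_lo i, piece_lo i < hi
  & (i.+1 < size P)%N -> piece_lo i < b`_i.+1 /\ lo < b`_i.+1].
Proof.
rewrite /piece_lo; case: ifP => h; split=> //.
- move=> i1p; have := pi1 i1p; rewrite /search_pred negb_or -ltNge => /andP[-> _].
  by [].
- by move: h => /negbT; rewrite -ltNge => /ltW.
- by move: pi; rewrite /search_pred h => /andP[].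
- move=> i1p; have := pi1 i1p; rewrite /search_pred negb_or -ltNge => /andP[-> _].
  by split=> //; apply: b_lt.
Qed.

Lemma piece_hiP : [/\ piece_lo i < piece_hi i, piece_hi i <= hi
  & (i.+1 < size P)%N -> piece_hi i <= b`_i.+1].
Proof.
have [h1 h2 h3 h4] := piece_loP; rewrite /piece_hi.
case: ifP => [/andP[i1p bh]|h]; first by have [] := h4 i1p.
split=> // i1p; move: h; rewrite i1p /= => /negbT; rewrite -ltNge => /ltW.
by [].
Qed.

Section Root.
Let d x := alpha + beta * D x + gamma * x.
Hypothesis nonstrict : strict = false.
Hypothesis delta0 : delta = 0.
Hypothesis dlo : d lo <= 0.
Hypothesis dhi : 0 < d hi.
Hypothesis dmono : forall x y, lo <= x -> x <= y -> y <= hi -> d x <= d y.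

(** The signs at the two ends of the piece give a root. The least root is also the last zero: a
    nonpositive value beyond it would, by monotonicity, make the polynomial vanish on an
    interval. *)
Lemma search_root : search_poly i != 0 /\ forall acc, first_root i acc ->
  [/\ lo <= acc < hi, d acc = 0 & forall x, acc < x -> x <= hi -> 0 < d x].
Proof.
have [l1 l2 l3 l4] := piece_loP; have [h1 h2 h3] := piece_hiP.
have dE x : piece_lo i <= x <= piece_hi i -> (search_poly i).[x] = d x.
  move=> /andP[x1 x2]; rewrite /search_poly delta0 !hornerE /d.
  rewrite (D_closed_piece ip); rewrite ?addr0 //; first exact: le_trans x1.
  by move=> i1p; apply: le_trans x2 (h3 i1p).
have d0 : d (piece_lo i) <= 0.
  rewrite -dE ?lexx ?(ltW h1) //; move: pi; rewrite /search_pred nonstrict.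
  have := dE (piece_lo i); rewrite lexx (ltW h1) => /(_ isT).
  rewrite /piece_lo; case: ifP => // h E; first by rewrite E.
  by case/andP.
have d1 : 0 < d (piece_hi i).
  rewrite /piece_hi; case: ifP => // /andP[i1p]; rewrite le_eqVlt => /orP[/eqP->//|bh].
  have := pi1 i1p; rewrite /search_pred negb_or bh nonstrict /= -ltNge.
  have E := D_at_piece (at_piece_b i1p).
  by rewrite /search_poly delta0 !hornerE /d E -ltNge => /andP[].
have p0 : search_poly i != 0.
  apply: contraTneq d1 => E; rewrite -dE ?E ?horner0 ?ltxx //.
  by rewrite lexx (ltW h1).
split=> // acc [/andP[a1 a2] aroot afirst].
have [r /andP[r1 r2] rr] : exists2 r, piece_lo i <= r <= piece_hi i & root (search_poly i) r.
  apply: poly_ivt; first exact: ltW.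
  by rewrite !dE ?lexx ?(ltW h1) // d0 ltW.
have rh : r < piece_hi i.
  rewrite lt_neqAle r2 andbT; apply: contraTneq d1 => <-.
  by rewrite -dE ?r1 ?r2 // (eqP rr) ltxx.
have ar : acc <= r by rewrite leNgt; apply/negP; apply: afirst.
have da : d acc = 0.
  rewrite -dE ?a1 ?a2 //; apply/eqP; rewrite -rootE; case: aroot => // E.
  by move: rh; rewrite -E ltNge ar.
split=> //; first by rewrite (le_trans l1) //= (le_lt_trans ar) // (lt_le_trans rh).
move=> x ax xh; rewrite ltNge; apply/negP => dx.
have xph : x <= piece_hi i.
  rewrite leNgt; apply/negP => hx.
  have := @dmono (piece_hi i) x; rewrite (ltW hx) xh (le_trans l1 (ltW h1)).
  by move=> /(_ isT isT isT); lra.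
move/eqP: p0; apply; apply: (poly_eq0_itv ax) => y /andP[y1 y2].
have hy : piece_lo i <= y <= piece_hi i by rewrite (le_trans a1) //= (le_trans y2).
rewrite rootE dE //; have ly : lo <= y by case/andP: hy => h _; exact: le_trans h.
have := @dmono acc y (le_trans l1 a1) y1 (le_trans y2 xh).
have := @dmono y x ly y2 xh.
by rewrite da => h h'; apply/eqP; lra.
Qed.

End Root.

Section Derivative.
Hypothesis isstrict : strict = true.
Hypothesis beta0 : beta = 0.
Hypothesis gamma0 : gamma = 0.
Hypothesis delta0 : delta <= 0.
Hypothesis dlo : forall g, is_rd lo g -> alpha + delta * g < 0.

(** The right derivative may jump at a breakpoint, so the sign can change without a root. Then [acc]
    is the right end of the piece, and the failing test at the next breakpoint supplies the
    nonnegative value. *)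
Lemma search_deriv : search_poly i != 0 /\ forall acc, first_root i acc ->
  [/\ lo < acc <= hi, forall x g, lo <= x < acc -> is_rd x g -> alpha + delta * g < 0
    & acc < hi -> forall x g, acc <= x -> is_rd x g -> 0 <= alpha + delta * g].
Proof.
have [l1 l2 l3 l4] := piece_loP; have [h1 h2 h3] := piece_hiP.
have dE j x : (search_poly j).[x] = alpha + delta * (P`_j)^`().[x].
  by rewrite /search_poly beta0 gamma0 !scale0r !addr0 !hornerE.
have ipl : at_piece i (piece_lo i).
  by split=> // i1p; have [] := l4 i1p.
have d0 : (search_poly i).[piece_lo i] < 0.
  move: pi; rewrite /search_pred /piece_lo isstrict; case: ifP => [bl _|_ /andP[] //].
  rewrite dE; apply: dlo; exists i => //.
  by split=> // i1p; have [] := l4 i1p.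
split; first by apply: contraTneq d0 => ->; rewrite horner0 ltxx.
move=> acc [/andP[a1 a2] aroot afirst].
have la : piece_lo i < acc.
  rewrite lt_neqAle a1 andbT; case: aroot => [->|ra]; first by rewrite lt_eqF.
  by apply: contraTneq d0 => ->; rewrite (eqP ra) ltxx.
split.
- by rewrite (le_lt_trans l1 la) (le_trans a2 h2).
- move=> x g /andP[lx xa] gx; case: (lerP (piece_lo i) x) => hx.
    have ipx : at_piece i x.
      split=> //; first exact: le_trans hx.
      by move=> i1p; apply: lt_le_trans xa (le_trans a2 (h3 i1p)).
    have -> : g = (P`_i)^`().[x] by apply: (rd_uniq gx); exists i.
    rewrite -dE ltNge; apply/negP => dx.
    have [] := @poly_ivt _ (search_poly i) (piece_lo i) x; rewrite ?dx ?(ltW d0) //.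
    move=> r /andP[r1 r2] rr; apply: (afirst r rr r1); exact: le_lt_trans r2 xa.
  have gp : is_rd (piece_lo i) (P`_i)^`().[piece_lo i] by exists i.
  have := ler_wnM2l delta0 (rd_nonincreasing gx gp (ltW hx)); rewrite dE in d0; lra.
- move=> ah x g ax gx.
  have [h [ga h0]] : exists h, is_rd acc h /\ 0 <= alpha + delta * h.
    case: (ltrP acc (piece_hi i)) => aph.
      exists (P`_i)^`().[acc]; split; last first.
        by rewrite -dE; case: aroot => [E|/eqP ->//]; rewrite E ltxx in aph.
      exists i => //; split=> //; first exact: le_trans a1.
      by move=> i1p; apply: lt_le_trans aph (h3 i1p).
    have E : acc = piece_hi i by apply/eqP; rewrite eq_le a2.
    move: E ah; rewrite /piece_hi; case: ifP => [/andP[i1p bh] -> bh'|_ ->]; last first.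
      by rewrite ltxx.
    exists (P`_i.+1)^`().[b`_i.+1]; split; first by exists i.+1 => //; apply: at_piece_b.
    by have := pi1 i1p; rewrite /search_pred isstrict negb_or bh' /= -leNgt dE => /andP[].
  by have := ler_wnM2l delta0 (rd_nonincreasing ga gx ax); lra.
Qed.

End Derivative.
End Search.
End PiecewiseConcave.

(** * Newton iteration on cut forms *)

(** Lexicographic comparison of pairs coded in base [N.+1]. *)
Lemma lex_ltn N a a' r r' : (a < a')%N -> (r <= N)%N ->
  (a * N.+1 + r < a' * N.+1 + r')%N.
Proof.
move=> aa rN; apply: (@leq_trans (a.+1 * N.+1)).
  by rewrite mulSnr ltn_add2l ltnS.
by rewrite (leq_trans _ (leq_addr _ _)) // leq_mul2r aa orbT.
Qed.

Section Bracketing.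
Variables (R : realType) (D : R -> R) (rd : R -> R -> Prop) (m : nat) (hmax : R).
Hypothesis monoD : forall x y, 0 <= x -> x <= y -> D x <= D y.
Hypothesis rd_super : forall x y g, rd x g -> 0 <= y -> D y <= D x + g * (y - x).
Hypothesis rd_ex : forall x, 0 <= x -> exists g, rd x g.
Hypothesis m_gt0 : (0 < m)%N.

(* (A, c, k) stands for the function A + c D(x) - k x. *)
Definition form := (R * nat * nat)%type.
Definition fev (w : form) (x : R) : R := w.1.1 + w.1.2%:R * D x - w.2%:R * x.
Definition fslope (w : form) (g : R) : R := w.1.2%:R * g - w.2%:R.
(** [D x - x] in the shape of a cut form, so that a failure of [x <= D x] is handled like a violated
    cut. *)
Definition gap_form : form := (0, 1%N, 1%N).
Definition bounded (w : form) := (w.1.2 <= m)%N && (w.2 <= m)%N.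

(* Cg: the constraints 0 <= w; Ch: the upper bounds on the value. *)
Variables Cg Ch : form -> Prop.
Hypothesis bCg : forall w, Cg w -> bounded w.
Hypothesis bCh : forall w, Ch w -> bounded w.

Definition feasible x :=
  [/\ 0 <= x <= hmax, x <= D x & forall w, Cg w -> 0 <= fev w x].

(** For the cut forms of an instance this amounts to an almost equal flow of value at least [v] that
    is at least [x] on the homologous edges. *)
Definition attains x v := feasible x /\ forall w, Ch w -> v <= fev w x.

(* Outcome tau = 0: x is feasible and w its tightest upper bound; tau = 1: w is
   the most violated constraint; tau = 2: already x <= D x fails. *)
Definition eval_ok x (tau : nat) (w : form) :=
  match tau with
  | 0 => [/\ x <= D x, forall w', Cg w' -> 0 <= fev w' x, Ch w
           & forall w', Ch w' -> fev w x <= fev w' x]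
  | 1 => [/\ x <= D x, fev w x < 0, Cg w & forall w', Cg w' -> fev w x <= fev w' x]
  | 2 => w = gap_form /\ fev w x < 0
  | _ => False
  end.

(** [f] tells whether a solution is known and [vb] is its value; without one the claim is that [v]
    is not attained at [x]. *)
Definition no_better (f : bool) (vb : R) x v := attains x v -> f /\ v <= vb.

Definition outside_done lo hi f vb :=
  forall x v, attains x v -> lo < x < hi \/ (f /\ v <= vb).

Lemma eval_bounded x tau w : eval_ok x tau w -> bounded w.
Proof.
case: tau => [|[|[|//]]]; first by case=> _ _ /bCh.
  by case=> _ _ /bCg.
by case=> -> _; rewrite /bounded /= m_gt0.
Qed.

Lemma eval_tau x tau w : eval_ok x tau w -> (tau <= 2)%N.
Proof. by case: tau => [|[|[|]]]. Qed.

Lemma eval_neg x tau w : eval_ok x tau w -> (0 < tau)%N -> fev w x < 0.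
Proof. by case: tau => [|[|[|//]]] // [] . Qed.

Lemma gap_lt0 x : (fev gap_form x < 0) = (D x < x).
Proof. by rewrite /fev /= add0r !mul1r subr_lt0. Qed.

Lemma attains_eval_ge0 x tau w y v : eval_ok x tau w -> (0 < tau)%N ->
  attains y v -> 0 <= fev w y.
Proof.
case: tau => [|[|[|//]]] // => [[_ _ Cw _] _ [[_ _ H] _]|[-> _] _ [[_ H _] _]].
  exact: H.
by rewrite leNgt gap_lt0 -leNgt.
Qed.

(** A violated constraint stays negative at [y], so [y] is infeasible; an upper bound gives
    [v <= w(y) <= w(x) <= vb]. *)
Lemma dominated x tau w y v (f : bool) vb : eval_ok x tau w ->
  (tau = 0%N -> f /\ fev w x <= vb) -> fev w y <= fev w x -> no_better f vb y v.
Proof.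
move=> ew rec yx at_; case: (posnP tau) => [t0|t0]; last first.
  by have := eval_neg ew t0; have := attains_eval_ge0 ew t0 at_; lra.
have [-> vx] := rec t0; split=> //; apply: le_trans vx; apply: le_trans yx.
by case: at_ => _; apply; move: ew; rewrite t0 => -[].
Qed.

Lemma fev_super w x y g : rd x g -> 0 <= y ->
  fev w y <= fev w x + fslope w g * (y - x).
Proof.
move=> hx y0; have := ler_wpM2l (ler0n R w.1.2) (rd_super hx y0).
by rewrite /fev /fslope; lra.
Qed.

Section Shrink.
Variables (lo hi x : R) (f f' : bool) (vb vb' : R) (tau : nat) (w : form) (g : R).
Hypothesis out : outside_done lo hi f vb.
Hypothesis rdx : rd x g.
Hypothesis ew : eval_ok x tau w.
Hypothesis rec : tau = 0%N -> f' /\ fev w x <= vb'.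
Hypothesis keep : f -> f' /\ vb <= vb'.

(** The slope at [x] is a supergradient of the form, so to the left of [x] the form is no larger
    than at [x]. *)
Lemma shrink_lo : 0 < fslope w g -> outside_done x hi f' vb'.
Proof.
move=> s0 y v at_; case: (out at_) => [/andP[ly yh]|[/keep[-> vv] vy]]; last first.
  by right; split=> //; lra.
case: (ltrP x y) => xy; first by left.
right; have y0 : 0 <= y by case: at_ => -[/andP[]].
have yx : fev w y <= fev w x by have := fev_super w rdx y0; nra.
exact: (dominated ew rec yx at_).
Qed.

Lemma shrink_hi : fslope w g <= 0 -> outside_done lo x f' vb'.
Proof.
move=> s0 y v at_; case: (out at_) => [/andP[ly yh]|[/keep[-> vv] vy]]; last first.
  by right; split=> //; lra.
case: (ltrP y x) => xy; first by left; rewrite ly.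
right; have y0 : 0 <= y by case: at_ => -[/andP[]].
have yx : fev w y <= fev w x by have := fev_super w rdx y0; nra.
exact: (dominated ew rec yx at_).
Qed.

End Shrink.

(** The slope [c D' - k] keeps its sign, hence all forms with these coefficients are monotone on the
    bracket, whatever their constant term. *)
Definition unimodal lo hi (c k : nat) :=
  (forall x g, lo <= x < hi -> rd x g -> k%:R < c%:R * g) \/
  (forall x g, lo <= x < hi -> rd x g -> c%:R * g <= k%:R).

Lemma unimodal_sub lo hi lo' hi' c k : lo <= lo' -> hi' <= hi ->
  unimodal lo hi c k -> unimodal lo' hi' c k.
Proof.
move=> h1 h2 [H|H]; [left|right]; move=> x g /andP[x1 x2]; apply: H;
  by rewrite (le_trans h1 x1) (lt_le_trans x2 h2).
Qed.

(** The derivative at the larger point, used backwards as a supergradient, gives strict growth below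
    [hi]. At [hi] itself no derivative is controlled. *)
Lemma unimodal_inc lo hi w : 0 <= lo ->
  (forall x g, lo <= x < hi -> rd x g -> w.2%:R < w.1.2%:R * g) ->
  forall x y, lo <= x -> x < y -> y <= hi -> fev w x < fev w y.
Proof.
move=> lo0 H.
have inc x y : lo <= x -> x < y -> y < hi -> fev w x < fev w y.
  move=> lx xy yh; have y0 : 0 <= y by lra.
  have [g hy] := rd_ex y0; have x0 : 0 <= x by lra.
  have := fev_super w hy x0; have := H y g; rewrite yh (le_trans lx (ltW xy)).
  by move=> /(_ isT hy); rewrite /fslope; nra.
move=> x y lx xy; rewrite le_eqVlt => /orP[/eqP E|]; last exact: inc.
pose z := (x + y) / 2; have [xz zy] : x < z /\ z < y by rewrite /z; lra.
have xz' : fev w x < fev w z by apply: inc => //; rewrite -E.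
(* the monotonicity of D excludes a downward jump at hi *)
pose e := (fev w z - fev w x) / (w.2%:R + 1).
have k0 := ler0n R w.2.
have e0 : 0 < e by rewrite divr_gt0 //; lra.
have ee : e * (w.2%:R + 1) = fev w z - fev w x by rewrite /e divfK //; lra.
(* Over the last stretch, of length at most [e], the linear part loses at most [w.2 * e], less than
   the gain from [x] to [z]. *)
pose u := Num.max z (y - e).
have [zu uy ye] : [/\ z <= u, u < y & y - u <= e].
  by rewrite /u; case: (lerP z (y - e)) => h; split; lra.
have zu' : fev w z <= fev w u.
  move: zu; rewrite le_eqVlt => /orP[/eqP->//|zu].
  by rewrite ltW // inc //; [lra|rewrite -E].
have u0 : 0 <= u by lra.
have := ler_wpM2l (ler0n R w.1.2) (monoD u0 (ltW uy)).
by move: zu' xz'; rewrite /fev in ee *; nra.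
Qed.

Lemma unimodal_noninc lo hi w : 0 <= lo ->
  (forall x g, lo <= x < hi -> rd x g -> w.1.2%:R * g <= w.2%:R) ->
  forall x y, lo <= x -> x <= y -> y <= hi -> fev w y <= fev w x.
Proof.
move=> lo0 H x y lx; rewrite le_eqVlt => /orP[/eqP->//|xy yh].
have x0 : 0 <= x by lra.
have [g hx] := rd_ex x0; have y0 : 0 <= y by lra.
have := fev_super w hx y0; have := H x g; rewrite lx (lt_le_trans xy yh).
by move=> /(_ isT hx); rewrite /fslope; nra.
Qed.

Definition all_unimodal lo hi :=
  forall c k, (c <= m)%N -> (k <= m)%N -> unimodal lo hi c k.

Lemma all_unimodal_sub lo hi lo' hi' : lo <= lo' -> hi' <= hi ->
  all_unimodal lo hi -> all_unimodal lo' hi'.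
Proof. by move=> h1 h2 H c k cm km; apply: unimodal_sub (H c k cm km). Qed.

Section Monotone.
Variables lo hi : R.
Hypothesis lo0 : 0 <= lo.
Hypothesis lohi : lo < hi.
Hypothesis U : all_unimodal lo hi.

Definition nondecr (h : R -> R) := forall x y, lo <= x -> x <= y -> y <= hi -> h x <= h y.
Definition nonincr (h : R -> R) := forall x y, lo <= x -> x <= y -> y <= hi -> h y <= h x.

Lemma form_monotone w : bounded w -> nondecr (fev w) \/ nonincr (fev w).
Proof.
move=> /andP[cm km]; have [H|H] := U cm km; [left|right]; last first.
  exact: unimodal_noninc H.
move=> x y lx; rewrite le_eqVlt => /orP[/eqP->//|xy yh]; apply: ltW.
exact: (unimodal_inc lo0 H).
Qed.

(** If [c - c'] and [k - k'] have the same sign, the difference is up to sign and constant a form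
    with coefficients at most [m]. Otherwise both terms move in the same direction, because [D] is
    monotone. *)
Lemma diff_monotone w w' : bounded w -> bounded w' ->
  let h x := fev w x - fev w' x in nondecr h \/ nonincr h.
Proof.
move: w w' => [[A c] k] [[A' c'] k'] /andP[cm km] /andP[cm' km'] h.
rewrite /= in cm km cm' km'.
have hE x : h x = A - A' + (c%:R - c'%:R) * D x - (k%:R - k'%:R) * x.
  by rewrite /h /fev /=; lra.
have D' (x y : R) : lo <= x -> x <= y -> D x <= D y.
  by move=> lx; apply: monoD; apply: le_trans lx.
case: (leqP c' c) => cc; case: (leqP k k') => kk.
- left=> x y lx xy _; rewrite !hE; have := D' _ _ lx xy.
  have : c'%:R <= c%:R :> R by rewrite ler_nat.
  have : k%:R <= k'%:R :> R by rewrite ler_nat.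
  nra.
- have b : bounded (0, (c - c')%N, (k - k')%N).
    by rewrite /bounded /= !(leq_trans (leq_subr _ _)).
  have E x : h x = A - A' + fev (0, (c - c')%N, (k - k')%N) x.
    by rewrite hE /fev /= !natrB ?(ltnW kk) //; lra.
  case: (form_monotone b) => H; [left|right]; move=> x y lx xy yh;
    by rewrite !E lerD2l H.
- have b : bounded (0, (c' - c)%N, (k' - k)%N).
    by rewrite /bounded /= !(leq_trans (leq_subr _ _)).
  have E x : h x = A - A' - fev (0, (c' - c)%N, (k' - k)%N) x.
    by rewrite hE /fev /= !natrB ?(ltnW cc) //; lra.
  case: (form_monotone b) => H; [right|left]; move=> x y lx xy yh;
    by rewrite !E lerD2l lerN2 H.
- right=> x y lx xy _; rewrite !hE; have := D' _ _ lx xy.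
  have : c%:R <= c'%:R :> R by rewrite ler_nat ltnW.
  have : k'%:R <= k%:R :> R by rewrite ler_nat ltnW.
  nra.
Qed.

(* Increase over the whole bracket; it orders the forms by slope. *)
Definition rise (w : form) : R :=
  w.1.2%:R * (D hi - D lo) - w.2%:R * (hi - lo).

(** A monotone difference that drops somewhere drops over the whole bracket. *)
Lemma rise_lt w w' x y : bounded w -> bounded w' -> lo <= x -> x < y -> y <= hi ->
  fev w y - fev w' y < fev w x - fev w' x -> rise w < rise w'.
Proof.
move=> bw bw' lx xy yh lt.
case: (diff_monotone bw bw') => H; first by have := H x y lx (ltW xy) yh; lra.
have h1 := H lo x (lexx _) lx (le_trans (ltW xy) yh).
have h2 := H y hi (le_trans lx (ltW xy)) yh (lexx _).
by move: h1 h2 lt; rewrite /= /rise /fev; lra.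
Qed.

(** Converts real slopes to integers by counting coefficient pairs; the constant term of a form does
    not affect its rise. *)
Definition rank (w : form) : nat :=
  #|[set p : 'I_m.+1 * 'I_m.+1 | rise (0, val p.1, val p.2) < rise w]|.

Lemma rank_le w : (rank w <= m.+1 * m.+1)%N.
Proof. by rewrite (leq_trans (max_card _)) // card_prod !card_ord. Qed.

Lemma rank_lt w w' : bounded w -> rise w < rise w' -> (rank w < rank w')%N.
Proof.
move=> /andP[cm km] ww'; apply: proper_card; apply/properP; split.
  by apply/subsetP => p; rewrite !inE => /lt_trans; apply.
pose p : 'I_m.+1 * 'I_m.+1 := (inord w.1.2, inord w.2).
have E : rise (0, val p.1, val p.2) = rise w by rewrite /rise /= !inordK.
by exists p; rewrite inE E ?ltxx.
Qed.

End Monotone.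

(** * Newton steps: stopping cases and decrease of the potential *)

Section Newton.
Variables (l0 h0 : R).
Hypothesis l00 : 0 <= l0.
Hypothesis U0 : all_unimodal l0 h0.

(** The outcomes lead, since no step makes them worse. A step replaces one end only, so a base
    exceeding a single rank suffices although two are added. Ranks refer to the initial bracket and
    so stay comparable while the bracket shrinks. *)
Definition potential tL wL tR wR : nat :=
  (tL + tR) * (m.+1 * m.+1).+1 + rank l0 h0 wL + (m.+1 * m.+1 - rank l0 h0 wR).

Variables (lo hi : R) (tL tR : nat) (wL wR : form) (gL : R) (f : bool) (vb : R).
Hypothesis l0lo : l0 <= lo.
Hypothesis lohi : lo < hi.
Hypothesis hih0 : hi <= h0.
Hypothesis eL : eval_ok lo tL wL.
Hypothesis eR : eval_ok hi tR wR.
Hypothesis rL : rd lo gL.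
Hypothesis sL : 0 < fslope wL gL.
Hypothesis recL : tL = 0%N -> f /\ fev wL lo <= vb.
Hypothesis recR : tR = 0%N -> f /\ fev wR hi <= vb.

(** Its zero is where the constraint violated at [lo] becomes satisfied, where the one violated at
    [hi] starts to fail, or where the two upper bounds meet. The signs make it nonpositive at
    [lo]. *)
Definition newton_fun x :=
  if (0 < tL)%N then fev wL x else if (0 < tR)%N then - fev wR x
  else fev wL x - fev wR x.

Let lo0 : 0 <= lo. Proof. exact: le_trans l0lo. Qed.
Let U : all_unimodal lo hi. Proof. exact: all_unimodal_sub U0. Qed.
Let bL := eval_bounded eL.
Let bR := eval_bounded eR.

Lemma wL_inc x y : lo <= x -> x < y -> y <= hi -> fev wL x < fev wL y.
Proof.
apply: unimodal_inc => //; have /andP[cm km] := bL.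
case: (U cm km) => // H; have := H lo gL; rewrite lexx lohi => /(_ isT rL).
by move: sL; rewrite /fslope; lra.
Qed.

(** The left form increases strictly. If it is a constraint not positive at [hi], the interior is
    infeasible; if it is a bound not above the right form at [hi], the recorded value there beats
    the interior. *)
Lemma newton_stop_hi x v : newton_fun hi <= 0 -> lo < x < hi -> no_better f vb x v.
Proof.
rewrite /newton_fun => dh /andP[lx xh] at_.
have wx := wL_inc (ltW lx) xh (lexx _).
case: ifP dh => [tL0 dh|/negbT]; last rewrite -leqNgt leqn0 => /eqP tL0.
  by have := attains_eval_ge0 eL tL0 at_; lra.
case: ifP => [tR0 dh|/negbT]; last rewrite -leqNgt leqn0 => /eqP tR0 dh.
  by have := eval_neg eR tR0; lra.
have [-> vh] := recR tR0; split=> //.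
have : v <= fev wL x.
  by case: at_ => _; apply; move: eL; rewrite tL0 => -[].
lra.
Qed.

(** The evaluation at [lo] ranged over all forms, including the one found at [hi]: a constraint from
    there holds at a feasible [lo], and a bound from there is no smaller than [wL]. *)
Lemma newton_fun_lo : newton_fun lo <= 0.
Proof.
rewrite /newton_fun; case: ifP => [tL0|/negbT]; first by rewrite ltW // (eval_neg eL).
rewrite -leqNgt leqn0 => /eqP tL0; move: eL; rewrite tL0 => -[l1 l2 _ l4].
case: ifP => [tR0|/negbT].
  rewrite oppr_le0; case: tR eR tR0 => [|[|[|//]]] // [].
    by move=> _ _ /l2.
  by move=> -> _ _; rewrite leNgt gap_lt0 -leNgt.
rewrite -leqNgt leqn0 => /eqP tR0; move: eR; rewrite tR0 => -[_ _ CR _].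
by rewrite subr_le0; apply: l4.
Qed.

Lemma newton_nondecr : 0 < newton_fun hi -> nondecr lo hi newton_fun.
Proof.
have key (h : R -> R) : nondecr lo hi h \/ nonincr lo hi h -> h lo <= 0 -> 0 < h hi ->
    nondecr lo hi h.
  by case=> // H h1 h2; have := H lo hi (lexx _) (ltW lohi) (lexx _); lra.
move=> h1; apply: key h1; last exact: newton_fun_lo.
rewrite /newton_fun; case: (0 < tL)%N; first exact: (form_monotone lo0 U bL).
case: (0 < tR)%N; last exact: (diff_monotone lo0 U bL bR).
case: (form_monotone lo0 U bR) => H; [right|left]; move=> x y lx xy yh;
  by rewrite lerN2 H.
Qed.

Variable x : R.
Hypothesis lx : lo <= x.
Hypothesis xh : x < hi.
Hypothesis dx : newton_fun x = 0.
Hypothesis dx' : forall y, x < y -> y <= hi -> 0 < newton_fun y.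

Lemma newton_right y v : x < y < hi -> tL = 0%N -> (0 < tR)%N -> no_better f vb y v.
Proof.
move=> /andP[xy yh] tL0 tR0 at_; have := dx' xy (ltW yh).
by rewrite /newton_fun tL0 ltnn tR0; have := attains_eval_ge0 eR tR0 at_; lra.
Qed.

Lemma newton_left y v : lo < y < x -> (0 < tL)%N -> no_better f vb y v.
Proof.
move=> /andP[ly yx] tL0 at_; have := dx; rewrite /newton_fun tL0.
have := wL_inc (ltW ly) yx (ltW xh); have := attains_eval_ge0 eL tL0 at_; lra.
Qed.

(** Left of the crossing the increasing left form is the bound, right of it the right form. Should
    the latter be nondecreasing, its value at [hi] is already recorded. *)
Lemma newton_crossing (f' : bool) vb' y v : tL = 0%N -> tR = 0%N ->
  (f -> f' /\ vb <= vb') -> f' /\ fev wL x <= vb' -> lo < y < hi ->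
  no_better f' vb' y v.
Proof.
move=> tL0 tR0 keep [f'1 vx] /andP[ly yh] at_.
have Ex : fev wL x = fev wR x.
  by have := dx; rewrite /newton_fun tL0 tR0 ltnn; lra.
split=> //; case: (lerP y x) => yx.
  have : v <= fev wL y by case: at_ => _; apply; move: eL; rewrite tL0 => -[].
  move: yx; rewrite le_eqVlt => /orP[/eqP->|yx]; first by lra.
  by have := wL_inc (ltW ly) yx (ltW xh); lra.
have vy : v <= fev wR y by case: at_ => _; apply; move: eR; rewrite tR0 => -[].
case: (form_monotone lo0 U bR) => H.
  have := H y hi (ltW ly) (ltW yh) (lexx _); have [f1 vh] := recR tR0.
  by have [_ vv] := keep f1; lra.
by have := H x y lx (ltW yx) (ltW yh); lra.
Qed.

Lemma newton_stop_lo y v : x <= lo -> lo < y < hi -> no_better f vb y v.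
Proof.
move=> xl yb; have xlo : x = lo by apply/eqP; rewrite eq_le xl.
case: (posnP tL) => tL0; last first.
  by have := dx; rewrite /newton_fun tL0 xlo; have := eval_neg eL tL0; lra.
case: (posnP tR) => tR0; last by apply: newton_right => //; rewrite xlo.
by apply: newton_crossing => //; rewrite xlo; apply: recL.
Qed.

Variables (tau : nat) (w : form) (g : R).
Hypothesis x_gt : lo < x.
Hypothesis ew : eval_ok x tau w.
Hypothesis rx : rd x g.

(** A positive slope makes [w] even smaller at [lo], so a constraint violated at [x] is violated at
    [lo] too. *)
Lemma newton_tau_lo : 0 < fslope w g -> (tau <= tL)%N.
Proof.
move=> s0; have := fev_super w rx lo0.
have : 0 < fslope w g * (x - lo) by rewrite mulr_gt0 // subr_gt0.
move=> pos H; have lt : fev w lo < fev w x by lra.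
case: tau ew => [|[|[|//]]] //= [].
- move=> _ wx Cw _; case: tL eL => // -[_ /(_ _ Cw) h _ _].
  by exfalso; lra.
- move=> E; move: lt; rewrite E => lt wx.
  have : fev gap_form lo < 0 by lra.
  by rewrite gap_lt0; case: tL eL => [|[|]] //= [] h; lra.
Qed.

Lemma newton_tau_hi : fslope w g <= 0 -> (tau <= tR)%N.
Proof.
have hi0 : 0 <= hi by exact: le_trans lo0 (ltW lohi).
move=> s0; have := fev_super w rx hi0.
have : fslope w g * (hi - x) <= 0 by rewrite mulr_le0_ge0 // subr_ge0 ltW.
move=> pos H; have lt : fev w hi <= fev w x by lra.
case: tau ew => [|[|[|//]]] //= [].
- move=> _ wx Cw _; case: tR eR => // -[_ /(_ _ Cw) h _ _].
  by exfalso; lra.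
- move=> E; move: lt; rewrite E => lt wx.
  have : fev gap_form hi < 0 by lra.
  by rewrite gap_lt0; case: tR eR => [|[|]] //= [] h; lra.
Qed.

(** If the outcome does not improve, [wL] is tightest at [lo] while [w] lies strictly below it at
    [x]. So the difference drops, and with it the rank. *)
Lemma newton_potential_lo : 0 < fslope w g -> ~ (tL = 0%N /\ (0 < tR)%N) ->
  (tL = 0%N -> tR = 0%N -> fev w x < fev wL x) ->
  (potential tau w tR wR < potential tL wL tR wR)%N.
Proof.
move=> s0 h1 h2; have bw := eval_bounded ew; rewrite /potential.
have := newton_tau_lo s0; rewrite leq_eqVlt => /orP[/eqP E|lt]; last first.
  by rewrite ltn_add2r lex_ltn ?rank_le // ltn_add2r.
suff : (rank l0 h0 w < rank l0 h0 wL)%N by rewrite E ltn_add2r ltn_add2l.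
apply: (rank_lt bw).
apply: (@rise_lt l0 h0 l00 U0 w wL lo x bw bL l0lo x_gt (le_trans (ltW xh) hih0)).
have lt : fev w x < fev wL x.
  case: (posnP tL) => tL0; first by apply: h2 => //; case: (posnP tR) h1 => // ? [].
  by have := dx; rewrite /newton_fun tL0; have := eval_neg ew; rewrite E => /(_ tL0); lra.
suff : fev wL lo <= fev w lo by lra.
move: ew eL; rewrite E; case: tL => [|[|[|//]]] /=.
- by move=> [_ _ Cw _] [_ _ _ H]; apply: H.
- by move=> [_ _ Cw _] [_ _ _ H]; apply: H.
- by move=> [-> _] [-> _].
Qed.

Lemma newton_potential_hi : fslope w g <= 0 -> tL = 0%N ->
  (tR = 0%N -> fev w x < fev wL x) ->
  (potential tL wL tau w < potential tL wL tR wR)%N.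
Proof.
move=> s0 tL0 h2; have bw := eval_bounded ew; rewrite /potential.
have := newton_tau_hi s0; rewrite leq_eqVlt => /orP[/eqP E|lt]; last first.
  by rewrite addnAC [ltnRHS]addnAC ltn_add2r lex_ltn ?leq_subr // ltn_add2l.
suff lt : (rank l0 h0 wR < rank l0 h0 w)%N.
  by rewrite E ltn_add2l ltn_sub2l // (leq_trans lt) // rank_le.
apply: (rank_lt bR).
apply: (@rise_lt l0 h0 l00 U0 wR w x hi bR bw (le_trans l0lo lx) xh hih0).
have lt : fev w x < fev wR x.
  have := dx; rewrite /newton_fun tL0 ltnn; case: (posnP tR) => tR0.
    by have := h2 tR0; lra.
  by have := eval_neg ew; rewrite E => /(_ tR0); lra.
suff : fev wR hi <= fev w hi by lra.
move: ew eR; rewrite E; case: tR => [|[|[|//]]] /=.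
- by move=> [_ _ Cw _] [_ _ _ H]; apply: H.
- by move=> [_ _ Cw _] [_ _ _ H]; apply: H.
- by move=> [-> _] [-> _].
Qed.

End Newton.
End Bracketing.

(** * Cuts of an instance as functions of the minimum over R_1 *)

Section Instance.
Variables (R : realType) (n m : nat) (I : aemfp R n m 1).
Local Notation D := (deviation I ord0).
Local Notation HR := (homologous I ord0).

(* The network closed by an arc from the sink to the source, of index m. *)
Definition arc_cap : R := \sum_e cap I e.
Definition xtl (e : 'I_m.+1) : 'I_n :=
  if unlift ord_max e is Some i then tail I i else snk I.
Definition xhd (e : 'I_m.+1) : 'I_n :=
  if unlift ord_max e is Some i then head I i else src I.
Definition xcap (e : 'I_m.+1) : R :=
  if unlift ord_max e is Some i then cap I i else arc_cap.
Definition xhom (e : 'I_m.+1) : bool :=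
  if unlift ord_max e is Some i then i \in HR else false.

Lemma widen_lift (i : 'I_m) : widen_ord (leqnSn m) i = lift ord_max i.
Proof. by apply: val_inj; rewrite /= /bump leqNgt ltn_ord. Qed.

Definition xlo (x : R) (e : 'I_m.+1) : R := if xhom e then x else 0.
Definition xup (y : R) (e : 'I_m.+1) : R :=
  if xhom e then (if xcap e <= y then xcap e else y) else xcap e.

Local Notation lcap x S := (lowcap xtl xhd (xlo x) (xup (D x)) S).

Definition leaves (S : {set 'I_n}) e := (xtl e \in S) && (xhd e \notin S).
Definition enters (S : {set 'I_n}) e := (xhd e \in S) && (xtl e \notin S).

(* X selects the homologous edges whose capacity is taken to be D x, whatever
   the smaller of D x and the given capacity. *)
Definition cut_form (S : {set 'I_n}) (X : 'I_m.+1 -> bool) : form R :=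
  (\sum_e (if leaves S e && ~~ (xhom e && X e) then xcap e else 0),
   (\sum_e (leaves S e && (xhom e && X e)))%N,
   (\sum_e (enters S e && xhom e))%N).

Definition is_cut_form (w : form R) := exists S X, w = cut_form S X.
Definition is_st_cut_form (w : form R) := exists (S : {set 'I_n}) X,
  [/\ src I \in S, snk I \notin S & w = cut_form S X].

(** The closing arc is not homologous, which keeps the count at [m] instead of [m.+1]. *)
Lemma sum_xhom_le (F : 'I_m.+1 -> bool) : (\sum_e (F e && xhom e) <= m)%N.
Proof.
rewrite big_ord_recr /= {2}/xhom unlift_none andbF addn0.
apply: (@leq_trans (\sum_(i < m) 1)%N); last by rewrite sum1_card card_ord.
by apply: leq_sum => i _; case: (_ && _).
Qed.

Lemma cut_form_bounded S X : bounded m (cut_form S X).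
Proof.
rewrite /bounded /= sum_xhom_le andbT.
rewrite (eq_bigr (fun e => (leaves S e && X e && xhom e) : nat)) ?sum_xhom_le //.
by move=> e _; rewrite -andbA (andbC (X e)).
Qed.

Lemma is_cut_form_bounded w : is_cut_form w -> bounded m w.
Proof. by move=> [S [X ->]]; apply: cut_form_bounded. Qed.

Lemma is_st_cut_form_bounded w : is_st_cut_form w -> bounded m w.
Proof. by move=> [S [X [_ _ ->]]]; apply: cut_form_bounded. Qed.

Lemma fev_cut_form S X x : fev D (cut_form S X) x =
  lowcap xtl xhd (xlo x) (fun e => if xhom e && X e then D x else xcap e) S.
Proof.
rewrite /fev /= !natr_sum !mulr_suml -big_split -sumrB /=.
apply: eq_bigr => e _; rewrite /edgecap /leaves /enters /xlo.
by case: (xtl e \in S); case: (xhd e \in S); case: (xhom e); case: (X e) => /=; lra.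
Qed.

(** The smaller of the capacity and [D x] lies below either choice, so every [X] gives a bound at
    every point; the next lemma picks the [X] that is exact at [x]. *)
Lemma lcap_le_form S X x : lcap x S <= fev D (cut_form S X) x.
Proof.
rewrite fev_cut_form; apply: ler_sum => e _; rewrite /edgecap /xup.
by case: (xtl e \in S); case: (xhd e \in S); case: (xhom e); case: (X e) => //=;
  case: ifP => // /negbT; rewrite -ltNge => /ltW.
Qed.

Lemma lcap_form S x : lcap x S = fev D (cut_form S (fun e => ~~ (xcap e <= D x))) x.
Proof.
rewrite fev_cut_form; apply: eq_bigr => e _; rewrite /edgecap /xup.
by case: (xhom e) => //=; case: (xcap e <= D x).
Qed.

Variable hmax : R.
Hypothesis hmaxP : is_min_on (cap I) HR hmax.

Local Notation att := (attains D hmax is_cut_form is_st_cut_form).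
Local Notation ok := (eval_ok D is_cut_form is_st_cut_form).

Lemma cap_nneg e : 0 <= cap I e. Proof. exact: (forallP (cap_ge0 I)). Qed.

Lemma hmax_ge0 : 0 <= hmax.
Proof. by case: hmaxP => -[e _ <-] _; apply: cap_nneg. Qed.

Lemma xbounds x : 0 <= x <= hmax -> x <= D x -> forall e, xlo x e <= xup (D x) e.
Proof.
move=> /andP[x0 xh] xD e; rewrite /xlo /xup /xhom /xcap.
case: (unlift ord_max e) => [i|]; last by apply: sumr_ge0 => i _; apply: cap_nneg.
case: ifP => iHR; last exact: cap_nneg.
case: ifP => // _; apply: le_trans xh _; by case: hmaxP => _; apply.
Qed.

Lemma xlo_ge0 x e : 0 <= x -> 0 <= xlo x e.
Proof. by rewrite /xlo; case: ifP. Qed.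

(** The arc enters such a set and has lower bound 0, so its deletion changes nothing. *)
Lemma lcap_upd_arc x (S : {set 'I_n}) : src I \in S -> snk I \notin S ->
  lowcap xtl xhd (upd (xlo x) ord_max 0) (upd (xup (D x)) ord_max 0) S = lcap x S.
Proof.
move=> sS tS; rewrite [RHS](lowcap_split _ _ _ _ ord_max) /edgecap.
by rewrite /xtl /xhd /xlo /xhom unlift_none sS (negbTE tS) oppr0 addr0.
Qed.

Lemma sum_net_out0 (g : {ffun 'I_m -> R}) : \sum_v net_out I g v = 0.
Proof.
under eq_bigr do rewrite net_outE.
rewrite (eq_bigl (mem [set: 'I_n])) => [|v]; last by rewrite !inE.
by rewrite sum_incidence big1 // => e _; rewrite !inE subrr mulr0.
Qed.

Lemma net_out_xsum (f : 'I_m.+1 -> R) v :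
  \sum_e f e * ((xtl e == v)%:R - (xhd e == v)%:R) =
  net_out I [ffun i => f (lift ord_max i)] v +
  f ord_max * ((snk I == v)%:R - (src I == v)%:R).
Proof.
rewrite big_ord_recr net_outE /= /xtl /xhd unlift_none; congr (_ + _).
by apply: eq_bigr => i _; rewrite widen_lift liftK ffunE.
Qed.

Lemma snk_net_out g : st_flow I g -> net_out I g (snk I) = - flow_value I g.
Proof.
move=> [_ cons _ _]; have := sum_net_out0 g.
have st : snk I != src I by rewrite eq_sym src_neq_snk.
rewrite (bigD1 (src I)) //= (bigD1 (snk I)) //= big1 => [|v /andP[vs vt]].
  by rewrite addr0 addrC => /eqP; rewrite addr_eq0 => /eqP.
exact: cons.
Qed.

(** Justifies the capacity of the closing arc: it never restricts a flow. *)
Lemma flow_value_le_arc g : st_flow I g -> flow_value I g <= arc_cap.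
Proof.
move=> [gb _ _ _]; rewrite /flow_value net_outE; apply: ler_sum => e _.
by have := gb e; do 2 case: eqP => _ /=; lra.
Qed.

(** The arc carries the flow value back, which makes the flow a circulation whose lower bound on the
    homologous edges is its own minimum. *)
Lemma almost_equal_attains g : almost_equal_flow I g ->
  exists x, att x (flow_value I g).
Proof.
move=> [gf ge]; have [x [[e0 e0R ge0] xmin] xb] := ge ord0; exists x.
case: (gf) => gb cons vs vt.
have x0 : 0 <= x by rewrite -ge0; have /andP[] := gb e0.
have xD : x <= D x by have := xb e0 e0R; rewrite ge0 => /andP[].
have xh : x <= hmax.
  have [[e eR <-] _] := hmaxP; apply: le_trans (xmin e eR) _.
  by have /andP[] := gb e.
pose f (e : 'I_m.+1) := if unlift ord_max e is Some i then g i else flow_value I g.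
have fE : [ffun i => f (lift ord_max i)] = g.
  by apply/ffunP => i; rewrite ffunE /f liftK.
have fm : f ord_max = flow_value I g by rewrite /f unlift_none.
have cf : conserved xtl xhd f.
  move=> v; rewrite net_out_xsum fE fm.
  have st := src_neq_snk I; rewrite !(eq_sym _ v).
  have [->|vs'] := altP (v =P src I); first by rewrite (negbTE st) /flow_value /=; lra.
  have [->|vt'] := altP (v =P snk I); first by rewrite (snk_net_out gf) /=; lra.
  by rewrite cons //=; lra.
have fb e : xlo x e <= f e <= xup (D x) e.
  rewrite /xlo /xup /f /xhom /xcap; case: (unlift ord_max e) => [i|]; last first.
    by rewrite vs flow_value_le_arc.
  case: ifP => iR; last exact: gb.
  by have /andP[h1 h2] := xb i iR; have /andP[_ h3] := gb i; rewrite h1; case: ifP.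
split.
  split=> //; first by rewrite x0.
  move=> w [S [X ->]]; apply: le_trans (lcap_le_form S X x).
  exact: circulation_cut0 cf fb.
move=> w [S [X [sS tS ->]]]; apply: le_trans (lcap_le_form S X x).
rewrite -lcap_upd_arc // -fm; apply: circulation_cut cf fb _ _;
  by rewrite /xtl /xhd unlift_none.
Qed.

Lemma circulation_almost_equal x (f : 'I_m.+1 -> R)
    (g := [ffun i : 'I_m => f (lift ord_max i)]) :
  0 <= x -> conserved xtl xhd f -> (forall e, xlo x e <= f e <= xup (D x) e) ->
  almost_equal_flow I g /\ flow_value I g = f ord_max.
Proof.
move=> x0 cf fb; have st := src_neq_snk I.
have net v : net_out I g v = - (f ord_max * ((snk I == v)%:R - (src I == v)%:R)).
  by apply/eqP; rewrite -addr_eq0 -net_out_xsum cf.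
have f0 : 0 <= f ord_max.
  by have /andP[h _] := fb ord_max; apply: le_trans h; apply: xlo_ge0.
have val : flow_value I g = f ord_max.
  by rewrite /flow_value net eqxx eq_sym (negbTE st) /=; lra.
have gE i : g i = f (lift ord_max i) by rewrite ffunE.
split=> //; split.
  split=> [i|v vs vt||].
  - rewrite gE; have := fb (lift ord_max i); have := xlo_ge0 (lift ord_max i) x0.
    rewrite /xup /xcap liftK => h0 /andP[h1 h2].
    rewrite (le_trans h0 h1) (le_trans h2) //; case: ifP => //; case: ifP => // /negbT.
    by rewrite -ltNge => /ltW.
  - by rewrite net !(eq_sym _ v) (negbTE vs) (negbTE vt) /=; lra.
  - by rewrite -/(flow_value I g) val.
  - by rewrite net eqxx (negbTE st) /=; lra.
move=> i; have -> : i = ord0 by apply: val_inj; case: i => -[].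
have /set0Pn[e0 e0R] := homologous_neq0 I ord0.
case: (arg_minP (fun e => g e) e0R) => e eR' emin; have eR : e \in HR by [].
exists (g e) => [|e' e'R]; first by split; [exists e|].
rewrite emin //=; have xe : x <= g e.
  by rewrite gE; have := fb (lift ord_max e); rewrite /xlo /xhom liftK eR => /andP[].
(* The actual minimum [g e] may exceed the lower bound [x]; monotonicity of the deviation covers
   this. *)
have Dx := @deviation_mono _ _ _ _ I ord0 _ _ x0 xe; apply: le_trans Dx.
rewrite gE; have := fb (lift ord_max e'); rewrite /xup /xhom liftK e'R => /andP[_].
by case: ifP => // h1 h2; apply: le_trans h2 _.
Qed.

Lemma eval_ok_infeasible x S : x <= D x -> lcap x S < 0 ->
  (forall S', lcap x S <= lcap x S') ->
  ok x 1 (cut_form S (fun e => ~~ (xcap e <= D x))).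
Proof.
move=> xD neg mn; split=> //=; rewrite -?lcap_form //; first by exists S; eexists.
by move=> w [S' [X ->]]; apply: le_trans (mn S') (lcap_le_form _ _ _).
Qed.

Lemma eval_ok_feasible x (S : {set 'I_n}) : x <= D x -> (forall S', 0 <= lcap x S') ->
  src I \in S -> snk I \notin S ->
  (forall S' : {set 'I_n}, src I \in S' -> snk I \notin S' -> lcap x S <= lcap x S') ->
  ok x 0 (cut_form S (fun e => ~~ (xcap e <= D x))).
Proof.
move=> xD nn sS tS mn; split=> //=; rewrite -?lcap_form.
- by move=> w [S' [X ->]]; apply: le_trans (nn S') (lcap_le_form _ _ _).
- by exists S; eexists.
- by move=> w [S' [X [sS' tS' ->]]]; apply: le_trans (mn S' sS' tS') (lcap_le_form _ _ _).
Qed.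

End Instance.

(** * Total correctness and running time *)

Definition iv a := IGet a (INum 0).
Definition rv a := RGet a (INum 0).
Notation "a :=i e" := (ISet a (INum 0) e) (at level 70).
Notation "a :=r e" := (RSet a (INum 0) e) (at level 70).
Notation "c1 ;; c2" := (Seq c1 c2) (at level 90, right associativity).

Definition For i N body :=
  i :=i INum 0 ;;
  While (BILe (IAdd (iv i) (INum 1)) N) (body ;; i :=i IAdd (iv i) (INum 1)).

Section WeakestPrecondition.
Variables (R : realType) (q : nat) (T : nat -> nat -> nat).
Variables (mf : flow_oracle R) (rt : {poly R} -> seq R).
Local Notation state := (state R).

(** A terminating run is asserted together with its cost, so correctness and time are proved at
    once. *)
Definition wp (c : cmd) (st : state) (Q : state -> nat -> Prop) :=
  exists st' k, exec q T mf rt c st st' k /\ Q st' k.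

Fixpoint imods (c : cmd) : seq nat :=
  match c with
  | ISet a _ _ => [:: a]
  | Seq c1 c2 | If _ c1 c2 => imods c1 ++ imods c2
  | While _ c1 => imods c1
  | Roots _ _ _ cnt => [:: cnt]
  | _ => [::]
  end.

Fixpoint rmods (c : cmd) : seq nat :=
  match c with
  | RSet a _ _ => [:: a]
  | Seq c1 c2 | If _ c1 c2 => rmods c1 ++ rmods c2
  | While _ c1 => rmods c1
  | Roots _ _ out _ => [:: out]
  | MaxFlow _ _ _ _ _ _ _ out => [:: out]
  | _ => [::]
  end.

Definition frame (mi mr : seq nat) (s s' : state) :=
  (forall a j, a \notin mi -> imem s' a j = imem s a j) /\
  (forall a j, a \notin mr -> rmem s' a j = rmem s a j).

Lemma frame_refl mi mr s : frame mi mr s s. Proof. by []. Qed.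

Lemma frame_trans mi mr s1 s2 s3 : frame mi mr s1 s2 -> frame mi mr s2 s3 ->
  frame mi mr s1 s3.
Proof.
move=> [i1 r1] [i2 r2]; split=> a j h; first by rewrite i2 // i1.
by rewrite r2 // r1.
Qed.

Lemma frame_sub mi mr mi' mr' s1 s2 : {subset mi <= mi'} -> {subset mr <= mr'} ->
  frame mi mr s1 s2 -> frame mi' mr' s1 s2.
Proof.
move=> si sr [i r]; split=> a j h; first by apply: i; apply: contra h; apply: si.
by apply: r; apply: contra h; apply: sr.
Qed.

Lemma frame_up mi mr mi' mr' s1 s2 : all (mem mi') mi -> all (mem mr') mr ->
  frame mi mr s1 s2 -> frame mi' mr' s1 s2.
Proof. by move=> /allP si /allP sr; apply: frame_sub. Qed.

Lemma frame_iput mi mr s s' a j v : a \in mi -> frame mi mr s s' ->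
  frame mi mr s (iput s' a j v).
Proof.
move=> ai [fi fr]; split=> // a' j' h /=; rewrite fi //.
by case: eqP h => // ->; rewrite ai.
Qed.

Lemma frame_rput mi mr s s' a j v : a \in mr -> frame mi mr s s' ->
  frame mi mr s (rput s' a j v).
Proof.
move=> ai [fi fr]; split=> // a' j' h /=; rewrite fr //.
by case: eqP h => // ->; rewrite ai.
Qed.

Lemma exec_frame c s s' k : exec q T mf rt c s s' k -> frame (imods c) (rmods c) s s'.
Proof.
elim=> {c s s' k} //=.
- move=> a i e st; split=> // a' j; rewrite inE /= => /negbTE h.
  by rewrite h.
- move=> a i e st; split=> // a' j; rewrite inE /= => /negbTE h.
  by rewrite h.
- move=> c1 c2 st st1 st2 k1 k2 _ f1 _ f2; apply: (@frame_trans _ _ _ st1);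
    [move: f1|move: f2]; apply: frame_sub => a h;
    by rewrite mem_cat h ?orbT.
- move=> b c1 c2 st st1 k _; case: (beval st b); apply: frame_sub => a h;
    by rewrite mem_cat h ?orbT.
- by move=> b c st st1 st2 k1 k2 _ _ f1 _ f2; apply: frame_trans f1 f2.
- move=> a len out cnt st p _ _ _; split=> a' j; rewrite inE /= => /negbTE h; by rewrite h.
- move=> *; split=> // a' j; rewrite inE /= => /negbTE h; by rewrite h.
Qed.

(** The frame is read off the syntax of [c], so specifications mention only what changes. *)
Lemma wp_conseq c st (Q Q' : state -> nat -> Prop) : wp c st Q ->
  (forall s k, frame (imods c) (rmods c) st s -> Q s k -> Q' s k) -> wp c st Q'.
Proof.
move=> [s [k [e Qs]]] H; exists s, k; split=> //.
by apply: H => //; apply: exec_frame e.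
Qed.

Lemma wp_skip st (Q : state -> nat -> Prop) : Q st 1%N -> wp Skip st Q.
Proof. by move=> h; exists st, 1%N; split=> //; constructor. Qed.

Lemma wp_iset a i e st (Q : state -> nat -> Prop) :
  Q (iput st a (ieval st i) (ieval st e)) (1 + icost i + icost e)%N -> wp (ISet a i e) st Q.
Proof. by move=> h; eexists; eexists; split; [constructor|]. Qed.

Lemma wp_rset a i e st (Q : state -> nat -> Prop) :
  Q (rput st a (ieval st i) (reval st e)) (1 + icost i + rcost e)%N -> wp (RSet a i e) st Q.
Proof. by move=> h; eexists; eexists; split; [constructor|]. Qed.

Lemma wp_seq c1 c2 st (Q : state -> nat -> Prop) :
  wp c1 st (fun s1 k1 => wp c2 s1 (fun s2 k2 => Q s2 (1 + k1 + k2)%N)) ->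
  wp (Seq c1 c2) st Q.
Proof.
move=> [s1 [k1 [e1 [s2 [k2 [e2 h]]]]]]; exists s2, (1 + k1 + k2)%N; split=> //.
exact: ExecSeq e1 e2.
Qed.

Lemma wp_if b c1 c2 st (Q : state -> nat -> Prop) :
  (beval st b -> wp c1 st (fun s k => Q s (1 + bcost b + k)%N)) ->
  (~~ beval st b -> wp c2 st (fun s k => Q s (1 + bcost b + k)%N)) ->
  wp (If b c1 c2) st Q.
Proof.
move=> h1 h2; case: (boolP (beval st b)) => hb.
  have [s [k [e h]]] := h1 hb; exists s, (1 + bcost b + k)%N; split=> //.
  by apply: ExecIf; rewrite hb.
have [s [k [e h]]] := h2 hb; exists s, (1 + bcost b + k)%N; split=> //.
by apply: ExecIf; rewrite (negbTE hb).
Qed.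

(** [j] is the variant and [t] bounds one pass of the body; the extra round in [j.+1] pays for the
    final failing test. *)
Lemma wp_while b c (Inv : nat -> state -> Prop) (t j : nat) st (Q : state -> nat -> Prop) :
  Inv j st ->
  (forall j s, frame (imods c) (rmods c) st s -> Inv j s -> beval s b ->
     wp c s (fun s' k => (k <= t)%N /\
       (frame (imods c) (rmods c) s s' -> exists2 j', (j' < j)%N & Inv j' s'))) ->
  (forall j' s k, frame (imods c) (rmods c) st s -> Inv j' s -> ~~ beval s b ->
     (j' <= j)%N -> (k <= j.+1 * (t + bcost b + 2))%N -> Q s k) ->
  wp (While b c) st Q.
Proof.
move=> Ij step post.
have key i s : frame (imods c) (rmods c) st s -> Inv i s ->
    wp (While b c) s (fun s' k => (k <= i.+1 * (t + bcost b + 2))%N /\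
      [/\ frame (imods c) (rmods c) st s', ~~ beval s' b
        & exists2 j', (j' <= i)%N & Inv j' s']).
  elim: i {-2}i (leqnn i) s => [|N IH] i iN s fs Is.
    case: (boolP (beval s b)) => hb; last first.
      exists s, (1 + bcost b)%N; split; first exact: ExecWhileF.
      by split; [rewrite mulSn; lia|split=> //; exists i].
    have [s1 [k1 [e1 [_ h1]]]] := step _ _ fs Is hb.
    have [j' j'i _] := h1 (exec_frame e1).
    by move: iN j'i; rewrite leqn0 => /eqP->; rewrite ltn0.
  case: (boolP (beval s b)) => hb; last first.
    exists s, (1 + bcost b)%N; split; first exact: ExecWhileF.
    by split; [rewrite mulSn; lia|split=> //; exists i].
  have [s1 [k1 [e1 [k1t h1]]]] := step _ _ fs Is hb.
  have [j' j'i Ij'] := h1 (exec_frame e1).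
  have j'N : (j' <= N)%N by rewrite -ltnS (leq_trans j'i).
  have [s2 [k2 [e2 [k2t [f2 nb [j2 j2i I2]]]]]] :=
    IH j' j'N s1 (frame_trans fs (exec_frame e1)) Ij'.
  exists s2, (1 + bcost b + k1 + k2)%N; split; first exact: ExecWhileT e1 e2.
  split; last by split=> //; exists j2 => //; apply: leq_trans (ltnW j'i).
  have : (j'.+1 * (t + bcost b + 2) <= i * (t + bcost b + 2))%N by rewrite leq_mul2r j'i orbT.
  by move=> h; rewrite [leqRHS]mulSn; lia.
have [s' [k [e [kt [f' nb [j' j'j Ij']]]]]] := key j st (frame_refl _ _ _) Ij.
by exists s', k; split=> //; apply: (post j').
Qed.

Lemma wp_for i N body st (nN t : nat) (Inv : nat -> state -> Prop)
    (Q : state -> nat -> Prop) :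
  i \notin imods body ->
  (forall s, frame (i :: imods body) (rmods body) st s -> ieval s N = nN) ->
  Inv 0%N (iput st i 0 0) ->
  (forall j s, (j < nN)%N -> frame (i :: imods body) (rmods body) st s ->
     imem s i 0 = j -> Inv j s ->
     wp body s (fun s' k => (k <= t)%N /\
       (frame (imods body) (rmods body) s s' -> Inv j.+1 (iput s' i 0 j.+1)))) ->
  (forall s k, frame (i :: imods body) (rmods body) st s -> Inv nN s ->
     (k <= nN.+1 * (t + icost N + 20))%N -> Q s k) ->
  wp (For i N body) st Q.
Proof.
move=> ib hN I0 step post; apply/wp_seq/wp_iset => /=.
pose Inv' k s := exists j, [/\ (j + k = nN)%N, imem s i 0 = j, Inv j s &
  frame (i :: imods body) (rmods body) st s].
have f0 : frame (i :: imods body) (rmods body) st (iput st i 0 0).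
  by split=> // a j; rewrite inE negb_or /= => /andP[/negbTE -> _].
apply: (@wp_while _ _ Inv' (t + 9) nN).
- by exists 0%N; split=> //=; rewrite !eqxx.
- move=> k s _ [j [jk ij Ij fj]]; rewrite /= (hN _ fj) ij addn1 => jn.
  have [s1 [k1 [e1 [k1t h1]]]] := step _ _ jn fj ij Ij.
  apply: wp_seq; exists s1, k1; split=> //; apply: wp_iset => /=.
  split; first by lia.
  have ff := exec_frame e1.
  move=> _; exists k.-1; first by lia.
  have ij1 : imem s1 i 0 = j by rewrite ff.1 // ij.
  rewrite ij1 addn1; exists j.+1; split; first by lia.
  + by rewrite /= !eqxx.
  + exact: h1.
  + apply: frame_trans fj _; split=> a j'; rewrite ?inE ?negb_or /=.
      by move=> /andP[/negbTE -> h]; rewrite /= ff.1.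
    by move=> h; rewrite ff.2.
- move=> k s c _ [j [jk ij Ij fj]]; rewrite /= (hN _ fj) ij addn1 -ltnNge ltnS => nj kn ck.
  have jn : j = nN by lia.
  rewrite jn in Ij; apply: post => //.
  have -> : (nN.+1 * (t + icost N + 20) = nN.+1 * (t + icost N + 17) + nN.+1 * 3)%N.
    by rewrite -mulnDr; congr muln; lia.
  have : (nN.+1 * (t + 9 + (1 + (1 + 2 + 1) + icost N) + 2) <=
          nN.+1 * (t + icost N + 17))%N by rewrite leq_mul2l; apply/orP; right; lia.
  by move: ck; rewrite /=; lia.
Qed.

End WeakestPrecondition.

Arguments wp_while {R q T mf rt b c} Inv t j {st Q}.
Arguments wp_for {R q T mf rt i N body st} nN t Inv {Q}.

(** * The program up to the evaluation of a parameter *)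

Definition eN := IGet 0 (INum 0).
Definition eM := IGet 0 (INum 1).
Definition eS := IGet 0 (INum 2).
Definition eT := IGet 0 (INum 3).
Definition eP := IGet 0 (INum 4).
Definition eQ := IGet 0 (INum 5).
Definition BRLt e1 e2 := BNot (BRLe e2 e1).
Definition BILt e1 e2 := BNot (BILe e2 e1).
Definition BOr b1 b2 := BNot (BAnd (BNot b1) (BNot b2)).
Definition RNeg e := RSub RZero e.

(* Integer arrays: 5 offsets of the pieces in the coefficient table, 10 14 23 24
   30 31 loop counters, 11 piece, 12 13 bisection, 15 number of roots, 16 17
   source and sink of a max-flow call, 18 19 its tails and heads, 20 residually
   reachable nodes, 21 22 most violated pair, 25 26 27 outcome of an evaluation
   (current, at lo, at hi), 28 run flag, 29 side, 32 33 saved outcomes, 34 edge.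
   Cell m of the arrays 1, 2, 3 describes the arc from the sink to the source.
   Real arrays: 3 4 lower and upper bounds, 5 point, 6 7 value and derivative of
   a piece, 8 9 10 lambda with D and its right derivative there, 11 excesses,
   12 13 capacities and flow of a max-flow call, 14 deficit, 15 cut value,
   16 smallest cut value, 17 18 19 current form, 20 21 22 lo with D and its
   derivative, 23 24 25 form at lo, 26 27 hi and D there, 28 29 30 form at hi,
   31 32 best value and its lambda, 33 34 35 36 alpha beta gamma delta, 37 38 39
   search interval and first root, 40 41 polynomial and roots, 42 44 50
   temporaries, 43 hmax, 45 46 real copies of the counters 30 31, 47 48 49
   saved form. *)
Definition horner :=
  6 :=r RZero ;; 7 :=r RZero ;;
  For 10 (IAdd eQ (INum 1)) (
    7 :=r RAdd (RMul (rv 7) (rv 5)) (rv 6) ;;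
    6 :=r RAdd (RMul (rv 6) (rv 5))
               (RGet 2 (IAdd (IGet 5 (iv 11)) (ISub eQ (iv 10))))).

Definition bisect pred :=
  12 :=i INum 0 ;; 13 :=i eP ;;
  While (BILe (IAdd (iv 12) (INum 2)) (iv 13)) (
    11 :=i IHalf (IAdd (iv 12) (iv 13)) ;;
    5 :=r RGet 1 (iv 11) ;; horner ;;
    If pred (12 :=i iv 11) (13 :=i iv 11)) ;;
  11 :=i iv 12.

Definition locate :=
  bisect (BRLe (rv 5) (rv 8)) ;;
  5 :=r rv 8 ;; horner ;; 9 :=r rv 6 ;; 10 :=r rv 7.

Definition bounds := For 14 (IAdd eM (INum 1)) (
  If (BILe (INum 1) (IGet 3 (iv 14)))
    (RSet 3 (iv 14) (rv 8) ;;
     If (BRLe (RGet 0 (iv 14)) (rv 9)) (RSet 4 (iv 14) (RGet 0 (iv 14)))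
        (RSet 4 (iv 14) (rv 9)))
    (RSet 3 (iv 14) RZero ;; RSet 4 (iv 14) (RGet 0 (iv 14)))).

Definition build_excess :=
  For 14 eN (RSet 11 (iv 14) RZero) ;;
  For 14 (IAdd eM (INum 1)) (
    RSet 11 (IGet 2 (iv 14)) (RAdd (RGet 11 (IGet 2 (iv 14))) (RGet 3 (iv 14))) ;;
    RSet 11 (IGet 1 (iv 14)) (RSub (RGet 11 (IGet 1 (iv 14))) (RGet 3 (iv 14)))).

Definition build_edges := For 14 eM (
  ISet 18 (iv 14) (IGet 1 (iv 14)) ;; ISet 19 (iv 14) (IGet 2 (iv 14)) ;;
  RSet 12 (iv 14) (RSub (RGet 4 (iv 14)) (RGet 3 (iv 14)))).

Definition build_extra :=
  14 :=r RZero ;;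
  For 14 eN (
    If (BAnd (BILe (iv 14) (iv 16)) (BILe (iv 16) (iv 14)))
      (ISet 18 (IAdd eM (iv 14)) (IGet 1 eM) ;; ISet 19 (IAdd eM (iv 14)) (IGet 2 eM) ;;
       RSet 12 (IAdd eM (iv 14)) (RSub (RGet 4 eM) (RGet 3 eM)))
      (If (BRLe RZero (RGet 11 (iv 14)))
        (ISet 18 (IAdd eM (iv 14)) (iv 16) ;; ISet 19 (IAdd eM (iv 14)) (iv 14) ;;
         RSet 12 (IAdd eM (iv 14)) (RGet 11 (iv 14)))
        (ISet 18 (IAdd eM (iv 14)) (iv 14) ;; ISet 19 (IAdd eM (iv 14)) (iv 17) ;;
         RSet 12 (IAdd eM (iv 14)) (RNeg (RGet 11 (iv 14))) ;;
         14 :=r RAdd (rv 14) (RNeg (RGet 11 (iv 14)))))).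

Definition build := build_excess ;; build_edges ;; build_extra.

Definition cut_value :=
  15 :=r RNeg (rv 14) ;;
  For 14 (IAdd eM eN) (
    If (BAnd (BILe (IGet 18 (iv 14)) (iv 16)) (BILe (iv 16) (IGet 18 (iv 14))))
      (15 :=r RAdd (rv 15) (RGet 13 (iv 14))) Skip ;;
    If (BAnd (BILe (IGet 19 (iv 14)) (iv 16)) (BILe (iv 16) (IGet 19 (iv 14))))
      (15 :=r RSub (rv 15) (RGet 13 (iv 14))) Skip).

Definition probe :=
  build ;; MaxFlow eN (IAdd eM eN) (iv 16) (iv 17) 18 19 12 13 ;; cut_value.

Definition reach_sweep := For 14 (IAdd eM eN) (
    If (BAnd (BILe (INum 1) (IGet 20 (IGet 18 (iv 14))))
             (BRLt (RGet 13 (iv 14)) (RGet 12 (iv 14))))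
      (ISet 20 (IGet 19 (iv 14)) (INum 1)) Skip ;;
    If (BAnd (BILe (INum 1) (IGet 20 (IGet 19 (iv 14)))) (BRLt RZero (RGet 13 (iv 14))))
      (ISet 20 (IGet 18 (iv 14)) (INum 1)) Skip).

Definition reach :=
  For 14 eN (ISet 20 (iv 14) (INum 0)) ;; ISet 20 (iv 16) (INum 1) ;;
  For 23 eN reach_sweep.

Definition compute_form :=
  17 :=r RZero ;; 18 :=r RZero ;; 19 :=r RZero ;;
  For 14 (IAdd eM (INum 1)) (
    If (BAnd (BILe (INum 1) (IGet 20 (IGet 1 (iv 14))))
             (BILt (IGet 20 (IGet 2 (iv 14))) (INum 1)))
      (If (BAnd (BILe (INum 1) (IGet 3 (iv 14))) (BRLt (rv 9) (RGet 0 (iv 14))))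
         (18 :=r RAdd (rv 18) ROne) (17 :=r RAdd (rv 17) (RGet 0 (iv 14)))) Skip ;;
    If (BAnd (BAnd (BILe (INum 1) (IGet 20 (IGet 2 (iv 14))))
                   (BILt (IGet 20 (IGet 1 (iv 14))) (INum 1)))
             (BILe (INum 1) (IGet 3 (iv 14))))
      (19 :=r RAdd (rv 19) ROne) Skip).

Definition update_best :=
  If (BRLt (rv 15) (rv 16)) (16 :=r rv 15 ;; 21 :=i iv 16 ;; 22 :=i iv 17) Skip.

(** A set that is neither empty nor full separates the source from some node, in one of two
    directions. The initial value 0 with the pair source and sink covers the trivial cuts; it
    survives exactly if no cut is violated, and then a smallest cut for that pair is wanted. *)
Definition scan :=
  16 :=r RZero ;; 21 :=i eS ;; 22 :=i eT ;;
  For 24 eN (If (BAnd (BILe (iv 24) eS) (BILe eS (iv 24))) Skip (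
    (16 :=i eS ;; 17 :=i iv 24 ;; probe ;; update_best) ;;
    (16 :=i iv 24 ;; 17 :=i eS ;; probe ;; update_best))).

(** The scan keeps only the best pair, so its flow is computed once more before the cut is read off
    by reachability. *)
Definition evaluate :=
  locate ;;
  If (BRLe (rv 8) (rv 9))
    (bounds ;; scan ;; 16 :=i iv 21 ;; 17 :=i iv 22 ;; probe ;; reach ;;
     compute_form ;; If (BRLe RZero (rv 16)) (25 :=i INum 0) (25 :=i INum 1))
    (17 :=r RZero ;; 18 :=r ROne ;; 19 :=r ROne ;; 25 :=i INum 2).

Section PartialSums.
Variables (V : nmodType) (k : nat) (F : 'I_k -> V).
Definition psum j := \sum_(e < k | (e < j)%N) F e.

Lemma psum0 : psum 0 = 0. Proof. by rewrite /psum big_pred0. Qed.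

Lemma psumS j (jk : (j < k)%N) : psum j.+1 = psum j + F (Ordinal jk).
Proof.
rewrite /psum (bigD1 (Ordinal jk)) //= addrC; congr (_ + _); apply: eq_bigl => e.
by rewrite ltnS -val_eqE /= andbC ltn_neqAle.
Qed.

Lemma psum_all : psum k = \sum_e F e.
Proof. by apply: eq_bigl => e; rewrite ltn_ord. Qed.

End PartialSums.

Section Programs.
Variables (R : realType) (n m q : nat) (I : aemfp R n m 1) (b : seq R).
Variables (P : seq {poly R}) (T : nat -> nat -> nat).
Variables (mf : flow_oracle R) (rt : {poly R} -> seq R).
Local Notation state := (state R).
Local Notation D := (deviation I ord0).
Local Notation wp := (@wp R q T mf rt).
Hypothesis pwD : piecewise_poly q b P D.

(** Besides the input this contains the closing arc and a table of multiples of [q.+1], since the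
    machine cannot multiply integers. *)
Record static (s : state) : Prop := Static {
  st_n : imem s 0 0 = n;
  st_m : imem s 0 1 = m;
  st_s : imem s 0 2 = src I;
  st_t : imem s 0 3 = snk I;
  st_p : imem s 0 4 = size P;
  st_q : imem s 0 5 = q;
  st_tl : forall e : 'I_m.+1, imem s 1 e = xtl I e;
  st_hd : forall e : 'I_m.+1, imem s 2 e = xhd I e;
  st_hom : forall e : 'I_m.+1, imem s 3 e = xhom I e;
  st_cap : forall e : 'I_m.+1, rmem s 0 e = xcap I e;
  st_off : forall i, (i <= size P)%N -> imem s 5 i = (i * q.+1)%N;
  st_b : forall i, (i < size P)%N -> rmem s 1 i = b`_i;
  st_P : forall i j, (i < size P)%N -> (j <= q)%N ->
    rmem s 2 (i * q.+1 + j)%N = (P`_i)`_j }.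

Definition spared (mi mr : seq nat) :=
  all (fun a => a \notin mi) [:: 0; 1; 2; 3; 5]%N && all (fun a => a \notin mr) [:: 0; 1; 2]%N.

Lemma static_frame mi mr s s' : spared mi mr -> frame mi mr s s' -> static s -> static s'.
Proof.
rewrite /spared /= => /andP[/and5P[i0 i1 i2 i3 /andP[i5 _]] /and4P[r0 r1 r2 _]] [fi fr] [].
move=> h1 h2 h3 h4 h5 h6 h7 h8 h9 h10 h11 h12 h13; split; rewrite ?fi // => *;
  by rewrite ?fi ?fr //; auto.
Qed.

Lemma static_iput s a j v : a \notin [:: 0; 1; 2; 3; 5]%N -> static s ->
  static (iput s a j v).
Proof.
move=> am; apply: (@static_frame [:: a] [::]).
  by move: am; do 6![case: a => [|a] //].
by split=> // a' j'; rewrite inE /= => /negbTE ->.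
Qed.

Lemma static_rput s a j v : a \notin [:: 0; 1; 2]%N -> static s ->
  static (rput s a j v).
Proof.
move=> am; apply: (@static_frame [::] [:: a]).
  by move: am; do 6![case: a => [|a] //].
by split=> // a' j'; rewrite inE /= => /negbTE ->.
Qed.

Lemma size_piece i : (i < size P)%N -> (size (P`_i)%R <= q.+1)%N.
Proof. by case: pwD => _ [/allP h _] ip; apply/h/mem_nth. Qed.

(* After j rounds the accumulators hold the polynomial given by the last j
   coefficients, and its derivative, at x. *)
Lemma wp_horner i x s : static s -> (i < size P)%N -> imem s 11 0 = i -> rmem s 5 0 = x ->
  wp horner s (fun s' k => [/\ (k <= 200 * q.+1)%N, rmem s' 6 0 = (P`_i).[x]
    & rmem s' 7 0 = (P`_i)^`().[x]]).
Proof.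
move=> st ip si sx; apply/wp_seq/wp_rset/wp_seq/wp_rset => /=.
pose l := mkseq (fun j => (P`_i)`_j) q.+1.
have lE : Poly l = P`_i.
  apply/polyP => j; rewrite coef_Poly; case: (ltnP j q.+1) => jq; first by rewrite nth_mkseq.
  by rewrite nth_default ?size_mkseq // nth_default // (leq_trans (size_piece ip)).
have sl : size l = q.+1 by rewrite size_mkseq.
set s1 := rput _ 7 _ _.
have st1 : static s1 by do 2 apply: static_rput => //.
pose Inv j (s' : state) := rmem s' 6 0 = (Poly (drop (q.+1 - j) l)).[x] /\
  rmem s' 7 0 = (Poly (drop (q.+1 - j) l))^`().[x].
apply: (wp_for q.+1 40 Inv) => //.
- by move=> s' f /=; rewrite f.1 //= (st_q st) addn1.
- rewrite /Inv subn0 drop_oversize ?sl //; by rewrite /= deriv0 horner0.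
- move=> j s' jq f sj [I1 I2]; apply/wp_seq/wp_rset/wp_rset => /=.
  split; first by [].
  move=> _; rewrite /Inv /= sj.
  have st' : static s' by apply: static_frame f st1.
  have -> : imem s' 11 0 = i by rewrite f.1.
  have -> : rmem s' 5 0 = x by rewrite f.2.
  rewrite (st_q st') (st_off st') ?(ltnW ip) // (st_P st') ?leq_subr //.
  have jE : (q.+1 - j = (q - j).+1)%N by rewrite subSn.
  rewrite I1 I2 jE subSS [in RHS](drop_nth 0) ?sl ?ltnS ?leq_subr //.
  rewrite [in X in _ /\ _ = X](drop_nth 0) ?sl ?ltnS ?leq_subr //.
  rewrite nth_mkseq ?ltnS ?leq_subr // /= !cons_poly_def derivD derivC addr0 derivM derivX.
  by rewrite !hornerE.
- move=> s' k f; rewrite /Inv subnn drop0 lE => -[-> ->] kt; split=> //.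
  by move: kt => /=; lia.
Qed.

(** [pr] holds at the left index and fails at the right one, the end of the list counting as
    failure. The gap is at most [2 ^ j], which gives [L] rounds. *)
Lemma wp_bisect pred (pr : nat -> bool) L s : static s -> (size P <= 2 ^ L)%N ->
  (forall i s', (i < size P)%N -> frame [:: 10; 11; 12; 13]%N [:: 5; 6; 7]%N s s' ->
     rmem s' 5 0 = b`_i -> rmem s' 6 0 = (P`_i).[b`_i] ->
     rmem s' 7 0 = (P`_i)^`().[b`_i] -> beval s' pred = pr i) ->
  pr 0%N ->
  wp (bisect pred) s (fun s' k => (k <= L.+1 * (300 * q.+1 + bcost pred))%N /\
    exists i, [/\ imem s' 11 0 = i, (i < size P)%N, pr i &
      (i.+1 < size P)%N -> ~~ pr i.+1]).
Proof.
move=> st pL predE pr0; have [[_ p0 _ _] _] := pwD.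
apply/wp_seq/wp_iset/wp_seq/wp_iset => /=; apply: wp_seq.
set s1 := iput _ 13 _ _.
have st1 : static s1 by do 2 apply: static_iput => //.
have f1 : frame [:: 10; 11; 12; 13]%N [:: 5; 6; 7]%N s s1.
  by do 2 apply: frame_iput => //.
pose Inv j (s' : state) := exists l r, [/\ imem s' 12 0 = l, imem s' 13 0 = r,
  (l < r <= size P)%N, pr l & (r < size P)%N -> ~~ pr r] /\ (r - l <= 2 ^ j)%N.
apply: (wp_while Inv (200 * q.+1 + bcost pred + 40) L).
- by exists 0%N, (size P); rewrite /= (st_p st) subn0 ltnn p0 leqnn.
- move=> j s' f [l [r [[sl sr /andP[lr rp] prl prr] rl]]]; rewrite /= sl sr => l2r.
  have st' : static s' by apply: static_frame f st1.
  have j0 : (0 < j)%N by case: j rl => //; rewrite expn0; lia.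
  have jE : (2 ^ j = 2 * 2 ^ j.-1)%N by rewrite -expnS prednK.
  apply/wp_seq/wp_iset/wp_seq/wp_rset => /=; rewrite sl sr.
  set mid := ((l + r)./2)%N.
  have lm : (l < mid)%N by rewrite /mid; lia.
  have mr : (mid < r)%N by rewrite /mid; lia.
  have mp : (mid < size P)%N by lia.
  apply: wp_seq; set s2 := rput _ 5 _ _.
  have st2 : static s2 by apply: static_rput => //; apply: static_iput.
  have x2 : rmem s2 5 0 = b`_mid by rewrite /= (st_b st').
  apply: (wp_conseq (wp_horner st2 mp erefl x2)) => s3 k3 f3 [k3q v3 d3].
  have p3 : imem s3 12 0 = l /\ imem s3 13 0 = r by rewrite !f3.1.
  have m3 : imem s3 11 0 = mid by rewrite f3.1.
  have prE : beval s3 pred = pr mid.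
    apply: predE => //; last by rewrite f3.2.
    apply: (frame_trans f1); apply: (frame_trans (frame_up _ _ f)) => //.
    apply: (frame_trans _ (frame_up _ _ f3)) => //.
    by apply: frame_rput => //; apply: frame_iput.
  apply: wp_if => hb; rewrite prE in hb; apply: wp_iset => /=.
    split; first by lia.
    move=> _; exists j.-1; first by lia.
    exists mid, r; rewrite /= m3 p3.2; split; first by split=> //; rewrite mr.
    by rewrite /mid; lia.
  split; first by lia.
  move=> _; exists j.-1; first by lia.
  exists l, mid; rewrite /= m3 p3.1; split; first by split=> //; rewrite lm ltnW.
  by rewrite /mid; lia.
- move=> j s' k f [l [r [[sl sr /andP[lr rp] prl prr] rl]]]; rewrite /= sl sr => l2r jL kk.
  apply: wp_iset => /=; split; last first.
    exists l; rewrite sl; split=> //; first by lia.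
    by have -> : (l.+1 = r)%N by lia.
  have := leq_pmull (q.+1) (ltn0Sn L).
  move: kk; rewrite /= ![(L.+1 * _)%N]mulnC; nia.
Qed.

Lemma wp_locate L x s : static s -> (size P <= 2 ^ L)%N -> rmem s 8 0 = x -> 0 <= x ->
  wp locate s (fun s' k => [/\ (k <= L.+2 * (600 * q.+1))%N, rmem s' 9 0 = D x
    & is_rd b P x (rmem s' 10 0)]).
Proof.
move=> st pL sx x0; apply: wp_seq.
have := @wp_bisect (BRLe (rv 5) (rv 8)) (fun i => b`_i <= x) L s st pL.
rewrite (b0 pwD) x0 => /(_ _ isT) H; apply: wp_conseq.
  by apply: H => i s' ip f xb _ _ /=; rewrite xb f.2 // sx.
move=> s1 k1 f1 [k1L [i [s1i ip bx xb]]].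
have st1 : static s1 by apply: static_frame f1 st.
have ipx : at_piece b P i x by split=> // /xb; rewrite -ltNge.
have x1 : rmem s1 8 0 = x by rewrite f1.2.
apply/wp_seq/wp_rset => /=; rewrite x1; apply: wp_seq; set s2 := rput _ 5 _ _.
have st2 : static s2 by apply: static_rput.
apply: (wp_conseq (wp_horner st2 ip s1i (erefl : rmem s2 5 0 = x))) => s3 k3 f3 [k3q v3 d3].
apply/wp_seq/wp_rset/wp_rset => /=; rewrite v3 d3; split.
- move: k1L => /=; rewrite !mulnDr; have := leq_pmull (q.+1) (ltn0Sn L); nia.
- by rewrite (D_at_piece pwD ipx).
- by exists i.
Qed.

Definition stores_bounds (s : state) (lo up : 'I_m.+1 -> R) :=
  forall e : 'I_m.+1, rmem s 3 e = lo e /\ rmem s 4 e = up e.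

Lemma wp_bounds x y s : static s -> rmem s 8 0 = x -> rmem s 9 0 = y ->
  wp bounds s (fun s' k => (k <= m.+2 * 60)%N /\
    stores_bounds s' (xlo I x) (xup I y)).
Proof.
move=> st sx sy.
pose Inv j (s' : state) := forall e : 'I_m.+1, (e < j)%N ->
  rmem s' 3 e = xlo I x e /\ rmem s' 4 e = xup I y e.
apply: (wp_for m.+1 30 Inv) => //.
- by move=> s' f /=; rewrite f.1 // (st_m st) addn1.
- move=> j s' jm f sj Ij; pose e := Ordinal jm.
  have st' : static s' by apply: static_frame f st.
  have hom : imem s' 3 j = xhom I e by rewrite -(st_hom st').
  have cap : rmem s' 0 j = xcap I e by rewrite -(st_cap st').
  have x' : rmem s' 8 0 = x by rewrite f.2.
  have y' : rmem s' 9 0 = y by rewrite f.2.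
  have key (s2 : state) : rmem s2 3 j = xlo I x e -> rmem s2 4 j = xup I y e ->
      (forall i, i != j -> rmem s2 3 i = rmem s' 3 i /\ rmem s2 4 i = rmem s' 4 i) ->
      Inv j.+1 (iput s2 14 0 j.+1).
    move=> h3 h4 h e' /=; rewrite ltnS leq_eqVlt => /orP[/eqP E|lt].
      by have -> : e' = e by [apply: val_inj]; rewrite /= h3 h4.
    by have [-> ->] := h e' (negbT (ltn_eqF lt)); apply: Ij.
  rewrite /xlo /xup in key.
  apply: wp_if; rewrite /= sj hom lt0b => hh.
    apply/wp_seq/wp_rset; apply: wp_if; rewrite /= sj cap y' => hc;
      apply: wp_rset; split; rewrite //= => _; apply: key; rewrite /= ?sj ?x' ?y' ?cap ?eqxx ?hh //=.
    - by rewrite hc.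
    - by move=> i /negbTE ->.
    - by rewrite (negbTE hc).
    - by move=> i /negbTE ->.
  apply/wp_seq/wp_rset/wp_rset => /=; split; rewrite //= => _; apply: key; rewrite /= ?sj ?cap ?eqxx ?(negbTE hh) //=.
  by move=> i /negbTE ->.
- move=> s' k f Im kk; split; last by move=> e; apply: Im; apply: ltn_ord.
  by move: kk => /=; lia.
Qed.

Lemma wp_build_excess lo s : static s -> (forall e : 'I_m.+1, rmem s 3 e = lo e) ->
  wp build_excess s (fun s' k => (k <= (n + m + 4) * 80)%N /\
    forall v : 'I_n, rmem s' 11 v = excess (xtl I) (xhd I) lo v).
Proof.
move=> st slo; apply: wp_seq.
pose Inv1 j (s' : state) := forall v : 'I_n, (v < j)%N -> rmem s' 11 v = 0.
apply: (wp_for n 10 Inv1) => //.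
- by move=> s' f; rewrite /= f.1 // (st_n st).
- move=> j s' jn f sj Ij; apply: wp_rset => /=; split=> // _ v /=.
  rewrite ltnS leq_eqVlt sj => /orP[->//|lt].
  by rewrite (ltn_eqF lt) Ij.
move=> s1 k1 f1 I1 kk1.
have st1 : static s1 by apply: static_frame f1 st.
pose F v (e : 'I_m.+1) : R := lo e * ((xhd I e == v)%:R - (xtl I e == v)%:R).
pose Inv2 j (s' : state) := forall v : 'I_n, rmem s' 11 v = psum (F v) j.
apply: (wp_for m.+1 40 Inv2) => //.
- by move=> s' f; rewrite /= f.1 // (st_m st1) addn1.
- by move=> v; rewrite psum0 /= I1.
- move=> j s' jm f sj Ij; pose e := Ordinal jm.
  have st' : static s' by apply: static_frame f st1.
  have tlE : imem s' 1 j = xtl I e by rewrite -(st_tl st').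
  have hdE : imem s' 2 j = xhd I e by rewrite -(st_hd st').
  have loE : rmem s' 3 j = lo e by rewrite f.2 // f1.2 // -slo.
  apply/wp_seq/wp_rset/wp_rset => /=; rewrite sj tlE hdE loE; split=> // _ v /=.
  have E (u w : 'I_n) : ((u : nat) == w) = (u == w) by exact: (inj_eq val_inj).
  rewrite (psumS _ jm) -/e !E {2}/F !(eq_sym _ v) -Ij.
  have [<-|tv] := v =P xtl I e; have [<-|hv] := v =P xhd I e; rewrite ?eqxx ?Ij /=; lra.
- move=> s2 k2 f2 I2 kk2; split; last by move=> v; rewrite I2 psum_all.
  by move: kk1 kk2 => /=; lia.
Qed.

Section Auxiliary.
Variables (lo up : 'I_m.+1 -> R) (a c : 'I_n).
Local Notation ex := (excess (xtl I) (xhd I) lo).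

Definition aux_edge (e : 'I_(m + n)) (s : state) :=
  [/\ imem s 18 e = aux_tail (xtl I) (xhd I) lo a e,
      imem s 19 e = aux_head (xtl I) (xhd I) lo a c e &
      rmem s 12 e = aux_cap (xtl I) (xhd I) lo up a e].

Lemma wp_build_edges s : static s ->
  stores_bounds s lo up ->
  wp build_edges s (fun s' k => (k <= (m + 1) * 60)%N /\
    forall e : 'I_(m + n), (e < m)%N -> aux_edge e s').
Proof.
move=> st slu.
pose Inv j (s' : state) := forall e : 'I_(m + n), (e < m)%N -> (e < j)%N -> aux_edge e s'.
apply: (wp_for m 30 Inv) => //.
- by move=> s' f; rewrite /= f.1 // (st_m st).
- move=> j s' jm f sj Ij; pose e := widen_ord (leqnSn m) (Ordinal jm).
  have st' : static s' by apply: static_frame f st.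
  have tlE : imem s' 1 j = xtl I e by rewrite -(st_tl st').
  have hdE : imem s' 2 j = xhd I e by rewrite -(st_hd st').
  have [loE upE] : rmem s' 3 j = lo e /\ rmem s' 4 j = up e by rewrite !f.2 //; exact: (slu e).
  apply/wp_seq/wp_iset/wp_seq/wp_iset/wp_rset => /=; rewrite sj tlE hdE loE upE; split=> // _ e' e'm.
  rewrite ltnS leq_eqVlt => /orP[/eqP E|lt]; last first.
    by have [h1 h2 h3] := Ij e' e'm lt; rewrite /aux_edge /= (ltn_eqF lt).
  have -> : e' = lshift n (Ordinal jm) by apply: val_inj.
  by rewrite /aux_edge /aux_tail /aux_head /aux_cap (unsplitK (inl (Ordinal jm))) /= eqxx.
- move=> s' k f Im kk; split; last by move=> e em; apply: Im.
  by move: kk => /=; lia.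
Qed.

Lemma wp_build_extra s : static s -> imem s 16 0 = a -> imem s 17 0 = c ->
  stores_bounds s lo up ->
  (forall v : 'I_n, rmem s 11 v = ex v) ->
  (forall e : 'I_(m + n), (e < m)%N -> aux_edge e s) ->
  wp build_extra s (fun s' k => [/\ (k <= (n + 2) * 120)%N,
    forall e : 'I_(m + n), aux_edge e s' &
    rmem s' 14 0 = deficit (xtl I) (xhd I) lo a]).
Proof.
move=> st sa sc slu sex sed; apply/wp_seq/wp_rset => /=; set s1 := rput _ _ _ _.
have st1 : static s1 by apply: static_rput.
pose F v := if v == a then 0 else if 0 <= ex v then 0 else - ex v.
pose Inv j (s' : state) := (forall e : 'I_(m + n), (e < m + j)%N -> aux_edge e s') /\
  rmem s' 14 0 = psum F j.
apply: (wp_for n 80 Inv) => //.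
- by move=> s' f; rewrite /= f.1 // (st_n st1).
- split; last by rewrite psum0.
  by move=> e; rewrite addn0 => /sed.
- move=> j s' jn f sj [Ij Id]; pose v := Ordinal jn.
  have st' : static s' by apply: static_frame f st1.
  have sm := st_m st'.
  have tlE : imem s' 1 m = xtl I ord_max by rewrite -(st_tl st').
  have hdE : imem s' 2 m = xhd I ord_max by rewrite -(st_hd st').
  have [loE upE] : rmem s' 3 m = lo ord_max /\ rmem s' 4 m = up ord_max.
    by rewrite !f.2 //; exact: (slu ord_max).
  have exE : rmem s' 11 j = ex v by rewrite f.2 // -sex.
  have aE : imem s' 16 0 = a by rewrite f.1.
  have cE : imem s' 17 0 = c by rewrite f.1.
  have key (s2 : state) : aux_edge (rshift m v) s2 ->
      (forall i, i != (m + j)%N -> [/\ imem s2 18 i = imem s' 18 i,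
         imem s2 19 i = imem s' 19 i & rmem s2 12 i = rmem s' 12 i]) ->
      rmem s2 14 0 = rmem s' 14 0 + F v -> Inv j.+1 (iput s2 14 0 j.+1).
    move=> h1 h2 h3; split; last by rewrite /= h3 Id (psumS _ jn).
    move=> e; rewrite addnS ltnS leq_eqVlt => /orP[/eqP E|lt].
      by have -> : e = rshift m v by apply: val_inj.
    have [g1 g2 g3] := h2 e (negbT (ltn_eqF lt)); have [h4 h5 h6] := Ij e lt.
    by rewrite /aux_edge /= g1 g2 g3.
  move: key; rewrite /aux_edge /aux_tail /aux_head /aux_cap (unsplitK (inr v)) /F => key.
  apply: wp_if; rewrite /= sj aE -eqn_leq => ja.
    have va : v == a by rewrite -(inj_eq val_inj).
    rewrite va in key.
    apply/wp_seq/wp_iset/wp_seq/wp_iset/wp_rset => /=; rewrite sm sj tlE hdE loE upE.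
    split=> // _; apply: key; rewrite /= ?eqxx ?addr0 //.
    by move=> i /negbTE ->.
  have va : v != a by rewrite -(inj_eq val_inj).
  rewrite (negbTE va) in key.
  apply: wp_if; rewrite /= sj exE => he.
    rewrite he in key.
    apply/wp_seq/wp_iset/wp_seq/wp_iset/wp_rset => /=; rewrite sm sj aE exE.
    split=> // _; apply: key; rewrite /= ?eqxx ?addr0 //.
    by move=> i /negbTE ->.
  rewrite (negbTE he) in key.
  apply/wp_seq/wp_iset/wp_seq/wp_iset/wp_seq/wp_rset/wp_rset => /=; rewrite sm sj cE exE sub0r.
  split=> // _; apply: key; rewrite /= ?eqxx ?addr0 //.
  by move=> i /negbTE ->.
- move=> s2 k2 f2 [I2 I3] kk2; split.
  + by move: kk2 => /=; lia.
  + by move=> e; apply: I2; apply: ltn_ord.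
  + rewrite I3 psum_all /deficit (bigD1 a) //= {1}/F eqxx add0r.
    by apply: eq_bigr => v /negbTE va; rewrite /F va.
Qed.

Lemma wp_build s : static s -> imem s 16 0 = a -> imem s 17 0 = c ->
  stores_bounds s lo up ->
  wp build s (fun s' k => [/\ (k <= (n + m + 4) * 260)%N,
    forall e : 'I_(m + n), aux_edge e s' &
    rmem s' 14 0 = deficit (xtl I) (xhd I) lo a]).
Proof.
move=> st sa sc slu; apply: wp_seq.
apply: (wp_conseq (wp_build_excess st (fun e => (slu e).1))) => s1 k1 f1 [kk1 ex1].
have st1 : static s1 by apply: static_frame f1 st.
have slu1 : stores_bounds s1 lo up by move=> e; rewrite !f1.2.
apply: wp_seq; apply: (wp_conseq (wp_build_edges st1 slu1)) => s2 k2 f2 [kk2 ed2].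
have st2 : static s2 by apply: static_frame f2 st1.
have slu2 : stores_bounds s2 lo up by move=> e; rewrite !f2.2.
have ex2 (v : 'I_n) : rmem s2 11 v = ex v by rewrite f2.2.
have a2 : imem s2 16 0 = a by rewrite f2.1 // f1.1.
have c2 : imem s2 17 0 = c by rewrite f2.1 // f1.1.
apply: (wp_conseq (wp_build_extra st2 a2 c2 slu2 ex2 ed2)) => s3 k3 f3 [kk3 ed3 def3].
by split=> //; lia.
Qed.

End Auxiliary.

Lemma wp_maxflow en em es et tl hd u out s (n' m' : nat) (N : network R n' m')
    (Q : state -> nat -> Prop) :
  ieval s en = n' -> ieval s em = m' -> ieval s es = src N -> ieval s et = snk N ->
  stores_network s tl hd u N ->
  (forall s', frame [::] [:: out] s s' -> (forall e : 'I_m', rmem s' out e = mf N e) ->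
     Q s' (1 + icost en + icost em + icost es + icost et + T n' m')%N) ->
  wp (MaxFlow en em es et tl hd u out) s Q.
Proof.
move=> hn hm hs ht hN H; eexists; eexists; split.
  exact: ExecMaxFlow hn hm hs ht hN.
apply: H => [|e].
  by split=> // a j; rewrite inE /= => /negbTE ->.
rewrite /= eqxx size_codom card_ord ltn_ord /=.
rewrite /codom /image_mem (nth_map e) ?nth_ord_enum //.
by rewrite size_enum_ord.
Qed.

Hypothesis mfP : flow_oracle_correct mf.

Section Probe.
Variables (lo up : 'I_m.+1 -> R) (a c : 'I_n).
Hypothesis lu : forall e, lo e <= up e.
Hypothesis ac : a != c.
Local Notation N := (aux_net (xtl I) (xhd I) lu ac).

(** By [aux_min_cut], cell 15 holds the smallest signed capacity of a cut that separates [a] from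
    [c]. *)
Lemma wp_probe s : static s -> imem s 16 0 = a -> imem s 17 0 = c ->
  stores_bounds s lo up ->
  wp probe s (fun s' k => [/\ (k <= (n + m + 4) * 500 + T n (n + m))%N,
    forall e : 'I_(m + n), aux_edge lo up a c e s',
    forall e : 'I_(m + n), rmem s' 13 e = mf N e &
    rmem s' 15 0 = flow_value N (mf N) - deficit (xtl I) (xhd I) lo a]).
Proof.
move=> st sa sc slu; apply: wp_seq.
apply: (wp_conseq (wp_build st sa sc slu)) => s1 k1 f1 [kk1 ed1 def1].
have st1 : static s1 by apply: static_frame f1 st.
have a1 : imem s1 16 0 = a by rewrite f1.1.
have c1 : imem s1 17 0 = c by rewrite f1.1.
apply: wp_seq; apply: (@wp_maxflow _ _ _ _ _ _ _ _ _ _ _ N) => //=.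
- exact: st_n.
- by rewrite (st_n st1) (st_m st1).
- by move=> e; have [h1 h2 h3] := ed1 e; rewrite !ffunE.
move=> s2 f2 fl2; apply/wp_seq/wp_rset => /=; set s3 := rput _ _ _ _.
have st3 : static s3 by apply: static_rput => //; apply: static_frame f2 st1.
pose F (e : 'I_(m + n)) : R := mf N e * ((tail N e == a)%:R - (head N e == a)%:R).
pose Inv j (s' : state) := rmem s' 15 0 = psum F j - deficit (xtl I) (xhd I) lo a.
apply: (wp_for (m + n) 60 Inv) => //.
- by move=> s' f; rewrite /= !f.1 // (st_n st3) (st_m st3).
- by rewrite /Inv psum0 /= f2.2 // def1 !sub0r.
- move=> j s' je f sj Ij; pose e := Ordinal je.
  have [h1 h2 h3] := ed1 e.
  have tlE : imem s' 18 j = tail N e by rewrite f.1 //= f2.1 // ffunE -h1.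
  have hdE : imem s' 19 j = head N e by rewrite f.1 //= f2.1 // ffunE -h2.
  have flE : rmem s' 13 j = mf N e by rewrite f.2 // -(fl2 e).
  have aE : imem s' 16 0 = a by rewrite f.1 //= f2.1.
  have E (u w : 'I_n) : ((u : nat) == w) = (u == w) by exact: (inj_eq val_inj).
  rewrite /Inv (psumS _ je) -/e {2}/F.
  apply/wp_seq/wp_if; rewrite /= sj tlE aE -eqn_leq E => ta.
    apply/wp_rset/wp_if; rewrite /= sj hdE aE -eqn_leq E => ha.
      by apply: wp_rset => /=; split=> // _; rewrite /= ?sj ?flE Ij ta ha /=; lra.
    by apply: wp_skip; split=> // _; rewrite /= ?sj ?flE Ij ta (negbTE ha) /=; lra.
  apply/wp_skip/wp_if; rewrite /= sj hdE aE -eqn_leq E => ha.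
    by apply: wp_rset => /=; split=> // _; rewrite /= ?sj ?flE Ij (negbTE ta) ha /=; lra.
  by apply: wp_skip; split=> // _; rewrite Ij (negbTE ta) (negbTE ha) /=; lra.
- move=> s4 k4 f4 I4 kk4; split.
  + by move: kk4; rewrite /= [(m + n)%N]addnC; lia.
  + move=> e; have [h1 h2 h3] := ed1 e.
    by split; rewrite ?f4.1 ?f4.2 //= ?f2.1 ?f2.2.
  + by move=> e; rewrite f4.2 // -fl2.
  + by rewrite I4 psum_all /flow_value net_outE.
Qed.

End Probe.

Section Reach.
Variables (lo up : 'I_m.+1 -> R) (a c : 'I_n).
Hypothesis lu : forall e, lo e <= up e.
Hypothesis ac : a != c.
Local Notation N := (aux_net (xtl I) (xhd I) lu ac).

Definition marked (s : state) : {set 'I_n} := [set v : 'I_n | (0 < imem s 20 v)%N].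

Lemma mem_marked s (v : 'I_n) : (0 < imem s 20 v)%N = (v \in marked s).
Proof. by rewrite inE. Qed.

(** Two sets, because marks are added during a sweep: closure is claimed from the marks at its start
    to those at its end. *)
Definition residual (e : 'I_(m + n)) (S S' : {set 'I_n}) :=
  (tail N e \in S -> mf N e < cap N e -> head N e \in S') /\
  (head N e \in S -> 0 < mf N e -> tail N e \in S').

Lemma wp_reach_sweep s : static s ->
  (forall e : 'I_(m + n), aux_edge lo up a c e s) ->
  (forall e : 'I_(m + n), rmem s 13 e = mf N e) ->
  (forall v, v \in marked s -> pushable N (mf N) v) ->
  forall Q : state -> nat -> Prop,
  (forall s' k, frame [:: 14; 20]%N [::] s s' -> (k <= (m + n).+1 * 90)%N ->
     marked s \subset marked s' -> (forall v, v \in marked s' -> pushable N (mf N) v) ->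
     (forall e, residual e (marked s) (marked s')) ->
     ((forall e, residual e (marked s) (marked s)) -> marked s' = marked s) ->
     Q s' k) ->
  wp reach_sweep s Q.
Proof.
move=> st sed sfl spu Q post.
pose closed := forall e, residual e (marked s) (marked s).
pose Inv j (s' : state) := [/\ marked s \subset marked s',
  forall v, v \in marked s' -> pushable N (mf N) v,
  forall e : 'I_(m + n), (e < j)%N -> residual e (marked s) (marked s') &
  closed -> marked s' \subset marked s].
apply: (wp_for (m + n) 60 Inv) => //.
- by move=> s' f; rewrite /= !f.1 // (st_n st) (st_m st).
- move=> j s' je f sj [I1 I2 I3 I4]; pose e := Ordinal je.
  have [h1 h2 h3] := sed e.
  have tlE : imem s' 18 j = tail N e by rewrite f.1 // ffunE -h1.
  have hdE : imem s' 19 j = head N e by rewrite f.1 // ffunE -h2.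
  have cpE : rmem s' 12 j = cap N e by rewrite f.2 // ffunE -h3.
  have flE : rmem s' 13 j = mf N e by rewrite f.2 // -(sfl e).
  have mk0 s2 i v : marked (iput s2 14 i v) = marked s2 by apply/setP => u; rewrite !inE.
  have mk1 s2 (v : 'I_n) : marked (iput s2 20 v 1) = v |: marked s2.
    apply/setP => u; rewrite !inE /= (inj_eq val_inj).
    by case: eqP.
  have main S : S = (if (tail N e \in marked s') && (mf N e < cap N e)
                     then head N e |: marked s' else marked s') ->
      let S' := if (head N e \in S) && (0 < mf N e) then tail N e |: S else S in
      [/\ marked s \subset S', forall v, v \in S' -> pushable N (mf N) v,
        forall e' : 'I_(m + n), (e' < j.+1)%N -> residual e' (marked s) S' &
        closed -> S' \subset marked s].
    move=> SE S'.
    have s'S : marked s' \subset S by rewrite SE; case: ifP => // _; apply: subsetUr.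
    have SS' : S \subset S' by rewrite /S'; case: ifP => // _; apply: subsetUr.
    have sS' := subset_trans s'S SS'.
    split; first exact: subset_trans I1 sS'.
      have pS v : v \in S -> pushable N (mf N) v.
        rewrite SE; case: ifP => [/andP[tS fc]|_]; last exact: I2.
        by move=> /setU1P[->|]; [apply: pushable_fwd fc; apply: I2|apply: I2].
      move=> v; rewrite /S'; case: ifP => [/andP[hS f0]|_]; last exact: pS.
      by move=> /setU1P[->|]; [apply: pushable_bwd f0; apply: pS|apply: pS].
      move=> e'; rewrite ltnS leq_eqVlt => /orP[/eqP E|lt]; last first.
        have [r1 r2] := I3 e' lt; split=> u1 u2; apply: (subsetP sS'); [exact: r1|exact: r2].
      have -> : e' = e by apply: val_inj.
      split=> u1 u2.
        by apply: (subsetP SS'); rewrite SE (subsetP I1 _ u1) u2 setU11.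
      by rewrite /S' (subsetP s'S) ?(subsetP I1) // u2 setU11.
    move=> cl; have [c1 c2] := cl e; have s's := I4 cl.
    have Ss : S \subset marked s.
      rewrite SE; case: ifP => [/andP[/(subsetP s's) u1 u2]|_] //.
      by apply/subsetP => v /setU1P[->|/(subsetP s's) //]; apply: c1.
    rewrite /S'; case: ifP => [/andP[/(subsetP Ss) u1 u2]|_] //.
    by apply/subsetP => v /setU1P[->|/(subsetP Ss) //]; apply: c2.
  apply: wp_seq.
  pose S1 := if (tail N e \in marked s') && (mf N e < cap N e)
             then head N e |: marked s' else marked s'.
  apply: (wp_conseq (Q := fun s2 k => (k <= 25)%N /\ marked s2 = S1)).
    apply: wp_if; rewrite /= sj tlE cpE flE mem_marked -ltNge => c1.
      by apply: wp_iset => /=; rewrite sj hdE mk1 /S1 c1.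
    by apply: wp_skip; rewrite /S1 (negbTE c1).
  move=> s2 k2 f2 [kk2 m2].
  apply: (wp_conseq (Q := fun s3 k => (k <= 25)%N /\ marked s3 =
    if (head N e \in S1) && (0 < mf N e) then tail N e |: S1 else S1)).
    have sj2 : imem s2 14 0 = j by rewrite f2.1.
    have tl2 : imem s2 18 j = tail N e by rewrite f2.1.
    have hd2 : imem s2 19 j = head N e by rewrite f2.1.
    have fl2 : rmem s2 13 j = mf N e by rewrite f2.2.
    apply: wp_if; rewrite /= sj2 hd2 fl2 mem_marked m2 -ltNge => c1.
      by apply: wp_iset => /=; rewrite sj2 tl2 mk1 m2 c1.
    by apply: wp_skip; rewrite m2 (negbTE c1).
  move=> s3 k3 f3 [kk3 m3]; split; first by lia.
  by move=> _; rewrite /Inv mk0 m3; apply: main.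
- move=> s' k f [I1 I2 I3 I4] kk; apply: post => //.
  + exact: frame_up f.
  + by move: kk => /=; lia.
  + by move=> e; apply: I3.
  + by move=> cl; apply/eqP; rewrite eqEsubset I4.
Qed.

Lemma wp_reach s : static s -> imem s 16 0 = a ->
  (forall e : 'I_(m + n), aux_edge lo up a c e s) ->
  (forall e : 'I_(m + n), rmem s 13 e = mf N e) ->
  wp reach s (fun s' k => [/\ (k <= (n + 2) * ((m + n).+1 * 90 + 80))%N,
    a \in marked s', c \notin marked s' & saturated N (mf N) (marked s')]).
Proof.
move=> st sa sed sfl; apply: wp_seq.
pose Inv1 j (s' : state) := forall v : 'I_n, (v < j)%N -> imem s' 20 v = 0%N.
apply: (wp_for n 10 Inv1) => //.
- by move=> s' f; rewrite /= f.1 // (st_n st).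
- move=> j s' jn f sj Ij; apply: wp_iset => /=; split=> // _ v /=.
  rewrite ltnS leq_eqVlt sj => /orP[->//|lt].
  by rewrite (ltn_eqF lt) Ij.
move=> s1 k1 f1 I1 kk1; apply/wp_seq/wp_iset => /=.
have -> : imem s1 16 0 = a by rewrite f1.1.
set s2 := iput _ _ _ _.
have f2 : frame [:: 14; 20]%N [::] s s2 by apply: frame_iput.
have m2 : marked s2 = [set a].
  apply/setP => v; rewrite !inE /= (inj_eq val_inj).
  by case: eqP => //= _; rewrite I1.
(* as long as the set is not closed, each sweep adds a node *)
pose Inv j (s' : state) := [/\ a \in marked s',
  forall v, v \in marked s' -> pushable N (mf N) v &
  (forall e, residual e (marked s') (marked s')) \/ (j < #|marked s'|)%N].
apply: (wp_for n ((m + n).+1 * 90) Inv) => //.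
- by move=> s' f; rewrite /= f.1 // f2.1 // (st_n st).
- split; first by rewrite inE /= eqxx.
    move=> v; have -> : marked (iput s2 23 0 0) = marked s2 by apply/setP => u; rewrite !inE.
    by rewrite m2 => /set1P ->; apply: pushable_src.
  right; have -> : marked (iput s2 23 0 0) = marked s2 by apply/setP => u; rewrite !inE.
  by rewrite m2 cards1.
- move=> j s' jn f sj [Ia Ip Ic].
  have f' : frame [:: 14; 20; 23]%N [::] s s'.
    by apply: (frame_trans (frame_up _ _ f2)) => //; apply: frame_up f.
  have st' : static s' by apply: static_frame f' st.
  have ed' (e : 'I_(m + n)) : aux_edge lo up a c e s'.
    by have [h1 h2 h3] := sed e; split; rewrite ?f'.1 ?f'.2.
  have fl' (e : 'I_(m + n)) : rmem s' 13 e = mf N e by rewrite f'.2.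
  apply: (wp_reach_sweep st' ed' fl' Ip) => s3 k3 f3 kk3 sub3 p3 r3 cl3; split=> // _.
  have mE : marked (iput s3 23 0 j.+1) = marked s3 by apply/setP => u; rewrite !inE.
  rewrite /Inv mE; split=> //; first exact: (subsetP sub3).
  case: (eqVneq (marked s') (marked s3)) => [E|ne]; first by left; rewrite -{1}E.
  have pr : marked s' \proper marked s3 by rewrite properEneq ne.
  have lt := proper_card pr.
  case: Ic => [/cl3 E|jm]; first by rewrite E eqxx in ne.
  by right; apply: leq_ltn_trans lt.
- move=> s4 k4 f4 [Ia Ip [cl|big]] kk4; last first.
    by have := max_card (mem (marked s4)); rewrite card_ord leqNgt big.
  have cm : c \notin marked s4.
    by apply/negP => /Ip; apply: max_flow_not_pushable; apply: mfP.
  split=> //; move: kk1 kk4 => /=; nia.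
Qed.

End Reach.

Lemma wp_compute_form y (S : {set 'I_n}) s : static s -> rmem s 9 0 = y ->
  marked s = S -> let w := cut_form I S (fun e => ~~ (xcap I e <= y)) in
  wp compute_form s (fun s' k => [/\ (k <= (m + 2) * 120)%N, rmem s' 17 0 = w.1.1,
    rmem s' 18 0 = w.1.2%:R & rmem s' 19 0 = w.2%:R]).
Proof.
move=> st sy sS w; apply/wp_seq/wp_rset/wp_seq/wp_rset/wp_seq/wp_rset => /=.
set s1 := rput _ 19 _ _.
have st1 : static s1 by do 3 apply: static_rput => //.
pose FA e := if leaves I S e && ~~ (xhom I e && ~~ (xcap I e <= y)) then xcap I e else 0.
pose Fc e : R := (leaves I S e && (xhom I e && ~~ (xcap I e <= y)))%:R.
pose Fk e : R := (enters I S e && xhom I e)%:R.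
pose Inv j (s' : state) := [/\ rmem s' 17 0 = psum FA j, rmem s' 18 0 = psum Fc j
  & rmem s' 19 0 = psum Fk j].
apply: (wp_for m.+1 80 Inv) => //.
- by move=> s' f; rewrite /= f.1 // (st_m st) addn1.
- by rewrite /Inv !psum0.
- move=> j s' jm f sj [IA Ic Ik]; pose e := Ordinal jm.
  have st' : static s' by apply: static_frame f st1.
  have tlE : imem s' 1 j = xtl I e by rewrite -(st_tl st').
  have hdE : imem s' 2 j = xhd I e by rewrite -(st_hd st').
  have homE : imem s' 3 j = xhom I e by rewrite -(st_hom st').
  have capE : rmem s' 0 j = xcap I e by rewrite -(st_cap st').
  have yE : rmem s' 9 0 = y by rewrite f.2.
  have mS : marked s' = S by rewrite -sS; apply/setP => v; rewrite !inE f.1.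
  rewrite /Inv !(psumS _ jm) -/e {2}/FA {2}/Fc {2}/Fk /leaves /enters.
  apply: wp_seq.
  apply: (wp_conseq (Q := fun s2 k => [/\ (k <= 40)%N,
      rmem s2 17 0 = psum FA j + FA e & rmem s2 18 0 = psum Fc j + Fc e])).
    rewrite {2}/FA {2}/Fc /leaves.
    apply: wp_if; rewrite /= sj tlE hdE !mem_marked mS => lv.
      rewrite lv /=.
      apply: wp_if; rewrite /= sj homE capE yE lt0b => hh; apply: wp_rset => /=.
        by rewrite ?sj ?capE IA Ic hh /=; split=> //; lra.
      by rewrite ?sj ?capE IA Ic (negbTE hh) /=; split=> //; lra.
    rewrite (negbTE lv) /=.
    by apply: wp_skip; rewrite IA Ic !addr0.
  move=> s2 k2 f2 [kk2 A2 c2].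
  have m2 : marked s2 = S by rewrite -mS; apply/setP => v; rewrite !inE f2.1.
  apply: wp_if; rewrite /= ![imem s2 _ _]f2.1 // sj tlE hdE homE lt0b -mS !mem_marked mS => en.
    rewrite en; apply: wp_rset => /=; split; first by lia.
    by move=> _ /=; rewrite A2 c2 f2.2 // Ik; split.
  rewrite (negbTE en); apply: wp_skip; split; first by lia.
  by move=> _ /=; rewrite A2 c2 f2.2 // Ik addr0; split.
- move=> s' k f [IA Ic Ik] kk; rewrite IA Ic Ik !psum_all /w /= !natr_sum; split=> //.
  by move: kk => /=; lia.
Qed.

Variable hmax : R.
Hypothesis hmaxP : is_min_on (cap I) (homologous I ord0) hmax.
Local Notation ok := (eval_ok D (is_cut_form I) (is_st_cut_form I)).

Section Scan.
Variable x : R.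
Hypothesis xb : 0 <= x <= hmax.
Hypothesis xD : x <= D x.
Local Notation lo := (xlo I x).
Local Notation up := (xup I (D x)).
Local Notation lcap := (lowcap (xtl I) (xhd I) lo up).
Let lu : forall e, lo e <= up e := xbounds hmaxP xb xD.

(** [cov] collects the cuts examined so far. Either nothing negative has been seen and the pair is
    still source and sink, or the recorded value belongs to a cut separating the pair. *)
Definition best_pair (cov : {set 'I_n} -> Prop) (s : state) :=
  exists a c : 'I_n, [/\ a != c, imem s 21 0 = a /\ imem s 22 0 = c,
    rmem s 16 0 = 0 /\ a = src I /\ c = snk I \/ rmem s 16 0 < 0 /\
      (exists S : {set 'I_n}, [/\ a \in S, c \notin S & lcap S = rmem s 16 0]) &
    forall S, cov S -> rmem s 16 0 <= lcap S].

Lemma best_pair_frame mi mr cov s s' : frame mi mr s s' ->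
  21 \notin mi -> 22 \notin mi -> 16 \notin mr -> best_pair cov s -> best_pair cov s'.
Proof.
by move=> [fi fr] h1 h2 h3; rewrite /best_pair fr // !fi.
Qed.

Lemma wp_probe_update (a c : 'I_n) (cov : {set 'I_n} -> Prop) s : a != c -> static s ->
  imem s 16 0 = a -> imem s 17 0 = c -> stores_bounds s lo up -> best_pair cov s ->
  wp (probe ;; update_best) s (fun s' k => (k <= (n + m + 4) * 510 + T n (n + m))%N /\
    best_pair (fun S => cov S \/ (a \in S /\ c \notin S)) s').
Proof.
move=> ac st sa sc sb bp; apply: wp_seq.
apply: (wp_conseq (wp_probe lu ac st sa sc sb)) => s1 k1 f1 [kk1 _ _ v1].
have [[S0 [aS0 cS0 E0]] mn] := aux_min_cut (mfP (aux_net (xtl I) (xhd I) lu ac)).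
rewrite -v1 in E0 mn.
have bp1 : best_pair cov s1 by apply: best_pair_frame bp; first exact: f1.
have a1 : imem s1 16 0 = a by rewrite f1.1.
have c1 : imem s1 17 0 = c by rewrite f1.1.
case: bp1 => a' [c' [ac' [sa' sc'] alt cv]].
have le0 : rmem s1 16 0 <= 0 by case: alt => [[-> _]//|[/ltW]].
apply: wp_if; rewrite /= -?ltNge -?leNgt => lt; last first.
  apply: wp_skip; split; first by lia.
  exists a', c'; split=> // S [/cv //|[aS cS]].
  exact: le_trans lt (mn S aS cS).
apply/wp_seq/wp_rset/wp_seq/wp_iset/wp_iset => /=; rewrite a1 c1; split; first by lia.
exists a, c; split=> //=.
- by right; split; [exact: lt_le_trans lt le0|exists S0].
- by move=> S [/cv h|[aS cS]]; [exact: le_trans (ltW lt) h|exact: mn].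
Qed.

Lemma wp_scan s : static s -> stores_bounds s lo up ->
  wp scan s (fun s' k =>
    (k <= (n + 2) * ((n + m + 4) * 1200 + 2 * T n (n + m)))%N /\
    best_pair (fun _ => True) s').
Proof.
move=> st sb; apply/wp_seq/wp_rset/wp_seq/wp_iset/wp_seq/wp_iset => /=.
rewrite (st_s st) (st_t st); set s1 := iput _ 22 _ _.
have st1 : static s1 by do 2 apply: static_iput => //; apply: static_rput.
have f1 : frame [:: 21; 22]%N [:: 16]%N s s1.
  by do 2 apply: frame_iput => //; apply: frame_rput.
have sb1 : stores_bounds s1 lo up by move=> e; rewrite !f1.2.
pose cut_by j (S : {set 'I_n}) := exists v : 'I_n, (v < j)%N /\ (src I \in S) != (v \in S).
pose Inv j := best_pair (cut_by j).
apply: (wp_for n ((n + m + 4) * 1100 + 2 * T n (n + m)) Inv) => //.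
- by move=> s' f; rewrite /= f.1 // (st_n st1).
- exists (src I), (snk I); split=> //=; first exact: src_neq_snk.
    by left.
  by move=> S [v []].
- move=> j s' jn f sj Ij; pose v := Ordinal jn.
  have st' : static s' by apply: static_frame f st1.
  have sb' : stores_bounds s' lo up by move=> e; rewrite !f.2.
  have sE : imem s' 0 2 = src I by exact: st_s.
  have inv (c1 : {set 'I_n} -> Prop) s2 : best_pair c1 s2 ->
      (forall S, cut_by j.+1 S -> c1 S) ->
      Inv j.+1 (iput s2 24 0 j.+1).
    move=> [a' [c' [h1 h2 h3 h4]]] cc; exists a', c'; split=> //= S /cc; exact: h4.
  have last_v S : cut_by j.+1 S -> cut_by j S \/ (src I \in S) != (v \in S).
    move=> [u []]; rewrite ltnS leq_eqVlt => /orP[/eqP E|lt] uS; last by left; exists u.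
    by right; have <- : u = v by apply: val_inj.
  apply: wp_if; rewrite /= sj sE -eqn_leq => js.
    have vs : v = src I by apply: val_inj; apply/eqP.
    apply: wp_skip; split; first by lia.
    move=> _; apply: inv Ij _ => S /last_v[//|].
    by rewrite vs eqxx.
  have vs : src I != v by rewrite eq_sym -(inj_eq val_inj).
  apply/wp_seq/wp_seq/wp_iset/wp_seq/wp_iset => /=; rewrite sj sE.
  set s2 := iput _ 17 _ _.
  have st2 : static s2 by do 2 apply: static_iput => //.
  apply: (wp_conseq (wp_probe_update vs st2 erefl erefl _ _)) => //.
    exact: Ij.
  move=> s3 k3 f3 [kk3 bp3].
  have st3 : static s3 by apply: static_frame f3 st2.
  have sj3 : imem s3 24 0 = j by rewrite f3.1.
  apply/wp_seq/wp_iset/wp_seq/wp_iset => /=; rewrite sj3 (st_s st3).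
  set s4 := iput _ 17 _ _.
  have st4 : static s4 by do 2 apply: static_iput => //.
  have sb4 : stores_bounds s4 lo up by move=> e; rewrite /= !f3.2 //; exact: sb'.
  rewrite eq_sym in vs.
  apply: (wp_conseq (wp_probe_update vs st4 erefl erefl sb4 bp3)) => //.
  move=> s5 k5 f5 [kk5 bp5]; split; first by lia.
  move=> _; apply: inv bp5 _ => S /last_v[|]; first by left; left.
  case: (boolP (src I \in S)) => sS; case: (boolP (v \in S)) => vS // _.
    by left; right.
  by right.
- move=> s2 k2 f2 [a [c [ac sac alt cv]]] kk2; split.
    by move: kk2 => /=; nia.
  exists a, c; split=> // S _.
  (* A set that separates the source from no node is empty or full, and no edge crosses it. *)
  case: (pickP (fun v => (src I \in S) != (v \in S))) => [v vS|noS].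
    by apply: cv; exists v; rewrite ltn_ord.
  have -> : lcap S = 0.
    apply: big1 => e _; rewrite /edgecap.
    have E u : (u \in S) = (src I \in S) by have /negbFE/eqP := noS u.
    by rewrite (E (xtl I e)) (E (xhd I e)); case: (src I \in S).
  by case: alt => [[-> _]//|[/ltW]].
Qed.

End Scan.

(** Linear once the products are named: [X] is [n + m + 4], [t] the time of a maximum flow, and [a],
    [b'] are [n + 2] times these. *)
Lemma eval_time_sum (m' X t a b' Q1 Q2 k1 k2 k3 k5 k6 k7 K : nat) :
  (k1 <= Q1 -> Q1 + 20 <= Q2 -> k2 <= m'.+2 * 60 -> k3 <= a * 1200 + 2 * b' ->
   k5 <= X * 500 + t -> k6 <= a * 170 -> k7 <= (m' + 2) * 120 -> 2 * X <= a -> t <= b' ->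
   m' + 4 <= X -> K <= k1 + k2 + k3 + k5 + k6 + k7 + 100 ->
   K <= Q2 + (2000 * a + 3 * b'))%N.
Proof. lia. Qed.

Definition eval_time L : nat :=
  (L.+2 * (700 * q.+1) + (n + 2) * (2000 * (n + m + 4) + 3 * T n (n + m)))%N.

Lemma wp_evaluate L x s : static s -> (size P <= 2 ^ L)%N -> rmem s 8 0 = x ->
  0 <= x <= hmax ->
  wp evaluate s (fun s' k => (k <= eval_time L)%N /\
    exists w, [/\ ok x (imem s' 25 0) w,
      [/\ rmem s' 17 0 = w.1.1, rmem s' 18 0 = w.1.2%:R & rmem s' 19 0 = w.2%:R],
      rmem s' 9 0 = D x & is_rd b P x (rmem s' 10 0)]).
Proof.
move=> st pL sx xb; have /andP[x0 xh] := xb; apply: wp_seq.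
apply: (wp_conseq (wp_locate st pL sx x0)) => s1 k1 f1 [kk1 y1 d1].
have st1 : static s1 by apply: static_frame f1 st.
have x1 : rmem s1 8 0 = x by rewrite f1.2.
have Tk : (L.+2 * (600 * q.+1) + 20 <= L.+2 * (700 * q.+1))%N by nia.
apply: wp_if; rewrite /= x1 y1 => xD; last first.
  apply/wp_seq/wp_rset/wp_seq/wp_rset/wp_seq/wp_rset/wp_iset => /=; split.
    by rewrite /eval_time; lia.
  exists (gap_form R); split=> //=; split=> //.
  by rewrite gap_lt0 ltNge.
apply: wp_seq; apply: (wp_conseq (wp_bounds st1 x1 y1)) => s2 k2 f2 [kk2 b2].
have st2 : static s2 by apply: static_frame f2 st1.
apply: wp_seq; apply: (wp_conseq (wp_scan xb xD st2 b2)) => s3 k3 f3 [kk3 [a [c [ac [sa sc] alt cv]]]].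
have st3 : static s3 by apply: static_frame f3 st2.
apply/wp_seq/wp_iset/wp_seq/wp_iset => /=; rewrite sa sc; set s4 := iput _ 17 _ _.
have st4 : static s4 by do 2 apply: static_iput => //.
have b4 : stores_bounds s4 (xlo I x) (xup I (D x)) by move=> e; rewrite /= !f3.2 //; apply: b2.
pose lu := xbounds hmaxP xb xD.
apply: wp_seq; apply: (wp_conseq (wp_probe lu ac st4 erefl erefl b4)) => s5 k5 f5 [kk5 e5 fl5 v5].
have st5 : static s5 by apply: static_frame f5 st4.
have a5 : imem s5 16 0 = a by rewrite f5.1.
apply: wp_seq; apply: (wp_conseq (wp_reach st5 a5 e5 fl5)) => s6 k6 f6 [kk6 aS cS sat].
have st6 : static s6 by apply: static_frame f6 st5.
have y6 : rmem s6 9 0 = D x by rewrite f6.2 // f5.2 //= f3.2 // f2.2.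
apply: wp_seq; apply: (wp_conseq (wp_compute_form st6 y6 erefl)) => s7 k7 f7 [kk7 A7 c7 k7E].
have mfN := mfP (aux_net (xtl I) (xhd I) lu ac).
have [_ mn] := aux_min_cut mfN.
have SE := aux_saturated mfN aS cS sat; rewrite -SE in mn.
have best7 : rmem s7 16 0 = rmem s3 16 0 by rewrite f7.2 // f6.2 // f5.2.
have D7 : rmem s7 9 0 = D x by rewrite f7.2.
have r7 : is_rd b P x (rmem s7 10 0) by rewrite f7.2 // f6.2 // f5.2 //= f3.2 // f2.2.
have time K : (K <= k1 + k2 + k3 + k5 + k6 + k7 + 100)%N -> (K <= eval_time L)%N.
  rewrite /eval_time; clear - kk1 kk2 kk3 kk5 kk6 kk7 Tk; move=> kK.
  have h6 : (k6 <= (n + 2) * ((n + m + 4) * 170))%N.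
    by apply: leq_trans kk6 _; rewrite leq_mul2l; apply/orP; right; lia.
  rewrite mulnDr [(_ * (2000 * _))%N]mulnCA [(_ * (3 * _))%N]mulnCA.
  rewrite mulnDr mulnA [(_ * (2 * _))%N]mulnCA in kk3; rewrite mulnA in h6.
  apply: (eval_time_sum kk1 Tk kk2 kk3 kk5 h6 kk7 _ _ _ kK).
  - by rewrite leq_mul2r; apply/orP; right; lia.
  - by rewrite leq_pmull //; lia.
  - by lia.
apply: wp_if; rewrite /= best7 => bb.
  apply: wp_iset => /=; split; first (apply: time; clear; lia).
  eexists; split; [|by split; [exact: A7|exact: c7|exact: k7E]| |] => //.
  (* A nonnegative result of the scan is the initial 0, so the last flow was for source and sink. *)
  case: alt => [[b0 [as_ ct]]|[]]; last by rewrite ltNge bb.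
  rewrite as_ in aS mn; rewrite ct in cS mn.
  apply: eval_ok_feasible => //.
  by move=> S'; rewrite -b0; apply: cv.
apply: wp_iset => /=; split; first (apply: time; clear; lia).
eexists; split; [|by split; [exact: A7|exact: c7|exact: k7E]| |] => //.
case: alt => [[b0 _]|[blt [S0 [aS0 cS0 ES0]]]]; first by rewrite b0 lexx in bb.
(* The marked set is a smallest cut for the chosen pair, hence as small as the cut seen by the
   scan. *)
have Sb : lowcap (xtl I) (xhd I) (xlo I x) (xup I (D x)) (marked s6) = rmem s3 16 0.
  by apply/eqP; rewrite eq_le (cv _ Logic.I) andbT -ES0; apply: mn.
apply: eval_ok_infeasible => //; first by rewrite Sb.
by move=> S'; rewrite Sb; apply: cv.
Qed.

End Programs.

(** * Shrinking the bracket: search, critical points and Newton steps *)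

Definition record_best := 31 :=r rv 42 ;; 32 :=r rv 8 ;; 4 :=i INum 1.

Definition shrink_best :=
  42 :=r RSub (RAdd (rv 17) (RMul (rv 18) (rv 9))) (RMul (rv 19) (rv 8)) ;;
  If (BILe (iv 25) (INum 0))
    (If (BILe (iv 4) (INum 0)) record_best
       (If (BRLe (rv 42) (rv 31)) Skip record_best)) Skip.

Definition shrink_bracket :=
  If (BRLe (RMul (rv 18) (rv 10)) (rv 19))
    (29 :=i INum 1 ;; 27 :=i iv 25 ;; 26 :=r rv 8 ;; 27 :=r rv 9 ;;
     28 :=r rv 17 ;; 29 :=r rv 18 ;; 30 :=r rv 19)
    (29 :=i INum 0 ;; 26 :=i iv 25 ;; 20 :=r rv 8 ;; 21 :=r rv 9 ;; 22 :=r rv 10 ;;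
     23 :=r rv 17 ;; 24 :=r rv 18 ;; 25 :=r rv 19).

Definition shrink := evaluate ;; shrink_best ;; shrink_bracket.

Definition search_val :=
  RAdd (RAdd (RAdd (rv 33) (RMul (rv 34) (rv 6))) (RMul (rv 35) (rv 5)))
       (RMul (rv 36) (rv 7)).

Definition search_test (strict : bool) :=
  BOr (BRLe (rv 5) (rv 20))
      (BAnd (BRLt (rv 5) (rv 26))
            (if strict then BRLt search_val RZero else BRLe search_val RZero)).

Definition search_interval :=
  If (BRLe (RGet 1 (iv 11)) (rv 20)) (37 :=r rv 20) (37 :=r RGet 1 (iv 11)) ;;
  38 :=r rv 26 ;;
  If (BAnd (BILe (IAdd (iv 11) (INum 2)) eP)
           (BRLe (RGet 1 (IAdd (iv 11) (INum 1))) (rv 26)))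
    (38 :=r RGet 1 (IAdd (iv 11) (INum 1))) Skip.

Definition search_coefs :=
  44 :=r ROne ;;
  For 10 (IAdd eQ (INum 1)) (
    RSet 40 (iv 10) (RMul (rv 34) (RGet 2 (IAdd (IGet 5 (iv 11)) (iv 10)))) ;;
    If (BILe (IAdd (iv 10) (INum 1)) eQ)
      (RSet 40 (iv 10) (RAdd (RGet 40 (iv 10)) (RMul (RMul (rv 36) (rv 44))
         (RGet 2 (IAdd (IGet 5 (iv 11)) (IAdd (iv 10) (INum 1))))))) Skip ;;
    44 :=r RAdd (rv 44) ROne) ;;
  RSet 40 (INum 0) (RAdd (RGet 40 (INum 0)) (rv 33)) ;;
  RSet 40 (INum 1) (RAdd (RGet 40 (INum 1)) (rv 35)).

Definition search_roots :=
  Roots 40 (IAdd eQ (INum 1)) 41 15 ;;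
  39 :=r rv 38 ;;
  For 10 (iv 15) (
    If (BAnd (BRLe (rv 37) (RGet 41 (iv 10))) (BRLe (RGet 41 (iv 10)) (rv 39)))
       (39 :=r RGet 41 (iv 10)) Skip).

Definition search strict :=
  bisect (search_test strict) ;; search_interval ;; search_coefs ;; search_roots ;;
  8 :=r rv 39.

Definition critical_body :=
  If (BRLt (rv 46) (RMul (rv 45) (rv 22)))
    (33 :=r rv 46 ;; 34 :=r RZero ;; 35 :=r RZero ;; 36 :=r RNeg (rv 45) ;;
     search true ;;
     If (BAnd (BRLt (rv 20) (rv 8)) (BRLt (rv 8) (rv 26))) shrink Skip) Skip ;;
  46 :=r RAdd (rv 46) ROne.

Definition critical :=
  45 :=r RZero ;;
  For 30 (IAdd eM (INum 1)) (
    46 :=r RZero ;; For 31 (IAdd eM (INum 1)) critical_body ;;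
    45 :=r RAdd (rv 45) ROne).

Definition newton_coefs :=
  36 :=r RZero ;;
  If (BILe (INum 1) (iv 26))
    (33 :=r rv 23 ;; 34 :=r rv 24 ;; 35 :=r RNeg (rv 25))
    (If (BILe (INum 1) (iv 27))
       (33 :=r RNeg (rv 28) ;; 34 :=r RNeg (rv 29) ;; 35 :=r rv 30)
       (33 :=r RSub (rv 23) (rv 28) ;; 34 :=r RSub (rv 24) (rv 29) ;;
        35 :=r RSub (rv 30) (rv 25))).

Definition newton_save :=
  32 :=i iv 26 ;; 33 :=i iv 27 ;; 47 :=r rv 23 ;; 48 :=r rv 24 ;; 49 :=r rv 25.

Definition newton_test :=
  If (BILe (INum 1) (iv 32)) (If (BILe (INum 1) (iv 29)) (28 :=i INum 0) Skip)
    (If (BILe (INum 1) (iv 33)) (If (BILe (iv 29) (INum 0)) (28 :=i INum 0) Skip)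
       (If (BRLe (RSub (RAdd (rv 47) (RMul (rv 48) (rv 9))) (RMul (rv 49) (rv 8))) (rv 42))
          (28 :=i INum 0) Skip)).

Definition newton_step :=
  newton_coefs ;;
  If (BRLe (RAdd (RAdd (rv 33) (RMul (rv 34) (rv 27))) (RMul (rv 35) (rv 26))) RZero)
    (28 :=i INum 0)
    (search false ;;
     If (BRLe (rv 8) (rv 20)) (28 :=i INum 0) (newton_save ;; shrink ;; newton_test)).

Definition newton := 28 :=i INum 1 ;; While (BILe (INum 1) (iv 28)) newton_step.

Section Main.
Variables (R : realType) (n m q : nat) (I : aemfp R n m 1) (b : seq R).
Variables (P : seq {poly R}) (T : nat -> nat -> nat).
Variables (mf : flow_oracle R) (rt : {poly R} -> seq R).
Local Notation state := (state R).
Local Notation D := (deviation I ord0).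
Local Notation wp := (@wp R q T mf rt).
Local Notation static := (static q I b P).
Hypothesis pwD : piecewise_poly q b P D.
Hypothesis mfP : flow_oracle_correct mf.
Hypothesis rtP : root_oracle_correct rt.
Hypothesis concD : concave_on_nneg D.
Hypothesis q_gt0 : (0 < q)%N.
Variable hmax : R.
Hypothesis hmaxP : is_min_on (cap I) (homologous I ord0) hmax.
Variable L : nat.
Hypothesis pL : (size P <= 2 ^ L)%N.
Local Notation ok := (eval_ok D (is_cut_form I) (is_st_cut_form I)).
Local Notation att := (attains D hmax (is_cut_form I) (is_st_cut_form I)).
Local Notation outside := (outside_done D hmax (is_cut_form I) (is_st_cut_form I)).
Local Notation rd := (is_rd b P).

Let monoD x y : 0 <= x -> x <= y -> D x <= D y := @deviation_mono _ _ _ _ I ord0 x y.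
Let superD x y g : rd x g -> 0 <= y -> D y <= D x + g * (y - x) :=
  fun h => supergradient pwD concD h.

Definition form_at a1 a2 a3 (w : form R) (s : state) :=
  [/\ rmem s a1 0 = w.1.1, rmem s a2 0 = w.1.2%:R & rmem s a3 0 = w.2%:R].

Definition found (s : state) := (0 < imem s 4 0)%N.

Definition best_ok (s : state) :=
  imem s 4 0 = 0%N \/ imem s 4 0 = 1%N /\ att (rmem s 32 0) (rmem s 31 0).

Definition better (s s' : state) := found s -> found s' /\ rmem s 31 0 <= rmem s' 31 0.

Definition left_end (s : state) lo tau w g :=
  [/\ rmem s 20 0 = lo, rmem s 21 0 = D lo, rmem s 22 0 = g,
      imem s 26 0 = tau & form_at 23 24 25 w s].

Definition right_end (s : state) hi tau w :=
  [/\ rmem s 26 0 = hi, rmem s 27 0 = D hi, imem s 27 0 = tau & form_at 28 29 30 w s].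

Definition evaluated (s : state) x tau w g :=
  [/\ 0 <= x <= hmax, ok x tau w, rd x g & tau = 0%N -> found s /\ fev D w x <= rmem s 31 0].

Lemma evaluated_better s s' x tau w g : better s s' -> evaluated s x tau w g ->
  evaluated s' x tau w g.
Proof.
move=> bt [h1 h2 h3 h4]; split=> // t0; have [f v] := h4 t0.
by have [f' v'] := bt f; split=> //; apply: le_trans v v'.
Qed.

Lemma better_frame mi mr s s' : frame mi mr s s' -> 4 \notin mi -> 31 \notin mr ->
  better s s'.
Proof. by move=> [fi fr] h1 h2; rewrite /better /found fi // fr. Qed.

Definition shrunk (s s' : state) x tau w g :=
  (0 < fslope w g /\ imem s' 29 0 = 0%N /\ left_end s' x tau w g /\
     forall hi t' w', right_end s hi t' w' -> right_end s' hi t' w') \/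
  (fslope w g <= 0 /\ imem s' 29 0 = 1%N /\ right_end s' x tau w /\
     forall lo t' w' g', left_end s lo t' w' g' -> left_end s' lo t' w' g').

Lemma wp_shrink x s : static s -> rmem s 8 0 = x -> 0 <= x <= hmax -> best_ok s ->
  wp shrink s (fun s' k => (k <= eval_time n m q T L + 300)%N /\
    exists tau w g, [/\ best_ok s' /\ better s s', evaluated s' x tau w g,
      shrunk s s' x tau w g & [/\ form_at 17 18 19 w s', rmem s' 9 0 = D x,
        rmem s' 42 0 = fev D w x & imem s' 25 0 = tau]]).
Proof.
move=> st sx xb bs; apply: wp_seq.
apply: (wp_conseq (wp_evaluate T rt pwD mfP hmaxP st pL sx xb)).
move=> s1 k1 f1 [kk1 [w [ok1 [A1 c1 K1] y1 d1]]].
have x1 : rmem s1 8 0 = x by rewrite f1.2.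
have bt1 : better s s1 by apply: better_frame f1 _ _.
have bs1 : best_ok s1 by move: bs; rewrite /best_ok !f1.1 // !f1.2.
set tau := imem s1 25 0 in ok1; set g := rmem s1 10 0 in d1.
apply: wp_seq; apply: wp_seq; apply: wp_rset => /=; rewrite A1 c1 K1 y1 x1.
set s2 := rput s1 42 0 _.
have v2 : rmem s2 42 0 = fev D w x by [].
apply: (wp_conseq (Q := fun s3 k => (k <= 40)%N /\ [/\ best_ok s3, better s2 s3 &
   tau = 0%N -> found s3 /\ fev D w x <= rmem s3 31 0])).
  have fx : tau = 0%N -> att x (fev D w x).
    move=> t0; move: ok1; rewrite t0 => -[xD cg ch mn]; split=> //.
  apply: wp_if; rewrite /= -/tau leqn0 => /eqP t0; last by apply: wp_skip; split=> //; split.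
  have x2 : rmem s2 8 0 = x by [].
  have b2 : best_ok s2 by move: bs1; rewrite /best_ok.
  apply: wp_if; rewrite /= leqn0 => f0.
    apply/wp_seq/wp_rset/wp_seq/wp_rset/wp_iset => /=; rewrite x1; split; first by [].
    split=> //; first by right; split=> //; apply: fx.
    by rewrite /better /found /= lt0n f0.
  have [E|[E at_]] := b2; first by move: f0; rewrite /= in E; rewrite E.
  apply: wp_if; rewrite /= => cmp.
    apply: wp_skip; split=> //; split=> // _; split=> //.
    by rewrite /found /= lt0n.
  apply/wp_seq/wp_rset/wp_seq/wp_rset/wp_iset => /=; rewrite x1; split; first by [].
  split=> //; first by right; split=> //; apply: fx.
  by move=> _; split=> //=; rewrite ltW // ltNge.
move=> s3 k3 f3 [kk3 [b3 bt3 rec3]].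
have bt : better s s3.
  move=> /bt1[g1 h1]; have [g3 h3] : found s3 /\ rmem s2 31 0 <= rmem s3 31 0 by apply: bt3.
  by split=> //; apply: le_trans h1 h3.
have [A3 c3 K3] : form_at 17 18 19 w s3 by split; rewrite f3.2.
have y3 : rmem s3 9 0 = D x by rewrite f3.2.
have g3 : rmem s3 10 0 = g by rewrite f3.2.
have x3 : rmem s3 8 0 = x by rewrite f3.2.
have v3 : rmem s3 42 0 = fev D w x by rewrite f3.2.
have t3 : imem s3 25 0 = tau by rewrite f3.1.
have keepL lo t' w' g' : left_end s lo t' w' g' -> left_end s3 lo t' w' g'.
  by move=> [h1 h2 h3 h4 [h5 h6 h7]]; split; last split;
    rewrite ?f3.1 ?f3.2 //= ?f1.1 ?f1.2.
have keepR hi t' w' : right_end s hi t' w' -> right_end s3 hi t' w'.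
  by move=> [h1 h2 h3 [h5 h6 h7]]; split; last split;
    rewrite ?f3.1 ?f3.2 //= ?f1.1 ?f1.2.
apply: wp_if; rewrite /= c3 g3 K3 => sg;
  do ![apply: wp_seq; (apply: wp_iset || apply: wp_rset)];
  (apply: wp_iset || apply: wp_rset);
  rewrite /= ?c3 ?A3 ?K3 ?y3 ?g3 ?x3 ?t3; (split; first by clear - kk1 kk3; lia);
  exists tau, w, g; (split; [by []|by split|idtac|by split=> //; split]).
  right; split; first by rewrite /fslope subr_le0.
  by split=> //; split=> // lo t' w' g' /keepL[? ? ? ? []].
left; split; first by rewrite /fslope subr_gt0 ltNge.
by split=> //; split=> // hi t' w' /keepR[? ? ? []].
Qed.

(** * Correctness of the search program *)

Section Search.
Variables (lo hi alpha beta gamma delta : R).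
Local Notation spoly := (search_poly P alpha beta gamma delta).
Local Notation spred := (search_pred b P lo hi alpha beta gamma delta).
Hypothesis lo0 : 0 <= lo.
Hypothesis lohi : lo < hi.

Definition search_input (s : state) := [/\ rmem s 20 0 = lo, rmem s 26 0 = hi &
  [/\ rmem s 33 0 = alpha, rmem s 34 0 = beta, rmem s 35 0 = gamma & rmem s 36 0 = delta]].

Lemma search_input_frame mi mr s s' : frame mi mr s s' ->
  all (fun a => a \notin mr) [:: 20; 26; 33; 34; 35; 36]%N ->
  search_input s -> search_input s'.
Proof.
move=> [_ fr] /and5P[h1 h2 h3 h4 /and3P[h5 h6 _]] [g1 g2 [g3 g4 g5 g6]].
by split; last split; rewrite fr.
Qed.

Lemma search_testE strict i s : search_input s -> rmem s 5 0 = b`_i ->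
  rmem s 6 0 = (P`_i).[b`_i] -> rmem s 7 0 = (P`_i)^`().[b`_i] ->
  beval s (search_test strict) = spred strict i.
Proof.
move=> [g1 g2 [g3 g4 g5 g6]] x p d; rewrite /search_pred /search_poly !hornerE.
rewrite /search_test /= g1 g2 x negb_and !negbK -ltNge; congr (_ || _ && _).
by case: strict; rewrite /= -?ltNge g3 g4 g5 g6 x p d.
Qed.

Lemma wp_search_interval i s : static s -> search_input s -> imem s 11 0 = i ->
  (i < size P)%N -> wp search_interval s (fun s' k => [/\ (k <= 60)%N,
    rmem s' 37 0 = piece_lo b lo i & rmem s' 38 0 = piece_hi b P hi i]).
Proof.
move=> st [g1 g2 _] si ip; apply: wp_seq.
apply: (wp_conseq (Q := fun s1 k => (k <= 20)%N /\
    rmem s1 37 0 = piece_lo b lo i)).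
  by apply: wp_if; rewrite /= g1 si (st_b st) // => h; apply: wp_rset;
    rewrite /= ?g1 ?si ?(st_b st) // /piece_lo ?h // (negbTE h).
move=> s1 k1 f1 [kk1 x1]; have st1 : static s1 by apply: static_frame f1 st.
have i1 : imem s1 11 0 = i by rewrite f1.1.
have h1 : rmem s1 26 0 = hi by rewrite f1.2.
apply/wp_seq/wp_rset/wp_if; rewrite /= i1 h1 (st_p st1) (addn1 i) addn2.
  move=> /andP[ip1]; rewrite (st_b st1) // => bh; apply: wp_rset => /=.
  by rewrite i1 (addn1 i) (st_b st1) // /piece_hi ip1 bh; split=> //; lia.
move=> nh; apply: wp_skip; split=> //; first by lia.
rewrite /= /piece_hi; case: ifP => // /andP[ip1 bh].
by move: nh; rewrite ip1 (st_b st1) // bh.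
Qed.

Lemma coef_search_poly i j : (spoly i)`_j =
  (if j == 0%N then alpha else 0) + beta * (P`_i)`_j + (if j == 1%N then gamma else 0)
  + delta * ((j.+1)%:R * (P`_i)`_j.+1).
Proof.
rewrite /search_poly !coefD !coefZ coefC coefX coef_deriv -[_ *+ j.+1]mulr_natl.
by case: (j == 1%N); rewrite /= ?mulr1 ?mulr0.
Qed.

(** Here [q_gt0] makes room for the linear term [gamma *: 'X]. *)
Lemma size_search_poly i : (i < size P)%N -> (size (spoly i) <= q.+1)%N.
Proof.
move=> ip; have sP := size_piece pwD ip.
apply/leq_sizeP => j qj; rewrite coef_search_poly.
have zero k : (q < k)%N -> (P`_i)`_k = 0.
  by move=> qk; apply: nth_default; apply: leq_trans sP qk.
rewrite (zero j qj) (zero j.+1 (ltnW qj)).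
have -> : (j == 0%N) = false by case: j qj q_gt0 => //; case: (q).
have -> : (j == 1%N) = false by case: j qj q_gt0 => [|[|]] //; case: (q) => [|[]].
by rewrite !mulr0 !addr0.
Qed.

Lemma wp_search_coefs i s : static s -> search_input s -> imem s 11 0 = i ->
  (i < size P)%N -> wp search_coefs s (fun s' k => (k <= q.+1 * 400)%N /\
    forall j, (j <= q)%N -> rmem s' 40 j = (spoly i)`_j).
Proof.
move=> st [g1 g2 [g3 g4 g5 g6]] si ip; apply/wp_seq/wp_rset => /=; apply: wp_seq.
set s1 := rput _ _ _ _.
have st1 : static s1 by apply: static_rput.
(* Cell 44 is a real copy of the counter, for the factor [j.+1] of the derivative: integers cannot
   be converted to reals. *)
pose Inv j (s' : state) := rmem s' 44 0 = (j.+1)%:R /\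
  forall j', (j' < j)%N -> rmem s' 40 j' =
    beta * (P`_i)`_j' + delta * ((j'.+1)%:R * (P`_i)`_j'.+1).
apply: (wp_for q.+1 100 Inv) => //.
- by move=> s' f; rewrite /= f.1 // (st_q st) addn1.
- move=> j s' jq f sj [I1 I2].
  have st' : static s' by apply: static_frame f st1.
  have i' : imem s' 11 0 = i by rewrite f.1.
  have b' : rmem s' 34 0 = beta by rewrite f.2.
  have d' : rmem s' 36 0 = delta by rewrite f.2.
  rewrite ltnS in jq.
  have offE : imem s' 5 i = (i * q.+1)%N by rewrite (st_off st') // ltnW.
  apply/wp_seq/wp_rset; rewrite /= sj i' offE (st_P st') // b'.
  set s2 := rput _ 40 _ _; apply: wp_seq.
  apply: (wp_conseq (Q := fun s3 k => [/\ (k <= 40)%N,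
    rmem s3 40 j = beta * (P`_i)`_j + delta * ((j.+1)%:R * (P`_i)`_j.+1) &
    forall j', (j' < j)%N -> rmem s3 40 j' = rmem s' 40 j'])).
    apply: wp_if; rewrite /= sj (st_q st') (addn1 j) => jq'.
      apply: wp_rset; rewrite /= sj i' offE I1 d' (addn1 j) eqxx; split=> //.
        by rewrite (st_P st') //= mulrA.
      by move=> j' /ltn_eqF ->.
    apply: wp_skip; split=> //; last by move=> j' /ltn_eqF lt; rewrite /= lt.
    (* Coefficient [q.+1] is not stored: its cell would be the first one of the next piece. The
       program skips it, as it is 0. *)
    have -> : (P`_i)`_j.+1 = 0.
      apply: nth_default; apply: leq_trans (size_piece pwD ip) _.
      by rewrite ltnS leqNgt.
    by rewrite /= eqxx !mulr0 addr0.
  move=> s3 k3 f3 [kk3 c3 o3]; apply: wp_rset => /=; split; first by clear - kk3; lia.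
  have j3 : rmem s3 44 0 = (j.+1)%:R by rewrite f3.2 //= I1.
  move=> _; split; first by rewrite /= j3 natr1.
  move=> j' /=; rewrite ltnS leq_eqVlt => /orP[/eqP->//|lt].
  by rewrite o3 // I2.
- move=> s4 k4 f4 [I1 I2] kk4; apply/wp_seq/wp_rset/wp_rset => /=; split.
    by move: kk4 => /=; clear; lia.
  have [a4 c4] : rmem s4 33 0 = alpha /\ rmem s4 35 0 = gamma by rewrite !f4.2.
  move=> j jq; rewrite coef_search_poly a4 c4.
  case: j jq => [|[|j]] jq; rewrite /= I2 //; lra.
Qed.

(** The oracle lists roots in arbitrary order, so one pass keeps the smallest in the window; there
    are at most [q] of them. *)
Lemma wp_search_roots i s : static s -> (i < size P)%N -> spoly i != 0 ->
  piece_lo b lo i <= piece_hi b P hi i ->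
  rmem s 37 0 = piece_lo b lo i -> rmem s 38 0 = piece_hi b P hi i ->
  (forall j, (j <= q)%N -> rmem s 40 j = (spoly i)`_j) ->
  wp search_roots s (fun s' k => (k <= q.+1 * 200)%N /\
    first_root b P lo hi alpha beta gamma delta i (rmem s' 39 0)).
Proof.
move=> st ip p0 lohi' x0 x1 coefs.
have sp := size_search_poly ip; have [rtu rtE] := rtP p0.
have size_rt : (size (rt (spoly i)) <= q)%N.
  rewrite -ltnS; apply: leq_trans sp; apply: max_poly_roots => //.
  by apply/allP => r; rewrite rtE.
apply: wp_seq; eexists; eexists; split.
  apply: ExecRoots; [reflexivity| |].
    have -> : \poly_(j < ieval s (IAdd eQ (INum 1))) rmem s 40 j = spoly i.
      apply/polyP => j; rewrite coef_poly /= (st_q st) addn1.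
      case: ltnP => jq; first by rewrite coefs.
      by rewrite nth_default // (leq_trans sp).
    exact: p0.
  apply: leq_trans (size_poly _ _) _; by rewrite /= (st_q st) addn1.
have -> : \poly_(j < ieval s (IAdd eQ (INum 1))) rmem s 40 j = spoly i.
  apply/polyP => j; rewrite coef_poly /= (st_q st) addn1.
  case: ltnP => jq; first by rewrite coefs.
  by rewrite nth_default // (leq_trans sp).
set rs := rt (spoly i) in rtu rtE size_rt *.
apply/wp_seq/wp_rset => /=; rewrite x1.
set s1 := rput _ 39 0 _.
have rs1 j : (j < size rs)%N -> rmem s1 41 j = rs`_j.
  by move=> h; rewrite /= h.
pose Inv j (s' : state) := [/\ piece_lo b lo i <= rmem s' 39 0 <= piece_hi b P hi i,
  rmem s' 39 0 = piece_hi b P hi i \/ root (spoly i) (rmem s' 39 0) &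
  forall j', (j' < j)%N -> piece_lo b lo i <= rs`_j' -> rmem s' 39 0 <= rs`_j'].
apply: (wp_for (size rs) 60 Inv) => //.
- by move=> s' f; rewrite /= f.1.
- by split=> //=; [rewrite lexx lohi'|left].
- move=> j s' jr f sj [I1 I2 I3].
  have r' : rmem s' 41 j = rs`_j by rewrite f.2 // rs1.
  have x0' : rmem s' 37 0 = piece_lo b lo i by rewrite f.2.
  apply: wp_if; rewrite /= sj r' x0'.
    move=> /andP[h1 h2]; apply: wp_rset => /=; split=> // _; rewrite sj r'; split=> /=.
    + by rewrite h1 (le_trans h2) //; case/andP: I1.
    + by right; have := mem_nth 0 jr; rewrite rtE.
    + move=> j'; rewrite ltnS leq_eqVlt => /orP[/eqP->//|lt] h.
      by apply: le_trans h2 _; apply: I3.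
  move=> nh; apply: wp_skip; split=> // _; split=> //= j'.
  rewrite ltnS leq_eqVlt => /orP[/eqP->|lt] h; last exact: I3.
  by move: nh; rewrite h /= -ltNge => /ltW.
- move=> s' k f [I1 I2 I3] kk; split; first by move: kk size_rt => /=; clear; nia.
  split=> // r rr h1; rewrite ltNge => /negP; apply.
  have rin : r \in rs by rewrite rtE.
  by rewrite -(nth_index 0 rin) I3 ?index_mem // nth_index.
Qed.

Lemma wp_search strict (post : R -> Prop) s : static s -> search_input s ->
  (forall i, (i < size P)%N -> spred strict i -> ((i.+1 < size P)%N -> ~~ spred strict i.+1) ->
    spoly i != 0 /\ forall acc, first_root b P lo hi alpha beta gamma delta i acc -> post acc) ->
  wp (search strict) s (fun s' k => (k <= L.+2 * (1100 * q.+1))%N /\ post (rmem s' 8 0)).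
Proof.
move=> st si H; apply: wp_seq.
have := @wp_bisect _ _ _ _ _ _ _ T mf rt pwD (search_test strict) (spred strict) L s st pL.
move=> /(_ _ _)/wp_conseq; apply.
  move=> i s' ip f x p d; apply: search_testE => //.
  exact: search_input_frame f _ si.
  by rewrite /search_pred (b0 pwD) lo0.
move=> s1 k1 f1 [kk1 [i [i1 ip pi pi1]]].
have [p0 fr] := H i ip pi pi1.
have st1 : static s1 by apply: static_frame f1 st.
have si1 : search_input s1 by apply: search_input_frame f1 _ si.
apply: wp_seq; apply: (wp_conseq (wp_search_interval st1 si1 i1 ip)) => s2 k2 f2 [kk2 x2 y2].
have st2 : static s2 by apply: static_frame f2 st1.
have si2 : search_input s2 by apply: search_input_frame f2 _ si1.
have i2 : imem s2 11 0 = i by rewrite f2.1.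
apply: wp_seq; apply: (wp_conseq (wp_search_coefs st2 si2 i2 ip)) => s3 k3 f3 [kk3 c3].
have st3 : static s3 by apply: static_frame f3 st2.
have [x3 y3] : rmem s3 37 0 = piece_lo b lo i /\ rmem s3 38 0 = piece_hi b P hi i.
  by rewrite !f3.2.
have [lt _ _] := piece_hiP pwD lohi pi pi1.
apply: wp_seq; apply: (wp_conseq (wp_search_roots st3 ip p0 (ltW lt) x3 y3 c3)).
move=> s4 k4 f4 [kk4 r4]; apply: wp_rset => /=; split; last exact: fr.
have bc : (bcost (search_test strict) <= 60)%N by case: (strict).
have kk1' : (k1 <= L.+2 * (360 * q.+1))%N.
  apply: leq_trans kk1 _; apply: leq_mul => //.
  by move: bc; case: (strict) => /=; clear; lia.
have : (2 * (330 * q.+1) <= L.+2 * (330 * q.+1))%N by rewrite leq_mul2r orbT.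
have -> : (L.+2 * (1100 * q.+1) = L.+2 * (360 * q.+1) + L.+2 * (330 * q.+1) + L.+2 * (410 * q.+1))%N.
  by rewrite -!mulnDr -!mulnDl.
by move: kk1' kk2 kk3 kk4; clear; lia.
Qed.

End Search.

Definition bracket (s : state) lo hi tL wL gL tR wR gR :=
  [/\ [/\ left_end s lo tL wL gL, evaluated s lo tL wL gL & 0 < fslope wL gL],
      [/\ right_end s hi tR wR, evaluated s hi tR wR gR & fslope wR gR <= 0],
      best_ok s & outside lo hi (found s) (rmem s 31 0)].

Definition bracketed s lo hi := exists tL wL gL tR wR gR, bracket s lo hi tL wL gL tR wR gR.

Definition spares_bracket (mi mr : seq nat) :=
  all (fun a => a \notin mi) [:: 4; 26; 27]%N &&
  all (fun a => a \notin mr) [:: 20; 21; 22; 23; 24; 25; 26; 27; 28; 29; 30; 31; 32]%N.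

Lemma bracket_frame mi mr s s' lo hi tL wL gL tR wR gR : spares_bracket mi mr ->
  frame mi mr s s' -> bracket s lo hi tL wL gL tR wR gR ->
  bracket s' lo hi tL wL gL tR wR gR.
Proof.
move=> /andP[/allP ai /allP ar] [fi fr].
have Ei a j : a \in [:: 4; 26; 27]%N -> imem s' a j = imem s a j.
  by move=> h; apply/fi/ai.
have Er a j : a \in [:: 20; 21; 22; 23; 24; 25; 26; 27; 28; 29; 30; 31; 32]%N ->
    rmem s' a j = rmem s a j by move=> h; apply/fr/ar.
by rewrite /bracket /left_end /right_end /evaluated /best_ok /found /form_at !Ei // !Er.
Qed.

Lemma bracketed_frame mi mr s s' lo hi : spares_bracket mi mr ->
  frame mi mr s s' -> bracketed s lo hi -> bracketed s' lo hi.
Proof.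
move=> sp f [tL [wL [gL [tR [wR [gR h]]]]]].
by exists tL, wL, gL, tR, wR, gR; apply: bracket_frame f h.
Qed.

Lemma bracketed_lo s lo hi : bracketed s lo hi ->
  [/\ rmem s 20 0 = lo, rmem s 26 0 = hi, rd lo (rmem s 22 0) & 0 <= lo /\ hi <= hmax].
Proof.
move=> [tL [wL [gL [tR [wR [gR [[[h1 _ -> _ _] [/andP[l0 _] _ r _] _] [[h2 _ _ _] [/andP[_ hm] _ _ _] _] _ _]]]]]]].
by [].
Qed.

Lemma bracket_shrink s s' x lo hi tL wL gL tR wR gR tau w g :
  bracket s lo hi tL wL gL tR wR gR -> best_ok s' -> better s s' ->
  evaluated s' x tau w g -> shrunk s s' x tau w g ->
  if (imem s' 29 0 == 0)%N then bracket s' x hi tau w g tR wR gR /\ 0 < fslope w g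
  else bracket s' lo x tL wL gL tau w g /\ fslope w g <= 0.
Proof.
move=> [[L1 L2 L3] [R1 R2 R3] B1 B2] bs' bt ev [[s0 [-> [Ls' keep]]]|[s0 [-> [Rs' keep]]]] /=;
  have [x0 okx rx rec] := ev.
  split=> //; split=> //; first by split=> //; [exact: keep|exact: evaluated_better R2].
  exact: (shrink_lo superD B2 rx okx rec bt s0).
split=> //; split=> //; first by split=> //; [exact: keep|exact: evaluated_better L2].
exact: (shrink_hi superD B2 rx okx rec bt s0).
Qed.

Lemma wp_shrink_bracket x s lo hi : static s -> rmem s 8 0 = x -> lo < x -> x < hi ->
  bracketed s lo hi ->
  wp shrink s (fun s' k => (k <= eval_time n m q T L + 300)%N /\
    exists lo' hi', [/\ bracketed s' lo' hi', lo <= lo' < hi', hi' <= hi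
      & x <= lo' \/ hi' <= x]).
Proof.
move=> st sx lx xh br; have [_ _ _ [l0 hm]] := bracketed_lo br.
case: br => [tL [wL [gL [tR [wR [gR br]]]]]].
have xb : 0 <= x <= hmax by rewrite (le_trans l0 (ltW lx)) (le_trans (ltW xh) hm).
have bs : best_ok s by case: br.
apply: (wp_conseq (wp_shrink st sx xb bs)) => s1 k1 f1 [kk1 [tau [w [g [[bs1 bt] ev sh _]]]]].
split=> //; have := bracket_shrink br bs1 bt ev sh; case: ifP => _ [h _].
  by exists x, hi; rewrite lexx (ltW lx) xh; split=> //; [exists tau, w, g, tR, wR, gR|left].
by exists lo, x; rewrite lexx lx (ltW xh); split=> //; [exists tL, wL, gL, tau, w, g|right].
Qed.

Definition step_time := (L.+2 * (1100 * q.+1) + eval_time n m q T L + 500)%N.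

(** A slope not positive at [lo] stays so, as the derivative is nonincreasing. Otherwise it is
    positive up to the crossing point: either that is [hi], or the evaluation there keeps one side,
    on which the sign is constant. *)
Lemma wp_critical_body c k s lo hi : static s -> rmem s 45 0 = c%:R -> rmem s 46 0 = k%:R ->
  lo < hi -> bracketed s lo hi ->
  wp critical_body s (fun s' t => [/\ (t <= step_time)%N, rmem s' 45 0 = c%:R,
    rmem s' 46 0 = (k.+1)%:R &
    exists lo' hi', [/\ bracketed s' lo' hi', lo <= lo' < hi', hi' <= hi
      & unimodal rd lo' hi' c k]]).
Proof.
move=> st sc sk lohi br; have [lE hE rlo [l0 hm]] := bracketed_lo br.
apply: wp_seq.
apply: (wp_conseq (Q := fun s' t => (t <= step_time - 40)%N /\
    exists lo' hi', [/\ bracketed s' lo' hi', lo <= lo' < hi', hi' <= hi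
      & unimodal rd lo' hi' c k])); last first.
  move=> s1 k1 f1 [kk1 [lo' [hi' [br' h1 h2 h3]]]]; apply: wp_rset => /=.
  have -> : rmem s1 46 0 = k%:R by rewrite f1.2.
  split; [by move: kk1; rewrite /step_time; clear; lia|by rewrite f1.2|by rewrite natr1|].
  by exists lo', hi'.
apply: wp_if; rewrite /= sc sk; last first.
  rewrite negbK => cg; apply: wp_skip; split; first by rewrite /step_time; clear; lia.
  exists lo, hi; rewrite lexx lohi; split=> //; right=> x g /andP[lx _] rx.
  apply: le_trans cg; rewrite ler_wpM2l //.
  exact: (rd_nonincreasing pwD concD rlo rx).
rewrite -ltNge => cg.
do 4 (apply: wp_seq; apply: wp_rset => /=); rewrite sc sk sub0r; apply: wp_seq.
set s1 := rput _ 36 _ _.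
have f1 : frame [::] [:: 33; 34; 35; 36]%N s s1 by do 4 apply: frame_rput => //.
have st1 : static s1 by apply: static_frame f1 st.
have br1 : bracketed s1 lo hi by apply: bracketed_frame f1 br.
pose post acc := [/\ lo < acc <= hi,
  forall x g, lo <= x < acc -> rd x g -> k%:R < c%:R * g
  & acc < hi -> forall x g, acc <= x -> rd x g -> c%:R * g <= k%:R].
have si : search_input lo hi k%:R 0 0 (- c%:R) s1 by split.
apply: (wp_conseq (wp_search (post := post) l0 lohi st1 si _)).
  move=> i ip pi pi1.
  have dneg : - c%:R <= 0 :> R by rewrite oppr_le0.
  have dlo g : rd lo g -> k%:R + - c%:R * g < 0.
    by move=> /(rd_uniq pwD rlo) <-; rewrite mulNr subr_lt0.
  have [p0 H] := search_deriv pwD concD lohi ip pi pi1 erefl erefl erefl dneg dlo.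
  split=> // acc /H[h1 h2 h3]; split=> //.
    by move=> x g xb rx; have := h2 x g xb rx; rewrite mulNr subr_lt0.
  by move=> ah x g ax rx; have := h3 ah x g ax rx; rewrite mulNr subr_ge0.
move=> s2 k2 f2 [kk2 [/andP[la ah] p2 p3]].
have st2 : static s2 by apply: static_frame f2 st1.
have br2 : bracketed s2 lo hi by apply: bracketed_frame f2 br1.
have [l2 h2 _ _] := bracketed_lo br2.
set acc := rmem s2 8 0 in la ah p2 p3.
apply: wp_if; rewrite /= l2 h2 -/acc -!ltNge la /=.
  move=> ah'; apply: (wp_conseq (wp_shrink_bracket st2 erefl la ah' br2)).
  move=> s3 k3 f3 [kk3 [lo' [hi' [br3 /andP[h3 h4] h5 alt]]]]; split.
    by move: kk2 kk3; rewrite /step_time; clear; lia.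
  exists lo', hi'; rewrite h3 h4; split=> //; case: alt => alt.
    right=> x g /andP[lx _]; apply: p3 => //; exact: le_trans lx.
  left=> x g /andP[lx xh]; apply: p2.
  by rewrite (le_trans h3 lx) (lt_le_trans xh alt).
move=> nah; apply: wp_skip; split; first by move: kk2; rewrite /step_time; clear; lia.
have E : acc = hi by apply/eqP; rewrite eq_le ah leNgt nah.
by exists lo, hi; rewrite lexx lohi; split=> //; left; rewrite -E.
Qed.

Definition critical_time := (m.+2 * (m.+2 * (step_time + 40) + 60) + 20)%N.

Lemma wp_critical s lo hi : static s -> lo < hi -> bracketed s lo hi ->
  wp critical s (fun s' t => (t <= critical_time)%N /\
    exists lo' hi', [/\ bracketed s' lo' hi', lo' < hi' & all_unimodal rd m lo' hi']).
Proof.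
move=> st lohi br; apply/wp_seq/wp_rset => /=; set s1 := rput _ _ _ _.
have f1 : frame [::] [:: 45]%N s s1 by apply: frame_rput.
have st1 : static s1 by apply: static_frame f1 st.
have br1 : bracketed s1 lo hi by apply: bracketed_frame f1 br.
pose U l h j := forall c k, (c < j)%N -> (k <= m)%N -> unimodal rd l h c k.
have Usub l h l' h' j : l <= l' -> h' <= h -> U l h j -> U l' h' j.
  by move=> h1 h2 H c k cj km; apply: unimodal_sub h1 h2 (H c k cj km).
pose Inv j (s' : state) := rmem s' 45 0 = j%:R /\
  exists l h, [/\ bracketed s' l h, l < h & U l h j].
apply: (wp_for m.+1 (m.+2 * (step_time + 40) + 30) Inv) => //.
- by move=> s' f; rewrite /= f.1 // (st_m st1) addn1.
- by split=> //; exists lo, hi.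
- move=> c s' cm f sc [I1 [l [h [br' lh Uc]]]].
  have st' : static s' by apply: static_frame f st1.
  apply/wp_seq/wp_rset => /=; set s2 := rput _ _ _ _.
  have f2 : frame [::] [:: 46]%N s' s2 by apply: frame_rput.
  have st2 : static s2 by apply: static_frame f2 st'.
  have br2 : bracketed s2 l h by apply: bracketed_frame f2 br'.
  pose Inv2 k (s3 : state) := [/\ rmem s3 45 0 = c%:R, rmem s3 46 0 = k%:R &
    exists l' h', [/\ bracketed s3 l' h', l' < h', U l' h' c
      & forall k', (k' < k)%N -> unimodal rd l' h' c k']].
  apply: wp_seq; apply: (wp_for m.+1 step_time Inv2) => //.
  + by move=> s3 f3; rewrite /= f3.1 // (st_m st2) addn1.
  + by split=> //; exists l, h.
  + move=> k s3 km f3 sk [J1 J2 [l' [h' [br3 lh' Uc' Uk]]]].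
    have st3 : static s3 by apply: static_frame f3 st2.
    apply: (wp_conseq (wp_critical_body st3 J1 J2 lh' br3)).
    move=> s4 k4 f4 [kk4 c4 e4 [l4 [h4 [br4 /andP[a4 b4] d4 U4]]]]; split=> // _; split=> //.
    exists l4, h4; split=> //.
    * exact: Usub Uc'.
    * move=> k'; rewrite ltnS leq_eqVlt => /orP[/eqP->//|lt].
      exact: unimodal_sub a4 d4 (Uk k' lt).
  + move=> s3 k3 f3 [J1 J2 [l' [h' [br3 lh' Uc' Uk]]]] kk3; apply: wp_rset => /=; split.
      by move: kk3 => /=; clear; nia.
    move=> _; split; first by rewrite /= J1 natr1.
    exists l', h'; split=> //.
    move=> c' k'; rewrite ltnS leq_eqVlt => /orP[/eqP->|lt] km'; last exact: Uc'.
    by apply: Uk; rewrite ltnS.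
- move=> s' k f [I1 [l [h [br' lh Uc]]]] kk; split.
    by move: kk; rewrite /critical_time /=; clear; nia.
  by exists l, h.
Qed.

Hypothesis m_gt0 : (0 < m)%N.

Definition settled (s : state) :=
  best_ok s /\ forall x v, att x v -> found s /\ v <= rmem s 31 0.

Lemma settled_frame mi mr s s' : frame mi mr s s' -> 4 \notin mi ->
  all (fun a => a \notin mr) [:: 31; 32]%N -> settled s -> settled s'.
Proof.
by move=> [fi fr] h1 /= /and3P[h2 h3 _]; rewrite /settled /best_ok /found !fi // !fr.
Qed.

Section Newton.
Variables (l0 h0 : R).
Hypothesis l00 : 0 <= l0.
Hypothesis U0 : all_unimodal rd m l0 h0.
Let exD x : 0 <= x -> exists g, rd x g := @ex_rd _ _ _ _ _ pwD x.
Let bg := @is_cut_form_bounded _ _ _ I.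
Let bh := @is_st_cut_form_bounded _ _ _ I.
Local Notation pot := (potential D m l0 h0).

Lemma outside_settled s lo hi : best_ok s -> outside lo hi (found s) (rmem s 31 0) ->
  (forall x v, lo < x < hi -> att x v -> found s /\ v <= rmem s 31 0) -> settled s.
Proof. by move=> bs out H; split=> // x v at_; case: (out x v at_) => // xb; apply: H at_. Qed.

Definition newton_progress (s : state) p :=
  imem s 28 0 = 0%N /\ settled s \/
  imem s 28 0 = 1%N /\ exists lo hi tL wL gL tR wR gR,
    [/\ bracket s lo hi tL wL gL tR wR gR, l0 <= lo, lo < hi, hi <= h0
      & (pot tL wL tR wR < p)%N].

Section Step.
Variables (lo hi : R) (tL tR : nat) (wL wR : form R) (gL gR : R).
Local Notation F := (newton_fun D tL tR wL wR).

Lemma wp_newton_coefs s : form_at 23 24 25 wL s -> form_at 28 29 30 wR s ->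
  imem s 26 0 = tL -> imem s 27 0 = tR ->
  wp newton_coefs s (fun s' k => (k <= 60)%N /\ [/\ rmem s' 36 0 = 0 &
    forall x, rmem s' 33 0 + rmem s' 34 0 * D x + rmem s' 35 0 * x = F x]).
Proof.
move=> [a1 a2 a3] [b1 b2 b3] sL sR; apply/wp_seq/wp_rset => /=; rewrite /newton_fun.
apply: wp_if; rewrite /= sL => hL.
  apply/wp_seq/wp_rset/wp_seq/wp_rset/wp_rset; rewrite /= a1 a2 a3; split=> //; split=> // x.
  by rewrite hL /fev; lra.
rewrite (negbTE hL); apply: wp_if; rewrite /= sR => hR;
  apply/wp_seq/wp_rset/wp_seq/wp_rset/wp_rset;
  rewrite /= ?a1 ?a2 ?a3 b1 b2 b3; split=> //; split=> // x.
  by rewrite hR /fev; lra.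
by rewrite (negbTE hR) /fev; lra.
Qed.

Lemma wp_newton_step s : static s -> bracket s lo hi tL wL gL tR wR gR ->
  l0 <= lo -> lo < hi -> hi <= h0 -> imem s 28 0 = 1%N ->
  wp newton_step s (fun s' k => (k <= step_time + 300)%N /\
    newton_progress s' (pot tL wL tR wR)).
Proof.
move=> st br l0lo lohi hih0 run.
have [[[lE ylE glE tLE fL] [lb eL rL recL] sL] [[hE yhE tRE fR] [hb eR rR recR] sR] bs out] := br.
have lo0 : 0 <= lo by case/andP: lb.
have stop_hi := newton_stop_hi monoD superD exD m_gt0 bg bh l00 U0 l0lo lohi hih0 eL eR rL sL recR.
have nondec := newton_nondecr monoD superD exD m_gt0 bg bh l00 U0 l0lo lohi hih0 eL eR.
have Flo := newton_fun_lo eL eR.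
apply: wp_seq; apply: (wp_conseq (wp_newton_coefs fL fR tLE tRE)) => s1 k1 f1 [kk1 [d1 F1]].
have st1 : static s1 by apply: static_frame f1 st.
have br1 : bracket s1 lo hi tL wL gL tR wR gR by apply: bracket_frame f1 br.
have hE1 : rmem s1 26 0 = hi by rewrite f1.2.
have yhE1 : rmem s1 27 0 = D hi by rewrite f1.2.
have run1 : imem s1 28 0 = 1%N by rewrite f1.1.
apply: wp_if; rewrite /= hE1 yhE1 F1 => Fhi.
  apply: wp_iset => /=; split; first by move: kk1; clear; lia.
  left; split=> //; apply: (@settled_frame [:: 28]%N [::] s1) => //; first exact: frame_iput.
  have [_ _ bs1 out1] := br1; apply: (outside_settled bs1 out1) => x v xb at_.
  by rewrite /found f1.1 // f1.2 //; exact: (stop_hi _ _ _ Fhi xb at_).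
rewrite -ltNge in Fhi.
have si : search_input lo hi (rmem s1 33 0) (rmem s1 34 0) (rmem s1 35 0) 0 s1.
  by split=> //; rewrite f1.2.
pose post x := [/\ lo <= x < hi, F x = 0 & forall y, x < y -> y <= hi -> 0 < F y].
apply: wp_seq; apply: (wp_conseq (wp_search (strict := false) (post := post) lo0 lohi st1 si _)).
  move=> i ip pi pi1.
  have [| | |p0 H] := search_root pwD concD monoD lohi ip pi pi1 erefl erefl.
  - by rewrite /= F1.
  - by rewrite /= F1.
  - by move=> x y lx xy yh; rewrite /= !F1; apply: nondec.
  split=> // acc /H[h1 h2 h3]; split=> //; first by rewrite -F1.
  by move=> y ay yh; rewrite -F1; apply: h3.
move=> s2 k2 f2 [kk2 []]; set x := rmem s2 8 0 => /andP[lx xh] Fx Fx'.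
have st2 : static s2 by apply: static_frame f2 st1.
have br2 : bracket s2 lo hi tL wL gL tR wR gR by apply: bracket_frame f2 br1.
have [[[lE2 ylE2 glE2 tLE2 fL2] [lb2 _ _ recL2] _] [[hE2 yhE2 tRE2 fR2] [hb2 _ _ recR2] _] bs2 out2] := br2.
have run2 : imem s2 28 0 = 1%N by rewrite f2.1.
apply: wp_if; rewrite /= lE2 -/x => xl.
  apply: wp_iset => /=; split; first by move: kk1 kk2; rewrite /step_time; clear; lia.
  left; split=> //; apply: (@settled_frame [:: 28]%N [::] s2) => //; first exact: frame_iput.
  apply: (outside_settled bs2 out2) => y v yb at_.
  exact: (newton_stop_lo monoD superD exD m_gt0 bg bh l00 U0 l0lo lohi hih0 eL eR rL sL
    recL2 recR2 lx xh Fx Fx' xl yb at_).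
rewrite -ltNge in xl.
have [a2 c2 e2] := fL2.
(* The shrinking step may overwrite the outcomes and the left form, which the stopping test still
   needs. *)
apply: wp_seq; do 4 (apply: wp_seq; (apply: wp_iset || apply: wp_rset)); apply: wp_rset.
rewrite /= tLE2 tRE2 a2 c2 e2; set s3 := rput _ 49 _ _.
have f3 : frame [:: 32; 33]%N [:: 47; 48; 49]%N s2 s3.
  by do 3 apply: frame_rput => //; do 2 apply: frame_iput => //.
have st3 : static s3 by apply: static_frame f3 st2.
have br3 : bracket s3 lo hi tL wL gL tR wR gR by apply: bracket_frame f3 br2.
have xb : 0 <= x <= hmax by have /andP[_ hm] := hb; rewrite (le_trans lo0 lx) (le_trans (ltW xh) hm).
have x3 : rmem s3 8 0 = x by [].
have bs3 : best_ok s3 by case: br3.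
apply: wp_seq; apply: (wp_conseq (wp_shrink st3 x3 xb bs3)).
move=> s4 k4 f4 [kk4 [tau [w [g [[bs4 bt] ev sh [fw y4 v4 _]]]]]].
have bsh := bracket_shrink br3 bs4 bt ev sh.
have oL : imem s4 32 0 = tL by rewrite f4.1.
have oR : imem s4 33 0 = tR by rewrite f4.1.
have [o1 o2 o3] : form_at 47 48 49 wL s4 by split; rewrite f4.2.
have run4 : imem s4 28 0 = 1%N by rewrite f4.1.
have x4 : rmem s4 8 0 = x by rewrite f4.2.
have [_ ex rx recx] := ev.
have time k : (k <= k1 + k2 + k4 + 200)%N -> (k <= step_time + 300)%N.
  by move: kk1 kk2 kk4; rewrite /step_time; clear; lia.
have side : imem s4 29 0 = 0%N \/ imem s4 29 0 = 1%N.
  by case: sh => [[_ [-> _]]|[_ [-> _]]]; [left|right].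
have stop k : (k <= k1 + k2 + k4 + 200)%N -> settled s4 ->
    (k <= step_time + 300)%N /\ newton_progress (iput s4 28 0 0) (pot tL wL tR wR).
  move=> kk ss; split; first exact: time.
  left; split=> //; apply: (@settled_frame [:: 28]%N [::] s4) ss => //; exact: frame_iput.
have pot_lo := @newton_potential_lo _ _ _ _ monoD superD exD m_gt0 _ _ bg bh _ _ l00 U0
  _ _ tL tR wL wR l0lo hih0 eL _ xh Fx _ _ _ xl ex rx.
have pot_hi := @newton_potential_hi _ _ _ _ monoD superD exD m_gt0 _ _ bg bh _ _ l00 U0
  _ _ tL tR wL wR l0lo lohi hih0 eR _ lx xh Fx _ _ _ ex rx.
have xh0 : x <= h0 by rewrite (le_trans (ltW xh)).
have l0x : l0 <= x by rewrite (le_trans l0lo).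
have go_lo k : (k <= k1 + k2 + k4 + 200)%N -> imem s4 29 0 = 0%N ->
    ~ (tL = 0%N /\ (0 < tR)%N) -> (tL = 0%N -> tR = 0%N -> fev D w x < fev D wL x) ->
    (k <= step_time + 300)%N /\ newton_progress s4 (pot tL wL tR wR).
  move=> kk sd n1 n2; split; first exact: time.
  right; split=> //; move: bsh; rewrite sd /= => -[br4 s0].
  by exists x, hi, tau, w, g, tR, wR, gR; split=> //; apply: pot_lo.
have go_hi k : (k <= k1 + k2 + k4 + 200)%N -> imem s4 29 0 = 1%N -> tL = 0%N ->
    (tR = 0%N -> fev D w x < fev D wL x) ->
    (k <= step_time + 300)%N /\ newton_progress s4 (pot tL wL tR wR).
  move=> kk sd n1 n2; split; first exact: time.
  right; split=> //; move: bsh; rewrite sd /= => -[br4 s0].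
  by exists lo, x, tL, wL, gL, tau, w, g; split=> //; apply: pot_hi.
(* Left end infeasible: everything left of [x] violates [wL], so discarding the right side settles
   the search. *)
apply: wp_if; rewrite /= oL => hL.
  apply: wp_if; rewrite /= => hs.
    apply: wp_iset; apply: stop; first by rewrite /=; clear; lia.
    case: side hs => [->//|sd _]; move: bsh; rewrite sd /= => -[[_ _ _ out4] _].
    apply: (outside_settled bs4 out4) => y v yb at_.
    exact: (newton_left monoD superD exD m_gt0 bg bh l00 U0 (found s4) (rmem s4 31 0)
      l0lo lohi hih0 eL rL sL xh Fx yb hL at_).
  apply: wp_skip; apply: go_lo; first by rewrite /=; clear; lia.
  - by case: side hs => ->.
  - by move=> [E _]; rewrite E in hL.
  - by move=> E; rewrite E in hL.
have tL0 : tL = 0%N by move: hL; rewrite -leqNgt leqn0 => /eqP.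
(* Only the right end infeasible: everything right of [x] violates [wR], so discarding the left side
   settles the search. *)
apply: wp_if; rewrite /= oR => hR.
  apply: wp_if; rewrite /= => hs.
    apply: wp_iset; apply: stop; first by rewrite /=; clear; lia.
    case: side hs => [sd _|->//]; move: bsh; rewrite sd /= => -[[_ _ _ out4] _].
    apply: (outside_settled bs4 out4) => y v yb at_.
    exact: (newton_right (found s4) (rmem s4 31 0) eR Fx' yb tL0 hR at_).
  apply: wp_skip; apply: go_hi => //; first by rewrite /=; clear; lia.
  - by case: side hs => ->.
  - by move=> E; rewrite E in hR.
have tR0 : tR = 0%N by move: hR; rewrite -leqNgt leqn0 => /eqP.
(* Both ends feasible: the height of the crossing bounds what remains, so a value at [x] that
   reaches it is optimal. *)
apply: wp_if; rewrite /= o1 o2 o3 y4 x4 v4 -/(fev D wL x) => cmp.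
  apply: wp_iset; apply: stop; first by rewrite /=; clear; lia.
  have t0 : tau = 0%N.
    have : (tau <= 0)%N.
      case: side => sd; move: bsh; rewrite sd /= => -[_ s0].
        by have := newton_tau_lo superD l00 l0lo eL xl ex rx s0; rewrite tL0.
      by have := newton_tau_hi superD l00 l0lo lohi eR xh ex rx s0; rewrite tR0.
    by rewrite leqn0 => /eqP.
  have [f4' v4'] := recx t0.
  have br4 : outside lo hi (found s4) (rmem s4 31 0).
    move=> y v at_; have [_ _ _ out3] := br3; case: (out3 y v at_) => [?|[h1 h2]]; [by left|right].
    by have [h3 h4] := bt h1; split=> //; apply: le_trans h2 h4.
  apply: (outside_settled bs4 br4) => y v yb at_.
  apply: (newton_crossing monoD superD exD m_gt0 bg bh l00 U0 l0lo lohi hih0 eL eR rL sL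
    recR2 lx xh Fx tL0 tR0 bt _ yb at_).
  by split=> //; apply: le_trans cmp v4'.
rewrite -ltNge in cmp; apply: wp_skip; case: side => sd.
  apply: go_lo => //; first by rewrite /=; clear; lia.
  by move=> [_]; rewrite tR0.
by apply: go_hi => //; rewrite /=; clear; lia.
Qed.

End Step.

(** Each outcome is at most 2, hence the [4 * N.+1]. The variant starts at [p.+1], which makes at
    most [p.+2 <= 6 * N + 6] rounds. *)
Lemma newton_time_sum (N p S c k K : nat) : (p <= 4 * N.+1 + N + N -> c <= 6 ->
  k <= p.+2 * (S + 300 + c + 2) -> K <= k + 10 -> K <= (6 * N + 7) * (S + 320))%N.
Proof.
move=> h1 hc h2 h3.
have h4 : (p.+2 * (S + 300 + c + 2) <= (6 * N + 7) * (S + 310))%N by apply: leq_mul; lia.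
nia.
Qed.

Definition newton_rounds := (6 * (m.+1 * m.+1) + 7)%N.

Lemma wp_newton s : static s -> l0 < h0 -> bracketed s l0 h0 ->
  wp newton s (fun s' k => (k <= newton_rounds * (step_time + 320))%N /\ settled s').
Proof.
move=> st lh br; apply/wp_seq/wp_iset => /=; set s1 := iput _ _ _ _.
have f1 : frame [:: 28]%N [::] s s1 by apply: frame_iput.
have st1 : static s1 by apply: static_frame f1 st.
have [tL [wL [gL [tR [wR [gR br1]]]]]] : bracketed s1 l0 h0 by apply: bracketed_frame f1 br.
apply: (wp_while (fun j s' => newton_progress s' j) (step_time + 300)
  (pot tL wL tR wR).+1).
- by right; split=> //; exists l0, h0, tL, wL, gL, tR, wR, gR; rewrite !lexx.
- move=> j s' f [[E _]|[E [lo [hi [tL' [wL' [gL' [tR' [wR' [gR' [br' h1 h2 h3 h4]]]]]]]]]]].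
    by rewrite /= E.
  move=> _; have st' : static s' by apply: static_frame f st1.
  apply: (wp_conseq (wp_newton_step st' br' h1 h2 h3 E)).
  move=> s2 k2 f2 [kk2 alt]; split=> // _.
  case: alt => [dn|[E2 [lo2 [hi2 [a [c [d [e [g [h [i1 i2 i3 i4 i5]]]]]]]]]]].
    by exists 0%N; [apply: leq_ltn_trans h4|left].
  exists (pot a c e g).+1; first by apply: leq_ltn_trans h4.
  by right; split=> //; exists lo2, hi2, a, c, d, e, g, h.
move=> j s' k f [[E sd]|[E _]]; last by rewrite /= E.
move=> _ _ kk; split=> //.
have [[_ [_ eL _ _] _] [_ [_ eR _ _] _] _ _] := br1.
have tL2 := eval_tau eL; have tR2 := eval_tau eR.
have rL := rank_le D m l0 h0 wL.
have bound : (pot tL wL tR wR <= 4 * (m.+1 * m.+1).+1 + (m.+1 * m.+1) + m.+1 * m.+1)%N.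
  rewrite /potential; apply: leq_add; last exact: leq_subr.
  by apply: leq_add => //; apply: leq_mul => //; move: tL2 tR2; clear; lia.
by apply: (newton_time_sum bound _ kk) => //=; clear; lia.
Qed.

End Newton.

End Main.

(** * Extraction of an optimal flow *)

(** Indices run downwards from [m], so the closing arc is fixed first and takes the flow value
    before any other edge is decided. Zero bounds delete the edge while the smallest cut from its
    head to its tail is computed. *)
Definition final_step :=
  34 :=i ISub eM (iv 24) ;; 50 :=r RGet 4 (iv 34) ;;
  RSet 3 (iv 34) RZero ;; RSet 4 (iv 34) RZero ;;
  If (BAnd (BILe (IGet 1 (iv 34)) (IGet 2 (iv 34)))
           (BILe (IGet 2 (iv 34)) (IGet 1 (iv 34)))) Skip
    (16 :=i IGet 2 (iv 34) ;; 17 :=i IGet 1 (iv 34) ;; probe ;;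
     If (BRLe (rv 15) (rv 50)) (50 :=r rv 15) Skip) ;;
  RSet 3 (iv 34) (rv 50) ;; RSet 4 (iv 34) (rv 50).

Definition final :=
  8 :=r rv 32 ;; locate ;; bounds ;; For 24 (IAdd eM (INum 1)) final_step.

Section Final.
Variables (R : realType) (n m q : nat) (I : aemfp R n m 1) (b : seq R).
Variables (P : seq {poly R}) (T : nat -> nat -> nat).
Variables (mf : flow_oracle R) (rt : {poly R} -> seq R).
Local Notation state := (state R).
Local Notation D := (deviation I ord0).
Local Notation wp := (@wp R q T mf rt).
Local Notation static := (static q I b P).
Local Notation lcut := (lowcap (xtl I) (xhd I)).
Hypothesis pwD : piecewise_poly q b P D.
Hypothesis mfP : flow_oracle_correct mf.
Variable hmax : R.
Hypothesis hmaxP : is_min_on (cap I) (homologous I ord0) hmax.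
Variable L : nat.
Hypothesis pL : (size P <= 2 ^ L)%N.
Local Notation att := (attains D hmax (is_cut_form I) (is_st_cut_form I)).

Lemma stores_upd (s : state) (lo up : 'I_m.+1 -> R) (e : 'I_m.+1) x y :
  stores_bounds s lo up -> stores_bounds (rput (rput s 3 e x) 4 e y) (upd lo e x) (upd up e y).
Proof.
move=> h e'; rewrite /= /upd val_eqE; have [h1 h2] := h e'.
by case: eqP.
Qed.

Lemma wp_final_step (e : 'I_m.+1) lo up s : static s -> imem s 24 0 = (m - e)%N ->
  stores_bounds s lo up -> (forall e, lo e <= up e) -> (forall S, 0 <= lcut lo up S) ->
  wp final_step s (fun s' k => (k <= (n + m + 4) * 500 + T n (n + m) + 100)%N /\
    exists x, [/\ stores_bounds s' (upd lo e x) (upd up e x), lo e <= x <= up e,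
      forall S, 0 <= lcut (upd lo e x) (upd up e x) S &
      x = up e \/ exists S : {set 'I_n}, [/\ xhd I e \in S, xtl I e \notin S &
        x = lcut (upd lo e 0) (upd up e 0) S]]).
Proof.
move=> st s24 sb lu cuts.
have me : (m - (m - e) = e)%N by rewrite subKn // -ltnS ltn_ord.
do 4 (apply: wp_seq; (apply: wp_iset || apply: wp_rset)).
rewrite /= (st_m st) s24 me (sb e).2; set s1 := rput _ 4 _ _.
have f1 : frame [:: 34]%N [:: 50; 3; 4]%N s s1.
  by do 3 apply: frame_rput => //; apply: frame_iput.
have st1 : static s1 by apply: static_frame f1 st.
have e1 : imem s1 34 0 = e by [].
have sb1 : stores_bounds s1 (upd lo e 0) (upd up e 0) by apply: stores_upd.
have u1 : rmem s1 50 0 = up e by [].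
pose fixed x := [/\ lo e <= x <= up e,
      forall S, 0 <= lcut (upd lo e x) (upd up e x) S &
      x = up e \/ exists S : {set 'I_n}, [/\ xhd I e \in S, xtl I e \notin S &
        x = lcut (upd lo e 0) (upd up e 0) S]].
apply: wp_seq; apply: (wp_conseq (Q := fun s2 k =>
  (k <= (n + m + 4) * 500 + T n (n + m) + 50)%N /\
  [/\ imem s2 34 0 = e, stores_bounds s2 (upd lo e 0) (upd up e 0) & fixed (rmem s2 50 0)])).
  apply: wp_if; rewrite /= (st_tl st) (st_hd st) -eqn_leq val_eqE.
    move=> /eqP loop; apply: wp_skip; split; first by clear; lia.
    split=> //; rewrite /= ; split; [by rewrite lu lexx|exact: fix_loop|by left].
  move=> ht; apply/wp_seq/wp_iset/wp_seq/wp_iset; rewrite /= (st_tl st) (st_hd st).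
  set s2 := iput _ _ _ _.
  have f2 : frame [:: 16; 17]%N [::] s1 s2 by do 2 apply: frame_iput => //.
  have st2 : static s2 by apply: static_frame f2 st1.
  have lu0 e' : upd lo e 0 e' <= upd up e 0 e' by rewrite /upd; case: eqP.
  have ht' : xhd I e != xtl I e by rewrite eq_sym.
  apply: wp_seq; apply: (wp_conseq (wp_probe T mf rt lu0 ht' st2 erefl erefl sb1)).
  move=> s3 k3 f3 [kk3 _ _ v3].
  have [[S0 [hS0 tS0 M0]] Mmin] := aux_min_cut (mfP (aux_net (xtl I) (xhd I) lu0 ht')).
  rewrite -v3 in M0 Mmin.
  have [xb xcuts] := fix_edge lu cuts hS0 tS0 M0 Mmin.
  have u3 : rmem s3 50 0 = up e by rewrite f3.2.
  have e3 : imem s3 34 0 = e by rewrite f3.1.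
  have sb3 : stores_bounds s3 (upd lo e 0) (upd up e 0).
    by move=> e'; rewrite !f3.2 //; exact: sb1.
  apply: wp_if; rewrite /= u3 => cmp.
    rewrite cmp in xb xcuts.
    apply: wp_rset; rewrite /=; split; first by move: kk3; clear; lia.
    by split=> //; split=> //=; right; exists S0.
  rewrite (negbTE cmp) in xb xcuts.
  apply: wp_skip; split; first by move: kk3; clear; lia.
  by split=> //; rewrite u3; split=> //; left.
move=> s2 k2 f2 [kk2 [e2 sb2 [xb xcuts xE]]].
apply/wp_seq/wp_rset/wp_rset; rewrite /= e2.
split; first by move: kk2; clear; lia.
exists (rmem s2 50 0); split=> // e'; rewrite /= /upd val_eqE; have [h1 h2] := sb2 e'.
by move: h1 h2; rewrite /upd; case: eqP.
Qed.

(** For the case that the arc is fixed at its own capacity: an attained value is at most the cut of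
    the source alone, hence at most that capacity. *)
Lemma lcap_le_arc x (S : {set 'I_n}) : 0 <= x -> snk I \notin S ->
  lcut (xlo I x) (xup I (D x)) S <= arc_cap I.
Proof.
move=> x0 tS; rewrite /lowcap big_ord_recr /= -[leRHS]addr0; apply: lerD.
  apply: ler_sum => i _; rewrite widen_lift /edgecap.
  have l0 := xlo_ge0 I (lift ord_max i) x0.
  have c0 := cap_nneg I i.
  have : xup I (D x) (lift ord_max i) <= cap I i.
    by rewrite /xup /xcap liftK; case: ifP => // _; case: ifP => // /negbT; rewrite -ltNge => /ltW.
  by case: (_ \in S); case: (_ \in S) => //; lra.
have E : xtl I ord_max = snk I by rewrite /xtl unlift_none.
rewrite /edgecap E (negbTE tS); case: (_ \in S) => //.
by rewrite oppr_le0 xlo_ge0.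
Qed.

Definition final_time :=
  (L.+2 * (600 * q.+1) + m.+2 * ((n + m + 4) * 500 + T n (n + m) + 200))%N.

Lemma wp_final x v s : static s -> rmem s 32 0 = x -> att x v ->
  wp final s (fun s' k => (k <= final_time)%N /\
    exists2 g, almost_equal_flow I g & v <= flow_value I g /\
      forall e : 'I_m, rmem s' 3 e = g e).
Proof.
move=> st sx at_; have [[xb xD cg] ch] := at_; have /andP[x0 _] := xb.
apply/wp_seq/wp_rset => /=; rewrite sx; set s1 := rput _ _ _ _.
have st1 : static s1 by apply: static_rput.
apply: wp_seq; apply: (wp_conseq (wp_locate T mf rt pwD st1 pL (erefl : rmem s1 8 0 = x) x0)) => s2 k2 f2 [kk2 y2 _].
have st2 : static s2 by apply: static_frame f2 st1.
have x2 : rmem s2 8 0 = x by rewrite f2.2.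
apply: wp_seq; apply: (wp_conseq (wp_bounds T mf rt st2 x2 y2)) => s3 k3 f3 [kk3 sb3].
have st3 : static s3 by apply: static_frame f3 st2.
(* After [j] rounds the [j] edges of largest index have equal bounds, and the arc among them carries
   at least [v]. *)
pose Inv j (s' : state) := exists lo up, [/\ stores_bounds s' lo up, forall e, lo e <= up e,
  forall S, 0 <= lcut lo up S, forall e, xlo I x e <= lo e /\ up e <= xup I (D x) e &
  (forall e : 'I_m.+1, (m < e + j)%N -> lo e = up e) /\
  if j is 0 then lo = xlo I x /\ up = xup I (D x) else v <= lo ord_max].
apply: (wp_for m.+1 ((n + m + 4) * 500 + T n (n + m) + 100) Inv) => //.
- by move=> s' f; rewrite /= f.1 // (st_m st3) addn1.
- exists (xlo I x), (xup I (D x)); split=> //; first exact: (@xbounds _ _ _ _ _ hmaxP _ xb xD).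
    by move=> S; rewrite lcap_form; apply: cg; exists S; eexists.
  by split=> // e; rewrite addn0 ltnNge -ltnS ltn_ord.
- move=> j s' jm f sj [lo [up [sb lu cuts bd [eqs v0]]]].
  have st' : static s' by apply: static_frame f st3.
  have jm' : (m - j < m.+1)%N by rewrite ltnS leq_subr.
  pose e := Ordinal jm'.
  have s24 : imem s' 24 0 = (m - e)%N by rewrite sj /= subKn // -ltnS.
  apply: (wp_conseq (wp_final_step st' s24 sb lu cuts)) => s4 k4 f4 [kk4 [y [sb4 yb cuts4 yE]]].
  split=> // _; exists (upd lo e y), (upd up e y); split=> //.
  + by move=> e'; rewrite /upd; case: eqP.
  + move=> e'; rewrite /upd; case: eqP => [->|_]; last exact: bd.
    have [h1 h2] := bd e; case/andP: yb => h3 h4.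
    by split; [apply: le_trans h1 h3|apply: le_trans h4 h2].
  + split=> [e'|].
      rewrite /upd; case: eqP => // /eqP ne h; apply: eqs.
      by move: ne h; rewrite -val_eqE /=; move: jm; clear; lia.
    case: j jm sj eqs v0 jm' @e s24 sb4 yb cuts4 yE => [|j] jm sj eqs v0 jm' e s24 sb4 yb cuts4 yE.
      case: v0 => lE uE.
      have eE : e = ord_max by apply: val_inj; rewrite /= subn0.
      rewrite /upd eE eqxx; rewrite eE lE uE in yE.
      case: yE => [->|[S [hS tS ->]]].
        rewrite /xup /xhom /xcap unlift_none.
        apply: le_trans (lcap_le_arc (S := [set src I]) x0 _); last first.
          by rewrite inE eq_sym src_neq_snk.
        rewrite lcap_form; apply: ch; exists [set src I]; eexists; split=> //.
          by rewrite inE.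
        by rewrite inE eq_sym src_neq_snk.
      rewrite /xhd unlift_none in hS; rewrite /xtl unlift_none in tS.
      rewrite lcap_upd_arc // lcap_form; apply: ch; exists S; eexists; split=> //.
    by rewrite /upd; case: eqP => // /(congr1 val) /=; move: jm; clear; lia.
- move=> s' k f [lo [up [sb lu cuts bd [eqs v0]]]] kk; split.
    by move: kk kk2 kk3; rewrite /final_time /=; clear; nia.
  have lE : lo = up by apply/funext => e; apply: eqs; rewrite addnS ltnS leq_addl.
  rewrite -lE in cuts bd.
  have cf := cuts_conserved cuts.
  have [gf gv] := circulation_almost_equal x0 cf (fun e => introT andP (bd e)).
  exists [ffun i => lo (lift ord_max i)] => //; split; first by rewrite gv.
  by move=> e; rewrite ffunE -(sb (lift ord_max e)).1 lift_max.
Qed.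

Lemma wp_final_settled s : static s -> settled I hmax s -> found s ->
  wp final s (fun s' k => [/\ (k <= final_time)%N, imem s' 4 0 = 1%N &
    max_almost_equal_flow I [ffun e : 'I_m => rmem s' 3 e]]).
Proof.
move=> st [bs mx] fs.
have [|[f1 at_]] := bs; first by move: fs; rewrite /found => /[swap] ->.
apply: (wp_conseq (wp_final st erefl at_)) => s' k f [kk [g gf [gv sg]]]; split=> //.
  by rewrite f.1.
have -> : [ffun e : 'I_m => rmem s' 3 e] = g by apply/ffunP => e; rewrite ffunE.
split=> // h hf; have [y hy] := almost_equal_attains hmaxP hf.
by apply: le_trans gv; case: (mx _ _ hy).
Qed.

Lemma settled_infeasible s : settled I hmax s -> ~ found s -> forall f, ~ almost_equal_flow I f.
Proof.
by move=> [_ mx] nf f hf; have [y /mx[]] := almost_equal_attains hmaxP hf.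
Qed.

End Final.

(** * The whole algorithm *)

Definition init_offsets :=
  ISet 5 (INum 0) (INum 0) ;;
  For 10 eP (ISet 5 (IAdd (iv 10) (INum 1)) (IAdd (IAdd (IGet 5 (iv 10)) eQ) (INum 1))).

Definition init_arc :=
  ISet 1 eM eT ;; ISet 2 eM eS ;; ISet 3 eM (INum 0) ;; RSet 0 eM RZero ;;
  For 10 eM (RSet 0 eM (RAdd (RGet 0 eM) (RGet 0 (iv 10)))).

(** The arc capacity, being the sum of all capacities, serves as the start value of the minimum. *)
Definition init_min :=
  43 :=r RGet 0 eM ;;
  For 10 eM (If (BAnd (BILe (INum 1) (IGet 3 (iv 10))) (BRLt (RGet 0 (iv 10)) (rv 43)))
                (43 :=r RGet 0 (iv 10)) Skip).

Definition init := init_offsets ;; init_arc ;; init_min ;; 4 :=i INum 0.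

Section Init.
Variables (R : realType) (n m q : nat) (I : aemfp R n m 1) (b : seq R).
Variables (P : seq {poly R}) (T : nat -> nat -> nat).
Variables (mf : flow_oracle R) (rt : {poly R} -> seq R).
Local Notation state := (state R).
Local Notation wp := (@wp R q T mf rt).
Local Notation static := (static q I b P).

Lemma stores_input_frame mi mr s s' : frame mi mr s s' ->
  all (fun a => a \notin mi) [:: 0; 1; 2; 3]%N -> all (fun a => a \notin mr) [:: 0; 1; 2]%N ->
  stores_input q b P I s -> stores_input q b P I s'.
Proof.
move=> [fi fr] /and5P[i0 i1 i2 i3 _] /and4P[r0 r1 r2 _] [[[h1 h2 h3 h4 h5] h6] h7 h8 h9 h10].
split=> [|e|e|i ip|i j ip jq].
- by rewrite !fi.
- by rewrite !fi // fr //; exact: h7.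
- by rewrite fi // h8.
- by rewrite fr // h9.
- by rewrite fr // h10.
Qed.

Lemma wp_init_offsets s : stores_input q b P I s ->
  wp init_offsets s (fun s' k => (k <= (size P).+1 * 40)%N /\
    forall i, (i <= size P)%N -> imem s' 5 i = (i * q.+1)%N).
Proof.
move=> si; apply/wp_seq/wp_iset => /=; set s1 := iput _ _ _ _.
have f1 : frame [:: 5]%N [::] s s1 by apply: frame_iput.
pose Inv j (s' : state) := forall i, (i <= j)%N -> imem s' 5 i = (i * q.+1)%N.
apply: (wp_for (size P) 14 Inv) => //.
- move=> s' f; rewrite /= f.1 // f1.1 //; by case: si => -[[]].
- by move=> i; rewrite leqn0 => /eqP ->.
- move=> j s' _ f sj inv; apply: wp_iset => /=; split=> // _ i.
  have -> : imem s' 0 5 = q by rewrite f.1 // f1.1 //; case: si => -[].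
  rewrite sj leq_eqVlt => /orP[/eqP->|lt] /=.
    by rewrite (addn1 j) eqxx inv // !addn1 mulSn addnC; lia.
  by rewrite (addn1 j) (ltn_eqF lt) inv.
- by move=> s' k f inv kk; split=> //; move: kk => /=; clear; lia.
Qed.

Lemma wp_init_arc s : stores_input q b P I s ->
  (forall i, (i <= size P)%N -> imem s 5 i = (i * q.+1)%N) ->
  wp init_arc s (fun s' k => (k <= m.+1 * 100)%N /\ static s').
Proof.
move=> [[[h1 h2 h3 h4 h5] h6] h7 h8 h9 h10] off.
do 3 (apply: wp_seq; apply: wp_iset); apply/wp_seq/wp_rset; rewrite /= h2 h3 h4.
set s1 := rput _ _ _ _.
pose Inv j (s' : state) := rmem s' 0 m = psum (cap I) j /\
  forall e : 'I_m, rmem s' 0 e = cap I e.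
have lm (i : 'I_m) : bump m i = i by rewrite /bump leqNgt ltn_ord.
have neq (e : 'I_m) : (nat_of_ord e == m) = false by rewrite ltn_eqF.
apply: (wp_for m 20 Inv) => //.
- by move=> s' f; rewrite /= f.1.
- split=> /=; first by rewrite !eqxx psum0.
  by move=> e; rewrite neq /=; case: (h7 e).
- move=> j s' jm f sj [I1 I2]; apply: wp_rset => /=; split=> // _.
  have -> : imem s' 0 1 = m by rewrite f.1.
  rewrite /Inv /= sj; split; last by move=> e; rewrite neq.
  by rewrite eqxx (psumS _ jm) I1 -(I2 (Ordinal jm)).
- move=> s' k f [I1 I2] kk; split; first by move: kk => /=; clear; lia.
  have ge a j : a != 10%N -> imem s' a j = imem s1 a j by move=> ha; apply: f.1; rewrite /= inE.
  split; rewrite ?ge //.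
  + move=> e; rewrite ge // /s1 /= /xtl; case: unliftP => [i ->|->] /=; last by rewrite eqxx.
    by rewrite lm neq; case: (h7 i).
  + move=> e; rewrite ge // /s1 /= /xhd; case: unliftP => [i ->|->] /=; last by rewrite eqxx.
    by rewrite lm neq; case: (h7 i).
  + move=> e; rewrite ge // /s1 /= /xhom; case: unliftP => [i ->|->] /=; last by rewrite eqxx.
    by rewrite lm neq h8.
  + move=> e; rewrite /xcap; case: unliftP => [i ->|->] /=; last by rewrite I1 psum_all.
    by rewrite lm.
  + by move=> i ip; rewrite ge //; apply: off.
  + by move=> i ip; rewrite f.2 //=; apply: h9.
  + by move=> i j ip jq; rewrite f.2 //=; apply: h10.
Qed.

Lemma wp_init_min s : static s ->
  wp init_min s (fun s' k => (k <= m.+1 * 60)%N /\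
    is_min_on (cap I) (homologous I ord0) (rmem s' 43 0)).
Proof.
move=> st; apply/wp_seq/wp_rset; rewrite /= (st_m st) -[m]/(nat_of_ord (@ord_max m)) (st_cap st).
rewrite /xcap unlift_none; set s1 := rput _ _ _ _.
have st1 : static s1 by apply: static_rput.
have cap_arc e : cap I e <= arc_cap I.
  by rewrite /arc_cap (bigD1 e) //= lerDl sumr_ge0 // => i _; apply: cap_nneg.
pose Inv j (s' : state) := [/\ rmem s' 43 0 <= arc_cap I,
  rmem s' 43 0 = arc_cap I \/ exists2 e, e \in homologous I ord0 & cap I e = rmem s' 43 0 &
  forall e : 'I_m, e \in homologous I ord0 -> (e < j)%N -> rmem s' 43 0 <= cap I e].
apply: (wp_for m 30 Inv) => //.
- by move=> s' f; rewrite /= f.1 // (st_m st1).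
- by split=> //; left.
- move=> j s' jm f sj [I1 I2 I3].
  have st' : static s' by apply: static_frame f st1.
  have hE : imem s' 3 j = (Ordinal jm \in homologous I ord0).
    by have := st_hom st' (widen_ord (leqnSn m) (Ordinal jm)); rewrite widen_lift /xhom liftK lift_max.
  have cE : rmem s' 0 j = cap I (Ordinal jm).
    by have := st_cap st' (widen_ord (leqnSn m) (Ordinal jm)); rewrite widen_lift /xcap liftK lift_max.
  apply: wp_if; rewrite /= sj hE lt0b cE -ltNge.
    move=> /andP[jH lt]; apply: wp_rset; rewrite /= sj cE; split=> // _; split=> /=.
    + exact: cap_arc.
    + by right; exists (Ordinal jm).
    + move=> e eH; rewrite ltnS leq_eqVlt => /orP[/eqP ej|ej].
        by rewrite (_ : Ordinal jm = e) //; apply: val_inj.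
      by apply: le_trans (ltW lt) _; apply: I3.
  move=> nlt; apply: wp_skip; split=> // _; split=> // e eH.
  rewrite ltnS leq_eqVlt => /orP[/eqP ej|ej]; last exact: I3.
  have eE : Ordinal jm = e by apply: val_inj.
  by move: nlt; rewrite eE eH /= -leNgt.
- move=> s' k f [I1 I2 I3] kk; split; first by move: kk => /=; clear; lia.
  have [e eH] := set0Pn _ (homologous_neq0 I ord0).
  split; last by move=> e' eH'; apply: I3.
  case: I2 => // E; exists e => //; apply/eqP; rewrite eq_le I3 // andbT E.
  exact: cap_arc.
Qed.

Lemma wp_init s : stores_input q b P I s ->
  wp init s (fun s' k => (k <= (size P + m).+1 * 300)%N /\
    [/\ static s', is_min_on (cap I) (homologous I ord0) (rmem s' 43 0) & imem s' 4 0 = 0%N]).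
Proof.
move=> si; apply: wp_seq; apply: (wp_conseq (wp_init_offsets si)) => s1 k1 f1 [kk1 off].
have si1 : stores_input q b P I s1 by apply: stores_input_frame f1 _ _ si.
apply: wp_seq; apply: (wp_conseq (wp_init_arc si1 off)) => s2 k2 f2 [kk2 st2].
apply: wp_seq; apply: (wp_conseq (wp_init_min st2)) => s3 k3 f3 [kk3 mn3].
have st3 : static s3 by apply: static_frame f3 st2.
apply: wp_iset => /=; split; first by move: kk1 kk2 kk3; clear; lia.
by split=> //; apply: static_iput.
Qed.

End Init.

(** A slope that is not positive at 0, or is still positive at the largest admissible minimum, makes
    that end optimal. Only the remaining case starts with a proper bracket. *)
Definition optimize :=
  8 :=r RZero ;; shrink ;;
  If (BAnd (BILe (iv 29) (INum 0)) (BRLt RZero (rv 43)))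
    (8 :=r rv 43 ;; shrink ;;
     If (BILe (INum 1) (iv 29)) (critical ;; newton) Skip) Skip.

Definition almost_equal_maxflow :=
  init ;; optimize ;; If (BILe (INum 1) (iv 4)) final Skip.

Section Optimize.
Variables (R : realType) (n m q : nat) (I : aemfp R n m 1) (b : seq R).
Variables (P : seq {poly R}) (T : nat -> nat -> nat).
Variables (mf : flow_oracle R) (rt : {poly R} -> seq R).
Local Notation state := (state R).
Local Notation D := (deviation I ord0).
Local Notation wp := (@wp R q T mf rt).
Local Notation static := (static q I b P).
Hypothesis pwD : piecewise_poly q b P D.
Hypothesis mfP : flow_oracle_correct mf.
Hypothesis rtP : root_oracle_correct rt.
Hypothesis concD : concave_on_nneg D.
Hypothesis q_gt0 : (0 < q)%N.
Variable L : nat.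
Hypothesis pL : (size P <= 2 ^ L)%N.

Let superD x y g : is_rd b P x g -> 0 <= y -> D y <= D x + g * (y - x) :=
  fun h => supergradient pwD concD h.

Definition optimize_time :=
  (eval_time n m q T L + (eval_time n m q T L + critical_time n m q T L) +
   newton_rounds m * (step_time n m q T L + 320) + 1000)%N.

Lemma edge_gt0 : (0 < m)%N.
Proof. by have [e _] := set0Pn _ (homologous_neq0 I ord0); apply: leq_trans (ltn_ord e). Qed.

Lemma wp_optimize hmax s : static s -> imem s 4 0 = 0%N ->
  is_min_on (cap I) (homologous I ord0) hmax -> rmem s 43 0 = hmax ->
  wp optimize s (fun s' k => (k <= optimize_time)%N /\ settled I hmax s').
Proof.
move=> st nf hmaxP sh.
have hmax0 := hmax_ge0 hmaxP.
(* A dummy bracket strictly around [[0, hmax]], so that the shrinking lemmas apply to the two end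
   points as well. *)
have out0 f vb : outside_done D hmax (is_cut_form I) (is_st_cut_form I) (-1) (hmax + 1) f vb.
  by move=> x v [[/andP[x0 xh] _ _] _]; left; apply/andP; split; lra.
apply/wp_seq/wp_rset => /=; set s1 := rput _ _ _ _.
have st1 : static s1 by apply: static_rput.
have h1 : rmem s1 43 0 = hmax by [].
have b1 : best_ok I hmax s1 by left.
have xb0 : (0 : R) <= 0 <= hmax by rewrite lexx.
apply: wp_seq; apply: (wp_conseq (wp_shrink T rt pwD mfP hmaxP pL st1 erefl xb0 b1)).
move=> s2 k2 f2 [kk2 [t0 [w0 [g0 [[b2 bt2] ev2 sh2 _]]]]].
have st2 : static s2 by apply: static_frame f2 st1.
have h2 : rmem s2 43 0 = hmax by rewrite f2.2.
have [_ ok0 rd0 rec0] := ev2.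
apply: wp_if; rewrite /= h2.
  rewrite leqn0 -ltNge => /andP[/eqP lo hm].
  case: sh2 => [[s0 [_ [L2 _]]]|[_ [E _]]]; last by rewrite E in lo.
  have out2 := shrink_lo superD (out0 (found s1) (rmem s1 31 0)) rd0 ok0 rec0 bt2 s0.
  apply/wp_seq/wp_rset; rewrite /= h2; set s3 := rput _ _ _ _.
  have st3 : static s3 by apply: static_rput.
  have L3 : left_end I s3 0 t0 w0 g0 by [].
  have xb1 : 0 <= hmax <= hmax by rewrite hmax0 lexx.
  apply: wp_seq; apply: (wp_conseq (wp_shrink T rt pwD mfP hmaxP pL st3 erefl xb1 b2)).
  move=> s4 k4 f4 [kk4 [t1 [w1 [g1 [[b4 bt4] ev4 sh4 _]]]]].
  have st4 : static s4 by apply: static_frame f4 st3.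
  have bt24 : better s2 s4 by [].
  have ev24 := evaluated_better bt24 ev2.
  have [_ ok1 rd1 rec1] := ev4.
  case: sh4 => [[s1' [E _]]|[s1' [E [R4 keep]]]]; apply: wp_if; rewrite /= E // => _.
    apply: wp_skip; split; first by move: kk2 kk4; rewrite /optimize_time; clear; lia.
    have out4 := shrink_lo superD out2 rd1 ok1 rec1 bt24 s1'.
    split=> // x v at_; case: (out4 x v at_) => // /andP[hx _].
    by case: at_ => -[/andP[_ xh] _ _] _; move: (lt_le_trans hx xh); rewrite ltxx.
  have out4 := shrink_hi superD out2 rd1 ok1 rec1 bt24 s1'.
  have br4 : bracketed I b P hmax s4 0 hmax.
    exists t0, w0, g0, t1, w1, g1; split=> //; split=> //; exact: keep.
  apply: wp_seq.
  apply: (wp_conseq (wp_critical T pwD mfP rtP concD q_gt0 hmaxP pL st4 hm br4)).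
  move=> s5 k5 f5 [kk5 [lo' [hi' [br5 lh U]]]].
  have st5 : static s5 by apply: static_frame f5 st4.
  have [_ _ _ [lo0 _]] := bracketed_lo br5.
  apply: (wp_conseq (wp_newton T pwD mfP rtP concD q_gt0 hmaxP pL edge_gt0 lo0 U st5 lh br5)).
  move=> s6 k6 f6 [kk6 set6]; split=> //.
  by move: kk2 kk4 kk5 kk6; rewrite /optimize_time; move: (_ * _)%N; clear; lia.
move=> nb; apply: wp_skip; split.
  by move: kk2; rewrite /optimize_time; clear; lia.
split=> // x v at_.
case: sh2 nb => [[s0 [-> _]]|[s0 [-> _]]] /=.
  rewrite negbK => hm.
  have out2 := shrink_lo superD (out0 (found s1) (rmem s1 31 0)) rd0 ok0 rec0 bt2 s0.
  case: (out2 x v at_) => // /andP[x0 _].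
  by case: at_ => -[/andP[_ xh] _ _] _; move: (lt_le_trans x0 (le_trans xh hm)); rewrite ltxx.
move=> _; have out2 := shrink_hi superD (out0 (found s1) (rmem s1 31 0)) rd0 ok0 rec0 bt2 s0.
case: (out2 x v at_) => // /andP[_ x0].
by case: at_ => -[/andP[xx _] _ _] _; move: (lt_le_trans x0 xx); rewrite ltxx.
Qed.

Lemma wp_almost_equal_maxflow s : stores_input q b P I s ->
  wp almost_equal_maxflow s (fun s' k =>
    (k <= (size P + m).+1 * 300 + optimize_time + final_time n m q T L + 20)%N /\
    stores_solution I s').
Proof.
move=> si; apply: wp_seq; apply: (wp_conseq (wp_init T mf rt si)) => s1 k1 f1 [kk1 [st1 hP nf]].
apply: wp_seq; apply: (wp_conseq (wp_optimize st1 nf hP erefl)) => s2 k2 f2 [kk2 set2].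
have st2 : static s2 by apply: static_frame f2 st1.
apply: wp_if => /= fs.
  apply: (wp_conseq (wp_final_settled T rt pwD mfP hP pL st2 set2 fs)).
  move=> s3 k3 f3 [kk3 f opt]; split; last by left.
  by move: kk1 kk2 kk3; clear; lia.
apply: wp_skip; split; first by move: kk1 kk2; clear; lia.
right; split; first by move: fs; rewrite -leqNgt leqn0 => /eqP.
by apply: (settled_infeasible hP set2); apply/negP.
Qed.

End Optimize.

(** * Arithmetic of the running time *)

Section TimeBound.
Local Open Scope nat_scope.

(** Equality holds at [L = 4], which fixes the constant; from 5 on the cube grows by less than a
    factor 2 per step. *)
Lemma cube_le_exp2 L : L ^ 3 <= 4 * 2 ^ L.
Proof.
have [/ltnW|L5] := ltnP 5 L; last by case: L L5 => [|[|[|[|[|[|]]]]]].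
elim: L => [|L IH] //; rewrite leq_eqVlt ltnS => /orP[/eqP <-//|L5].
by rewrite [2 ^ L.+1]expnS; move: (IH L5); rewrite !expnS expn0; nia.
Qed.

(** Rounding the logarithm up costs the second factor 2, as [2 ^ (up_log 2 p).-1 < p] for
    [p > 1]. *)
Lemma up_log_cube p : 0 < p -> up_log 2 p ^ 3 <= 8 * p.
Proof.
move=> p0; have [p1|p1] := ltnP 1 p; last by rewrite (_ : p = 1%N) //; lia.
have [/andP[lt _]] := (up_log_bounds (isT : 1 < 2) p1, tt).
have l0 : 0 < up_log 2 p by rewrite up_log_gt0.
have := cube_le_exp2 (up_log 2 p); move: lt l0; case: (up_log 2 p) => // k /= lt _.
by rewrite [2 ^ k.+1]expnS; lia.
Qed.

(** Only the first summand carries the logarithm [L]. If [L <= m], the flow term covers it;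
    otherwise [m * m * L <= L ^ 3 <= 8 * p], which the size of the input pays for. *)
Lemma work_bound (n m q p L t : nat) : 0 < n -> 0 < q -> 0 < t -> L ^ 3 <= 8 * p ->
  m * m * (L * q + q + n * (n + m) + n * t) <=
  20 * (m * q * (n * m * (n + 2 * m + n ^ 2) * t) + p * q.+1).
Proof.
move=> n0 q0 t0 Lp; set X := n * m * (n + 2 * m + n ^ 2) * t.
have hq : m * m * q * n * t <= m * q * X.
  rewrite (_ : m * q * X = m * m * q * n * t * (n + 2 * m + n ^ 2)); last by rewrite /X; ring.
  by rewrite leq_pmulr //; lia.
have hs : m * m * (n * (n + m)) <= m * q * X.
  rewrite (_ : m * q * X = m * m * (n * (n + 2 * m + n ^ 2)) * (q * t)); last by rewrite /X; ring.
  apply: leq_trans (leq_pmulr _ _); last by rewrite muln_gt0 q0.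
  by rewrite !leq_mul2l; lia.
have hL : m * m * (L * q) <= m * q * X + 8 * (p * q).
  have [Lm|mL] := leqP L m.
    apply: leq_trans (leq_addr _ _).
    rewrite (_ : m * q * X = m * m * ((n + 2 * m + n ^ 2) * q) * (n * t)); last by rewrite /X; ring.
    apply: leq_trans (leq_pmulr _ _); last by rewrite muln_gt0 n0.
    by rewrite leq_mul2l leq_mul2r; lia.
  apply: leq_trans (leq_addl _ _); rewrite !mulnA leq_mul2r; apply/orP; right.
  apply: leq_trans Lp; rewrite !expnS expn0 muln1 -mulnA leq_mul //; [exact: ltnW|].
  by rewrite leq_mul // ltnW.
have hq1 : m * m * q <= m * m * q * n * t.
  by rewrite -[leqRHS]mulnA leq_pmulr // muln_gt0 n0.
have ht : m * m * (n * t) <= m * m * q * n * t.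
  by rewrite (_ : m * m * q * n * t = m * m * (n * t) * q) ?leq_pmulr //; ring.
have pq : p * q <= p * q.+1 by rewrite leq_mul2l leqnSn orbT.
rewrite !mulnDr.
move: hq hs hL hq1 ht pq; move: (m * m * (L * q)) (m * m * (n * t)) (m * m * q * n * t) (m * m * q).
move: (m * q * X) (p * q) (p * q.+1); clear; lia.
Qed.

Lemma step_bound (n m q L : nat) (T : nat -> nat -> nat) (t := T n (n + m)) :
  0 < n -> 0 < m -> 0 < q -> 0 < t ->
  step_time n m q T L + 320 <= 40 * 1000 * (L * q + q + n * (n + m) + n * t).
Proof.
move=> n0 m0 q0 t0; rewrite /step_time /eval_time -/t; clearbody t.
have h1 : L.+2 * q.+1 <= 4 * (L * q) + 4 * q by nia.
have h2 : (n + 2) * (n + m + 4) <= 12 * (n * (n + m)) by nia.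
have h3 : (n + 2) * t <= 3 * (n * t) by nia.
have h4 : 0 < n * t by rewrite muln_gt0 n0.
rewrite [L.+2 * (1100 * _)]mulnCA [L.+2 * (700 * _)]mulnCA [(n + 2) * _]mulnDr.
rewrite [(n + 2) * (2000 * _)]mulnCA [(n + 2) * (3 * _)]mulnCA.
move: h1 h2 h3 h4; move: (L.+2 * q.+1) (L * q) ((n + 2) * (n + m + 4)).
move: (n * (n + m)) ((n + 2) * t) (n * t); clear; move=> a b c d e f; lia.
Qed.

(** [V] majorizes a single step of every phase; the critical points and the Newton rounds need
    O(m^2) steps each, the extraction O(m). *)
Lemma phases_bound (m p V E S F Y : nat) : 0 < m -> E <= V -> S + 320 <= V -> F <= V ->
  Y <= V ->
  (p + m).+1 * 300 +
    (E + (E + (m.+2 * (m.+2 * (S + 40) + 60) + 20)) +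
     (6 * (m.+1 * m.+1) + 7) * (S + 320) + 1000) + (F + m.+2 * Y) + 20 <=
  300 * p + 2000 * (m * m * V).
Proof.
move=> m0 EV SV FV YV.
have h1 : m.+2 * (m.+2 * (S + 40) + 60) <= 9 * (m * m * V).
  have : m.+2 * (S + 40) + 60 <= m.+2 * V by nia.
  by move=> h; apply: leq_trans (leq_mul (leqnn _) h) _; nia.
have h2 : (6 * (m.+1 * m.+1) + 7) * (S + 320) <= 31 * (m * m * V).
  by apply: leq_trans (leq_mul (leqnn _) SV) _; nia.
have h3 : m.+2 * Y <= 3 * (m * m * V).
  by apply: leq_trans (leq_mul (leqnn _) YV) _; nia.
have h4 : V <= m * m * V by rewrite leq_pmull // muln_gt0 m0.
have h5 : m <= m * m * V by rewrite -mulnA leq_pmulr // muln_gt0 m0; lia.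
have h6 : 0 < m * m * V by apply: leq_trans h5.
move: h1 h2 h3 h4 h5 h6; move: (m.+2 * (_ + _)) ((_ + 7) * _) (m.+2 * Y) (m * m * V).
clear - EV FV; lia.
Qed.

Lemma total_bound (n m q p k : nat) (T : nat -> nat -> nat) :
  0 < n -> 0 < m -> 0 < q -> 0 < p -> 0 < T n (n + m) ->
  k <= (p + m).+1 * 300 + optimize_time n m q T (up_log 2 p) +
       final_time n m q T (up_log 2 p) + 20 ->
  k <= 2 * 1000 * 1000 * 1000 *
    (m * q * (n * m * (n + 2 * m + n ^ 2) * T n (n + m)) + p * q.+1).
Proof.
move=> n0 m0 q0 p0 t0; rewrite /optimize_time /critical_time /newton_rounds /final_time.
have Vb := @step_bound n m q (up_log 2 p) T n0 m0 q0 t0.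
have Wb := work_bound m n0 q0 t0 (up_log_cube p0).
set L := up_log 2 p in Vb Wb *; set S := step_time n m q T L in Vb *.
set E := eval_time n m q T L.
have EV : E <= S + 320 by rewrite /S /step_time -/E; clear; lia.
have FV : L.+2 * (600 * q.+1) <= S + 320.
  have : L.+2 * (600 * q.+1) <= L.+2 * (1100 * q.+1) by rewrite leq_mul2l leq_mul2r; lia.
  by rewrite /S /step_time; move: (L.+2 * (600 * _)) (L.+2 * (1100 * _)); clear; lia.
have YV : (n + m + 4) * 500 + T n (n + m) + 200 <= S + 320.
  have : 2000 * (n + m + 4) + 3 * T n (n + m) <=
         (n + 2) * (2000 * (n + m + 4) + 3 * T n (n + m)).
    by rewrite leq_pmull // addn_gt0 orbT.
  rewrite /S /step_time /eval_time.
  by move: (L.+2 * (1100 * _)) (L.+2 * (700 * _)) ((n + 2) * _); clear; lia.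
move: EV FV YV; move: (L.+2 * _) (_ + 200) => F Y EV FV YV kk; apply: leq_trans kk _.
have := phases_bound p m0 EV (leqnn _) FV YV.
have mV := leq_mul (leqnn (m * m)) Vb.
have pq : p <= p * q.+1 by rewrite leq_pmulr.
rewrite [_ * (40 * _ * _)]mulnCA in mV.
move: mV Wb pq; clear; move: (m * m * (S + 320)) => V; move: (m * m * _) => U.
move: (p * q.+1) (m * q * _) => b a; lia.
Qed.

End TimeBound.

Theorem theorem6 (R : realType) :
  exists (prog : cmd) (C : nat),
  forall (n m q : nat) (I : aemfp R n m 1) (b : seq R) (P : seq {poly R})
         (T_MF : nat -> nat -> nat) (mf : flow_oracle R)
         (rt : {poly R} -> seq R) (st : state R),
    (1 <= q)%N ->
    piecewise_poly q b P (deviation I ord0) ->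
    concave_on_nneg (deviation I ord0) ->
    (forall n' m', (0 < T_MF n' m')%N) ->
    flow_oracle_correct mf ->
    root_oracle_correct rt ->
    stores_input q b P I st ->
    exists (st' : state R) (time : nat),
      [/\ exec q T_MF mf rt prog st st' time,
          (time <= C * (m * q * (n * m * (n + 2 * m + n ^ 2) * T_MF n (n + m))
                        + size P * q.+1))%N
        & stores_solution I st'].

Proof.
exists almost_equal_maxflow, (2 * 1000 * 1000 * 1000)%N.
move=> n m q I b P T mf rt s q0 pwD concD T0 mfP rtP si.
have p0 : (0 < size P)%N by case: pwD => -[].
have n0 : (0 < n)%N by apply: leq_ltn_trans (ltn_ord (src I)).
have [//|s' [k [ex [kk sol]]]] :=
  wp_almost_equal_maxflow T pwD mfP rtP concD q0 (L := up_log 2 (size P)) _ si.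
  exact: up_logP.
exists s', k; split=> //.
exact: total_bound n0 (edge_gt0 I) q0 p0 (T0 _ _) kk.
Qed.
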